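(* Let $\Sigma\subset\mathbb R^{n+1}$ be a closed set which is parabolic ADR with constant $M$ and which satisfies the weak time-synchronized two cube condition with constant $\gamma_1\in(0,1)$. Then $\Sigma$ contains uniform big pieces of Lip(1,1/2) graphs with constants $(\epsilon,b)$ depending only on $n,M,\gamma_1$.
   Context: Notation: points $(X,t)=(x,x_n,t)\in\mathbb R^{n-1}\times\mathbb R\times\mathbb R$; $d_p((X,t),(Y,s))=|X-Y|+|t-s|^{1/2}$ (parabolic distance, used for all diameters/distances); $Q_r(X,t)=\{(Y,s):|y_i-x_i|<r\ (i\le n),\ |t-s|<r^2\}$; $\sigma=\mathcal H^{n+1}_p$ restricted to $\Sigma$ ($\mathcal H^{n+1}_p$ = Hausdorff measure of dimension $n+1$ built with $d_p$-diameters); $\Delta(X,t,r)=\Sigma\cap Q_r(X,t)$; $T_0,T_1$ are the infimum and supremum of time coordinates of points of $\Sigma$. Parabolic ADR with constant $M$: $M^{-1}r^{n+1}\le\sigma(\Delta(X,t,r))\le Mr^{n+1}$ for $(X,t)\in\Sigma$, $T_0<t<T_1$, $0<r<\operatorname{diam}\Sigma$. Weak time-synchronized two cube condition with constant $\gamma_1$: for all $(X,t)\in\Sigma$ with $T_0<t<T_1$ and $0<r<\operatorname{diam}\Sigma$ there are $Q_\rho(X_1,t_1),Q_\rho(X_2,t_2)\subset Q_r(X,t)$ with $\gamma_1r\le\rho<r$ and $t_1=t_2$ such that $Q_\rho(X_i,t_i)\cap(\mathbb R^n\times(T_0,T_1))$, $i=1,2$, belong to different connected components of $\mathbb R^{n+1}\setminus\Sigma$.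 A function $\psi:\mathbb R^{n-1}\times\mathbb R\to\mathbb R$ is Lip(1,1/2) with constant $b$ if $|\psi(x,t)-\psi(y,s)|\le b(|x-y|+|t-s|^{1/2})$. Let $\pi$ be the orthogonal projection onto $\{x_n=0\}$, identified with $\mathbb R^n$, and $\mathcal H^n$ the $n$-dimensional (Euclidean) Hausdorff measure. $\Sigma$ contains uniform big pieces of Lip(1,1/2) graphs with constants $(\epsilon,b)$ if for every $(X,t)\in\Sigma$ with $T_0<t<T_1$ and every $0<R<\operatorname{diam}\Sigma$ there is, after a possible rotation in the space variables, a Lip(1,1/2) function $\psi$ with constant $b$ such that $\mathcal H^n(\pi(\Sigma_\psi\cap\Delta(X,t,R)))\ge\epsilon R^{n+1}$, where $\Sigma_\psi=\{(x,x_n,t):x_n=\psi(x,t)\}$. *)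

(* Defs.v *)
From HB Require Import structures.
From mathcomp Require Import all_boot all_order all_algebra.
From mathcomp Require Import all_classical all_reals all_analysis.
Set Implicit Arguments. Unset Strict Implicit. Unset Printing Implicit Defensive.
Import Order.TTheory GRing.Theory Num.Theory.
Import numFieldNormedType.Exports.
Local Open Scope classical_set_scope.
Local Open Scope ring_scope.

Section Hausdorff.
Context {R : realType} {T : Type} (d : T -> T -> R).

Definition diamd (A : set T) : \bar R :=
  ereal_sup ([set (d p.1 p.2)%:E | p in A `*` A] `|` [set 0%E]).

Definition hausdorff_content (s : nat) (delta : R) (A : set T) : \bar R :=
  ereal_inf [set (\sum_(k <oo) ((fine (diamd (F k))) ^+ s)%:E)%E
            | F in [set F : nat -> set T |
                     A `<=` \bigcup_k F k /\ forall k, (diamd (F k) <= delta%:E)%E]].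

Definition hausdorff_measure (s : nat) (A : set T) : \bar R :=
  ereal_sup [set hausdorff_content s delta A | delta in [set delta : R | 0 < delta]].
End Hausdorff.

Definition enorm {R : realType} {k : nat} (v : 'rV[R]_k) : R :=
  Num.sqrt (\sum_(i < k) (v ord0 i) ^+ 2).

(* The paper's dimension n is m.+1 here: a point (X,t) of R^{n+1}
   has space part X : 'rV_(m.+1) (last coordinate ord_max is x_n) and time t. *)
Notation ppoint R m := ('rV[R]_(m.+1) * R)%type.

Definition dpar {R : realType} {m : nat} (P Q : ppoint R m) : R :=
  enorm (P.1 - Q.1) + Num.sqrt `|P.2 - Q.2|.

Definition pcube {R : realType} {m : nat} (P : ppoint R m) (r : R) : set (ppoint R m) :=
  [set Q : ppoint R m | (forall i, `|Q.1 ord0 i - P.1 ord0 i| < r) /\ `|Q.2 - P.2| < r ^+ 2].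

Definition sigma {R : realType} {m : nat} (A : set (ppoint R m)) : \bar R :=
  hausdorff_measure (@dpar R m) m.+2 A.

Definition Delta {R : realType} {m : nat} (S : set (ppoint R m)) (P : ppoint R m) (r : R) :=
  S `&` pcube P r.

Definition T0 {R : realType} {m : nat} (S : set (ppoint R m)) : \bar R :=
  ereal_inf [set P.2%:E | P in S].
Definition T1 {R : realType} {m : nat} (S : set (ppoint R m)) : \bar R :=
  ereal_sup [set P.2%:E | P in S].

Definition pdiam {R : realType} {m : nat} (S : set (ppoint R m)) : \bar R :=
  diamd (@dpar R m) S.

Definition admissible {R : realType} {m : nat} (S : set (ppoint R m)) (P : ppoint R m) (r : R) :=
  [/\ S P, (T0 S < P.2%:E)%E, (P.2%:E < T1 S)%E, 0 < r & (r%:E < pdiam S)%E].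

Definition parabolic_ADR {R : realType} {m : nat} (S : set (ppoint R m)) (M : R) :=
  forall P r, admissible S P r ->
    ((M^-1 * r ^+ m.+2)%:E <= sigma (Delta S P r))%E /\
    (sigma (Delta S P r) <= (M * r ^+ m.+2)%:E)%E.

Definition slab {R : realType} {m : nat} (S : set (ppoint R m)) : set (ppoint R m) :=
  [set Q : ppoint R m | (T0 S < Q.2%:E)%E /\ (Q.2%:E < T1 S)%E].

Definition different_components {R : realType} {m : nat} (S A B : set (ppoint R m)) :=
  exists p q, [/\ A p, B q,
    A `<=` connected_component (~` S) p,
    B `<=` connected_component (~` S) q &
    ~ connected_component (~` S) p q].

Definition weak_ts_two_cube {R : realType} {m : nat} (S : set (ppoint R m)) (g1 : R) :=
  forall P r, admissible S P r ->
    exists (rho : R) (X1 X2 : 'rV[R]_(m.+1)) (t12 : R),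
      [/\ g1 * r <= rho, rho < r,
          pcube (X1, t12) rho `<=` pcube P r,
          pcube (X2, t12) rho `<=` pcube P r &
          different_components S (pcube (X1, t12) rho `&` slab S)
                                 (pcube (X2, t12) rho `&` slab S)].

Definition xpart {R : realType} {m : nat} (X : 'rV[R]_(m.+1)) : 'rV[R]_m :=
  \row_(i < m) X ord0 (widen_ord (leqnSn m) i).

(* projection pi onto {x_n = 0}, identified with R^n = R^m x R *)
Definition proj {R : realType} {m : nat} (P : ppoint R m) : ('rV[R]_m * R)%type :=
  (xpart P.1, P.2).

Definition edist {R : realType} {m : nat} (p q : ('rV[R]_m * R)%type) : R :=
  Num.sqrt (enorm (p.1 - q.1) ^+ 2 + (p.2 - q.2) ^+ 2).

Definition Hn {R : realType} {m : nat} (A : set ('rV[R]_m * R)) : \bar R :=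
  hausdorff_measure (@edist R m) m.+1 A.

Definition lip11_2 {R : realType} {m : nat} (psi : 'rV[R]_m -> R -> R) (b : R) :=
  forall x t y s, `|psi x t - psi y s| <= b * (enorm (x - y) + Num.sqrt `|t - s|).

Definition graph {R : realType} {m : nat} (psi : 'rV[R]_m -> R -> R) : set (ppoint R m) :=
  [set P : ppoint R m | P.1 ord0 ord_max = psi (xpart P.1) P.2].

Definition rotation {R : realType} {k : nat} (O : 'M[R]_k) :=
  O *m O^T = 1%:M /\ \det O = 1.

Definition rot {R : realType} {m : nat} (O : 'M[R]_(m.+1)) (P : ppoint R m) : ppoint R m :=
  (P.1 *m O, P.2).

(* uniform big pieces of Lip(1,1/2) graphs; the rotation is applied to the
   whole configuration (the set, the center, hence the cubes are taken in
   the rotated coordinates) *)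
Definition UBP_lip_graphs {R : realType} {m : nat} (S : set (ppoint R m)) (eps b : R) :=
  forall P r, admissible S P r ->
    exists (O : 'M[R]_(m.+1)) (psi : 'rV[R]_m -> R -> R),
      [/\ rotation O, lip11_2 psi b &
        ((eps * r ^+ m.+2)%:E <=
           Hn (proj @` (graph psi `&` Delta (rot O @` S) (rot O P) r)))%E].

(* Main.v *)
(** Two time-synchronized cubes at a point [P1], at a scale comparable to [r],
    have centers differing by a spatial vector; rotate it to the vertical axis.
    Every vertical line over a base box then crosses [S], which gives a section
    [f] of [S] over the box.  A pair of section points is steep at scale
    [rho = 2^-j] when their heights differ by about [h rho] over a base distance
    at most [2 rho].  Near a steep pair, either [S] meets [~ h] consecutive slabs
    of height [rho] over a base box of size [rho], or there is a box of size
    comparable to [rho], free of [S], all of whose vertical lines meet [S] within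
    [O(h rho)] both above and below it: if three free slabs lie below, between
    and above the two points, then either the middle slab is not connected to
    either of the others, or a cube at one of the points is cut off from the slabs
    around it.  By upper and lower regularity, the first alternative occupies a
    proportion [O(1/h)] of the base (a weak type inequality for dyadic cells).
    In the second, each gap between consecutive points of [S] on a vertical line
    is charged [O(1)] times, so the bad scales over a base point number [O(1)] on
    average.  Coloring heights modulo 3 at each bad scale and keeping the points
    with prescribed colors leaves a fixed proportion of the base without steep
    pairs.  All this is done at a finite resolution [2^-J]; an ultralimit as [J]
    tends to infinity is a compact piece of a Lip(1,1/2) graph inside [S]. *)

Require Import Defs.
From HB Require Import structures.
From mathcomp Require Import all_boot all_order all_algebra.
From mathcomp Require Import all_classical all_reals all_analysis.
From mathcomp Require Import ring lra zify.
Set Implicit Arguments. Unset Strict Implicit. Unset Printing Implicit Defensive.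
Import Order.TTheory GRing.Theory Num.Theory.
Import numFieldNormedType.Exports.

(** * Combinatorics of scales *)

(** The hypotheses apply only at centers whose time lies strictly between [T0] and [T1], and they
    are needed all over the window of a chart; the construction is therefore moved to a nearby point
    of [S] whose time is far from both ends in proportion to the scale. Nothing is used about the
    section [f] beyond its range and its graph lying in [S]: it is neither continuous nor
    measurable, and additivity of the Hausdorff measure is replaced by finite subadditivity and by
    superadditivity on families a positive distance apart. This is the reason for working on finite
    grids, where all estimates are counts with constants independent of the resolution. The slope is
    tied to the tower length: a free slab has to be found below, between and above a steep pair,
    while towers must be rare enough to occupy at most half of the unit box. Mass does not pass to
    the limit by itself: a cover of the projected limit with too small a total is thickened and
    carried back to a fine grid, where it contradicts the number of selected cells. The limit set
    has to be rich for this, so limits of all selections are taken. *)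

Section Coloring.
Variables (Omega : finType) (bad : nat -> pred Omega) (col : nat -> Omega -> 'I_3).

(* Derandomized form of: keep x iff, at each of its bad scales, x has the
   randomly chosen color; x survives with probability 3^-(number of bad scales). *)
Lemma choose_colors (l : seq nat) (G : {set Omega}) (u : Omega -> nat) :
  exists G' : {set Omega}, [/\ G' \subset G,
    (forall j x y, j \in l -> x \in G' -> y \in G' -> bad j x -> bad j y ->
       col j x = col j y) &
    \sum_(x in G) u x <= \sum_(x in G') u x * 3 ^ count (bad^~ x) l].
Proof.
elim: l G u => [|j l IH] G u.
  exists G; split=> //; by apply: leq_sum => x _; rewrite muln1.
pose GC (C : 'I_3) := [set x in G | bad j x ==> (col j x == C)].
(* A point that is not bad at [j] belongs to all three color classes, a bad one to exactly one. With
   bad points weighted by 3 the classes together weigh three times the whole, so some class keeps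
   the total. *)
pose v x := u x * 3 ^ bad j x.
have [C hC] : exists C, \sum_(x in G) u x <= \sum_(x in GC C) v x.
  apply/existsP; apply: contraT; rewrite negb_exists => /forallP hlt.
  have : \sum_(C : 'I_3) \sum_(x in GC C) v x < \sum_(C : 'I_3) \sum_(x in G) u x.
    have hC C : \sum_(x in GC C) v x < \sum_(x in G) u x by rewrite ltnNge.
    rewrite !big_ord_recl !big_ord0 !addn0.
    by rewrite -addSn; apply: leq_add => //; apply: leq_add; apply: ltnW.
  suff -> : \sum_(C : 'I_3) \sum_(x in GC C) v x = \sum_(C : 'I_3) \sum_(x in G) u x.
    by rewrite ltnn.
  rewrite [RHS]exchange_big /=.
  transitivity (\sum_(x in G) \sum_(C : 'I_3) (if bad j x ==> (col j x == C) then v x else 0)).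
    rewrite exchange_big /=; apply: eq_bigr => C _.
    rewrite -big_mkcondr; apply: eq_bigl => x; by rewrite inE.
  apply: eq_bigr => x _; rewrite /v; case: (bad j x) => /=.
    rewrite -big_mkcond (eq_bigl (pred1 (col j x))); last by move=> C; rewrite /= eq_sym.
    by rewrite big_pred1_eq sum_nat_const card_ord mulnC.
  by rewrite muln1.
have [G' [sG' hG' hs]] := IH (GC C) v.
exists G'; split.
- by apply: fintype.subset_trans sG' _; apply/fintype.subsetP => x; rewrite inE => /andP[].
- move=> i x y; rewrite inE => /orP[/eqP ->|]; last exact: hG'.
  move=> /(fintype.subsetP sG'); rewrite inE => /andP[_ /implyP hx].
  move=> /(fintype.subsetP sG'); rewrite inE => /andP[_ /implyP hy].
  by move=> /hx /eqP -> /hy /eqP ->.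
- apply: leq_trans hC (leq_trans hs _); apply: leq_sum => x _.
  by rewrite /v /= expnD mulnA.
Qed.

(** Points with more than [N] bad scales are counted by Markov's inequality, which gives the last
    sum; the others lose at most the factor [3 ^ N] in [choose_colors]. *)
Lemma extract_unbad (l : seq nat) (G : {set Omega}) (N : nat) :
  exists G' : {set Omega}, [/\ G' \subset G,
    (forall j x y, j \in l -> x \in G' -> y \in G' -> bad j x -> bad j y ->
       col j x = col j y) &
    #|G| * N.+1 <= N.+1 * 3 ^ N * #|G'| + \sum_(j <- l) #|[set x | bad j x]|].
Proof.
pose G0 := [set x in G | count (bad^~ x) l <= N].
have [G' [sG' hG' hs]] := choose_colors l G0 (fun=> 1).
exists G'; split=> //.
  by apply: fintype.subset_trans sG' _; apply/fintype.subsetP => x; rewrite inE => /andP[].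
rewrite -(cardsID [set x | count (bad^~ x) l <= N] G) mulnDl; apply: leq_add.
  have -> : G :&: [set x | count (bad^~ x) l <= N] = G0.
    by apply/setP => x; rewrite !inE.
  rewrite mulnC -mulnA leq_mul2l /= -sum1_card (leq_trans hs) //.
  rewrite -sum1_card big_distrr /=; apply: leq_sum => x xG'.
  rewrite mul1n muln1 leq_exp2l //.
  by move/(fintype.subsetP sG'): xG'; rewrite inE => /andP[].
have -> : \sum_(j <- l) #|[set x | bad j x]| = \sum_x count (bad^~ x) l.
  under eq_bigr do rewrite -sum1_card.
  under eq_bigr => j _ do rewrite big_mkcond /=.
  rewrite exchange_big /=; apply: eq_bigr => x _.
  rewrite -sum1_count [RHS]big_mkcond; by apply: eq_bigr => j _; rewrite inE.
rewrite (bigID (mem (G :\: [set x | count (bad^~ x) l <= N]))) /=.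
apply: leq_trans (leq_addr _ _).
rewrite -sum1_card big_distrl /=; apply: leq_sum => x; rewrite !inE => /andP[h _].
by rewrite mul1n ltnNge.
Qed.
End Coloring.

Lemma card_sum1 (T : finType) (A : pred T) : #|[set x | A x]| = \sum_x A x.
Proof. by rewrite -sum1_card big_mkcond /=; apply: eq_bigr => x _; rewrite inE; case: (A x). Qed.

(** * A weak type inequality for nested cells *)

Section Dyadic.
Variables (Omega : finType) (T : eqType) (cell : nat -> Omega -> T).
Variables (near : nat -> rel Omega) (J C : nat) (v : nat -> nat).
Hypothesis cell_nest : forall i j x y, i <= j -> cell j x = cell j y -> cell i x = cell i y.
Hypothesis near_nest : forall i j x y, i <= j -> near j x y -> near i x y.
Hypothesis near_cell : forall j x x' y y', cell j x = cell j x' -> cell j y = cell j y' ->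
  near j x y = near j x' y'.
Hypothesis near_sym : forall j x y, near j x y = near j y x.
Hypothesis near_refl : forall j x, near j x x.
Hypothesis v_gt0 : forall j, 0 < v j.
Hypothesis cell_card : forall j x, j <= J -> \sum_y (cell j y == cell j x) = v j.
Hypothesis near_card : forall j x, j <= J -> \sum_y near j x y <= C * v j.

(** Double counting of the pairs of [x] in [B] and [z] in [X] with [near i x z]: each [x] sees at
    least a full cell of such [z], each [z] at most [C * v i] such [x]. *)
Lemma card_nbhd (i j : nat) (X : pred Omega) (B : pred Omega) : i <= j -> j <= J ->
  (forall x, B x -> exists y, near i x y /\ forall z, cell j z = cell j y -> X z) ->
  #|[set x | B x]| * v j <= #|[set x | X x]| * (C * v i).
Proof.
move=> ij jJ hB; rewrite !card_sum1 !big_distrl /=.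
apply: (@leq_trans (\sum_x \sum_y B x * (X y * near i x y))).
  apply: leq_sum => x _; have [Bx|] := boolP (B x); last by rewrite mul0n.
  have [y [xy hy]] := hB _ Bx; rewrite -(cell_card y jJ) mul1n.
  apply: leq_sum => z _; case: eqP => // zy; rewrite (hy _ zy) !mul1n.
  by rewrite (@near_cell i x x z y) ?xy //; apply: cell_nest zy.
rewrite exchange_big /=; apply: leq_sum => y _; case: (X y).
  rewrite mul1n; apply: leq_trans (near_card y (leq_trans ij jJ)).
  by apply: leq_sum => x _; rewrite mul1n near_sym; case: (B x); rewrite // mul1n.
by under eq_bigr do rewrite mul0n muln0; rewrite big1.
Qed.

Variables (k : Omega -> nat) (lambda : nat).

(** Stopping cells as in a Calderon-Zygmund decomposition: the average of [k] over a heavy cell is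
    at least [lambda], and a first heavy cell lies in no coarser heavy one. *)
Definition heavy j x := lambda * v j <= \sum_(z | cell j z == cell j x) k z.
Definition first_heavy j x := heavy j x && all (fun i => ~~ heavy i x) (iota 0 j).

Lemma heavy_cell j x y : cell j x = cell j y -> heavy j x = heavy j y.
Proof. by move=> e; rewrite /heavy e. Qed.

Lemma first_heavy_cell j x y : cell j x = cell j y -> first_heavy j x = first_heavy j y.
Proof.
move=> e; rewrite /first_heavy (heavy_cell e); congr (_ && _).
apply: eq_in_all => i; rewrite mem_iota => /andP[_]; rewrite add0n => ij.
by rewrite (heavy_cell (cell_nest (ltnW ij) e)).
Qed.

Lemma first_heavy_uniq i j x : first_heavy i x -> first_heavy j x -> i = j.
Proof.
move=> /andP[hi /allP ni] /andP[hj /allP nj]; apply/eqP.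
rewrite eqn_leq; apply/andP; split; rewrite leqNgt; apply/negP => lt.
  by move: (ni j); rewrite mem_iota lt hj => /(_ isT).
by move: (nj i); rewrite mem_iota lt hi => /(_ isT).
Qed.

Lemma heavy_first j x : heavy j x -> exists2 i, i <= j & first_heavy i x.
Proof.
move=> hj; have ex : exists i, heavy i x by exists j.
case: (ex_minnP ex) => i hi min; exists i; first exact: min.
rewrite /first_heavy hi; apply/allP => l; rewrite mem_iota => /andP[_].
by rewrite add0n ltnNge => /negP h; apply/negP => /min.
Qed.

(** The neighborhood of [x] is a union of cells with at most [C * v j] points in all; if each of
    them had average below [lambda], the sum over it would be below [lambda * (C * v j)]. *)
Lemma near_sum_heavy j x : j <= J -> 0 < lambda -> 0 < C ->
  lambda * (C * v j) <= \sum_(y | near j x y) k y -> exists2 y, near j x y & heavy j y.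
Proof.
move=> jJ l0 C0 hs.
suff /existsP[y /andP[]] : [exists y, near j x y && heavy j y] by exists y.
apply: contraT; rewrite negb_exists => /forallP hn.
have hlt y : near j x y -> \sum_(z | cell j z == cell j y) k z < lambda * v j.
  by move=> xy; move: (hn y); rewrite xy /= /heavy ltnNge.
suff : (\sum_(y | near j x y) k y) * v j < lambda * (C * v j) * v j.
  by rewrite ltn_mul2r v_gt0 /= ltnNge hs.
have -> : (\sum_(y | near j x y) k y) * v j =
          \sum_(y | near j x y) \sum_(z | cell j z == cell j y) k z.
  rewrite big_distrl /= (exchange_big_dep (near j x)) /=; last first.
    by move=> y z xy /eqP zy; rewrite (@near_cell j x x z y).
  apply: eq_bigr => z xz; rewrite (eq_bigl (fun y => cell j y == cell j z)); last first.
    move=> y; rewrite eq_sym; case: eqP => [e|]; rewrite ?andbT ?andbF //.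
    by rewrite (@near_cell j x x y z).
  by rewrite sum_nat_cond_const card_sum1 cell_card // mulnC.
have h1 : \sum_(y | near j x y) (\sum_(z | cell j z == cell j y) k z).+1 <=
          C * v j * (lambda * v j).
  apply: (@leq_trans (\sum_(y | near j x y) lambda * v j)); first by apply: leq_sum => y /hlt.
  by rewrite sum_nat_cond_const leq_mul2r card_sum1 near_card // orbT.
apply: (@leq_trans (C * v j * (lambda * v j))); last by lia.
(* Strictness comes from the term of [x] itself, present because [near] is reflexive. *)
apply: leq_trans h1; rewrite (bigD1 x) //= [X in _ < X](bigD1 x) //= -addSn.
by apply: leq_add => //; apply: leq_sum => y _.
Qed.

(** The neighborhoods of the first heavy cells cover [B]. These cells are disjoint, also across
    levels, so [lambda] times their total size is at most the sum of [k]; passing to neighborhoods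
    costs the factor [C]. *)
Lemma weak_type (B : pred Omega) : 0 < lambda -> 0 < C ->
  (forall x, B x -> exists2 j, j <= J & lambda * (C * v j) <= \sum_(y | near j x y) k y) ->
  lambda * #|[set x | B x]| <= C * \sum_x k x.
Proof.
move=> l0 C0 hB.
pose Hj j x := first_heavy j x.
pose Nj j x := [exists y, near j x y && Hj j y].
have NC j : j <= J -> #|[set x | Nj j x]| <= #|[set x | Hj j x]| * C.
  move=> jJ; rewrite -(leq_pmul2r (v_gt0 j)) -mulnA.
  apply: (@card_nbhd j j (Hj j) (Nj j)) => // x /existsP[y /andP[xy hy]].
  by exists y; split=> // z zy; rewrite /Hj (first_heavy_cell zy).
have HC j : j <= J -> lambda * #|[set x | Hj j x]| <= \sum_(x | Hj j x) k x.
  move=> jJ; rewrite -(leq_pmul2r (v_gt0 j)) mulnAC.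
  rewrite -sum1_card big_distrr big_distrl /=.
  apply: (@leq_trans (\sum_(x | Hj j x) \sum_(z | cell j z == cell j x) k z)).
    rewrite (eq_bigl (Hj j)); last by move=> x; rewrite inE.
    by apply: leq_sum => x /andP[h _]; rewrite muln1.
  rewrite (exchange_big_dep (Hj j)) /=; last first.
    by move=> x z hx /eqP zx; rewrite /Hj (first_heavy_cell zx).
  apply: leq_sum => z hz.
  rewrite (eq_bigl (fun y => cell j y == cell j z)); last first.
    move=> y; rewrite eq_sym; case: eqP => [e|]; rewrite ?andbT ?andbF //.
    by rewrite /Hj (first_heavy_cell e).
  by rewrite sum_nat_cond_const card_sum1 cell_card // mulnC.
have hcov : #|[set x | B x]| <= \sum_(j < J.+1) #|[set x | Nj j x]|.
  rewrite card_sum1; under [X in _ <= X]eq_bigr do rewrite card_sum1.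
  rewrite exchange_big /=; apply: leq_sum => x _.
  have [/hB[j jJ hs]|//] := boolP (B x).
  have [y xy hy] := near_sum_heavy jJ l0 C0 hs.
  have [i ij fi] := heavy_first hy.
  rewrite (bigD1 (Ordinal (leq_trans ij jJ : i < J.+1))) //=.
  apply: leq_trans (leq_addr _ _); rewrite lt0b.
  by apply/existsP; exists y; rewrite (near_nest ij xy).
apply: (@leq_trans (\sum_(j < J.+1) C * \sum_(x | Hj j x) k x)).
  apply: (leq_trans (leq_mul (leqnn _) hcov)); rewrite big_distrr /=.
  apply: leq_sum => j _; have jJ : j <= J by rewrite -ltnS.
  apply: (leq_trans (leq_mul (leqnn _) (NC _ jJ))).
  by rewrite mulnA mulnC leq_mul2l HC // orbT.
rewrite -big_distrr leq_mul2l /=; apply/orP; right.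
under eq_bigr => j _ do rewrite big_mkcond /=.
rewrite exchange_big /=; apply: leq_sum => x _.
have [/existsP[j0 hj]|] := boolP [exists j : 'I_J.+1, Hj j x].
  rewrite (bigD1 j0) //= hj big1 ?addn0 // => j jj0.
  case: ifP => // h; case/eqP: jj0; apply/val_inj; exact: first_heavy_uniq h hj.
rewrite negb_exists => /forallP h; rewrite big1 // => j _.
by rewrite (negbTE (h j)).
Qed.

End Dyadic.

Lemma sum_interval a b n :
  \sum_(s < n) ((a <= s) && (s < a + b)) = minn n (a + b) - minn n a.
Proof.
elim: n => [|n IH]; first by rewrite big_ord0; lia.
by rewrite big_ord_recr /= IH; lia.
Qed.

(** * Gaps between consecutive hits on one vertical line *)

Section Gaps.
Variables (V : nat) (hit : pred 'I_V) (J1 A D : nat).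

Definition gap (i j : 'I_V) :=
  [&& i < j, hit i, hit j & [forall l : 'I_V, (i < l) && (l < j) ==> ~~ hit l]].
(** With [2 ^ J1] rows per unit of height, [g] rows have length between [2 ^ -A] and [2 ^ D] times
    the scale [2 ^ -s]. *)
Definition in_scale (g s : nat) := (2 ^ (J1 - s) <= 2 ^ A * g) && (g <= 2 ^ (J1 - s + D)).
Definition gap_scale s := [exists i, [exists j, gap i j && in_scale (j - i) s]].

Lemma gap_uniq i j j' : gap i j -> gap i j' -> j = j'.
Proof.
move=> /and4P[ij hi hj /forallP gj] /and4P[ij' _ hj' /forallP gj'].
apply/val_inj/eqP; rewrite eqn_leq; apply/andP; split; rewrite leqNgt; apply/negP => lt.
  by move: (gj j'); rewrite ij' lt hj'.
by move: (gj' j); rewrite ij lt hj.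
Qed.

Lemma count_scales J g : J <= J1 -> \sum_(s < J.+1) in_scale g s <= A + D + 1.
Proof.
move=> JJ1.
have [/existsP ex|] := boolP [exists s : 'I_J.+1, in_scale g s]; last first.
  rewrite negb_exists => /forallP h; rewrite big1 // => s _.
  by move: (h s) => /negbTE ->.
have ex' : exists s, (s <= J) && in_scale g s.
  by case: ex => s hs; exists s; rewrite -ltnS ltn_ord.
case: (ex_minnP ex') => s0 /andP[s0J /andP[h1 h2]] min.
apply: (@leq_trans (\sum_(s < J.+1) ((s0 <= s) && (s < s0 + (A + D + 1))))).
  2: by rewrite sum_interval; lia.
apply: leq_sum => s _.
case Ps : (in_scale g s) => //=; rewrite lt0b.
have sJ : s <= J by rewrite -ltnS.
rewrite min ?Ps ?sJ //=; move: Ps => /andP[_ h3].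
have : 2 ^ (J1 - s0) <= 2 ^ (A + (J1 - s + D)).
  by rewrite expnD; apply: (leq_trans h1); rewrite leq_mul2l h3 orbT.
rewrite leq_exp2l //; lia.
Qed.

(** A gap is determined by its lower end, which is a hit, and it serves at most [A + D + 1]
    scales. *)
Lemma sum_gap_scale J : J <= J1 ->
  \sum_(s < J.+1) gap_scale s <= (A + D + 1) * #|[set i | hit i]|.
Proof.
move=> JJ1; rewrite card_sum1.
apply: (@leq_trans (\sum_(s < J.+1) \sum_i [exists j, gap i j && in_scale (j - i) s])).
  apply: leq_sum => s _; case: (boolP (gap_scale s)) => // /existsP[i hi].
  by rewrite (bigD1 i) //= hi.
rewrite exchange_big big_distrr /=; apply: leq_sum => i _.
have [/existsP[j0 g0]|] := boolP [exists j, gap i j]; last first.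
  rewrite negb_exists => /forallP h; rewrite big1 // => s _.
  by case: existsP => // -[j /andP[hj _]]; move: (h j); rewrite hj.
have -> : hit i by case/and4P: g0.
rewrite muln1; apply: leq_trans (count_scales (j0 - i) JJ1); apply: leq_sum => s _.
by case: existsP => // -[j /andP[/(gap_uniq g0) <- ->]].
Qed.
End Gaps.

(** * The anisotropic dyadic grid *)

Section Grid.
Variables (iota : finType) (e : iota -> nat) (J1 K N : nat).
Let q := \sum_i e i.
Let Omega := {ffun iota -> 'I_N}.
(** Lengths are in units of the finest level [J1]. Direction [i] scales with the power [e i], which
    will be 2 for time, so [q] is the homogeneous dimension. *)
Definition side j i := 2 ^ (e i * (J1 - j)).
Definition gcell j (w : Omega) : {ffun iota -> nat} := [ffun i => w i %/ side j i].
Definition gnear j : rel Omega := fun w w' =>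
  [forall i, (w i %/ side j i <= w' i %/ side j i + K) && (w' i %/ side j i <= w i %/ side j i + K)].

Lemma side_gt0 j i : 0 < side j i. Proof. by rewrite expn_gt0. Qed.

Lemma gcellP j (w w' : Omega) : reflect (forall i, w i %/ side j i = w' i %/ side j i) (gcell j w == gcell j w').
Proof.
apply: (iffP eqP) => [/ffunP h i|h]; first by move: (h i); rewrite !ffunE.
by apply/ffunP => i; rewrite !ffunE.
Qed.

Lemma side_dvd j j' i : j <= j' -> side j i = side j' i * 2 ^ (e i * (J1 - j - (J1 - j'))).
Proof. by move=> jj'; rewrite /side -expnD -mulnDr; congr (2 ^ (_ * _)); lia. Qed.

Lemma gcell_nest j j' w w' : j <= j' -> gcell j' w = gcell j' w' -> gcell j w = gcell j w'.
Proof.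
move=> jj' /eqP/gcellP h; apply/eqP/gcellP => i.
by rewrite (side_dvd i jj') !divnMA h.
Qed.

Lemma gnear_nest j j' w w' : j <= j' -> gnear j' w w' -> gnear j w w'.
Proof.
move=> jj' /forallP h; apply/forallP => i; rewrite (side_dvd i jj') !divnMA.
have {h} := h i; move: (w i %/ _) (w' i %/ _) => a b /andP[ab ba].
have d0 : 0 < 2 ^ (e i * (J1 - j - (J1 - j'))) by rewrite expn_gt0.
move: (2 ^ _) d0 => d d0.
have aux x y : x <= y + K -> x %/ d <= y %/ d + K.
  move=> xy; apply: (leq_trans (leq_div2r d xy)).
  rewrite -ltnS ltn_divLR //.
  have hy : y < (y %/ d).+1 * d by rewrite -ltn_divLR.
  have hK : K <= K * d by rewrite leq_pmulr.
  rewrite -[X in _ < X * _]addSn mulnDl; lia.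
by rewrite !aux.
Qed.

Lemma gnear_cell j w w2 w' w'2 : gcell j w = gcell j w2 -> gcell j w' = gcell j w'2 ->
  gnear j w w' = gnear j w2 w'2.
Proof.
move=> /eqP/gcellP h /eqP/gcellP h'; apply: eq_forallb => i.
by rewrite h h'.
Qed.

Lemma gnear_sym j w w' : gnear j w w' = gnear j w' w.
Proof. by apply: eq_forallb => i; rewrite andbC. Qed.

Lemma gnear_refl j w : gnear j w w.
Proof. by apply/forallP => i; rewrite leq_addr. Qed.

Lemma prod_side j : \prod_i side j i = 2 ^ (q * (J1 - j)).
Proof. by rewrite /side -expn_sum -big_distrl. Qed.

Lemma card_familyE (F : iota -> pred 'I_N) :
  \sum_(w : Omega) [forall i, F i (w i)] = \prod_i \sum_(u < N) F i u.
Proof.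
transitivity #|family F|.
  rewrite -sum1_card [RHS]big_mkcond /=; apply: eq_bigr => w _.
  by rewrite unfold_in; case: ifP.
rewrite card_family foldrE big_map big_enum /=; apply: eq_bigr => i _.
by rewrite -sum1_card big_mkcond /=; apply: eq_bigr => u _; rewrite unfold_in; case: ifP.
Qed.

Hypothesis Ndvd : forall i, 2 ^ (e i * J1) %| N.

(** Divisibility of [N] makes every cell full, including those at the end of the range. *)
Lemma gcell_card j w : \sum_w' (gcell j w' == gcell j w) = 2 ^ (q * (J1 - j)).
Proof.
pose F i := [pred u : 'I_N | u %/ side j i == w i %/ side j i].
transitivity (\sum_(w' : Omega) [forall i, F i (w' i)]).
  apply: eq_bigr => w' _; congr nat_of_bool; apply/gcellP/forallP => h i.
    by rewrite /F /= h.
  by apply/eqP/h.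
rewrite (card_familyE F) -prod_side; apply: eq_bigr => i _; rewrite /F /=.
set s := side j i; have s0 : 0 < s := side_gt0 j i.
have sN : s %| N.
  by apply: dvdn_trans (Ndvd i); rewrite dvdn_exp2l // leq_mul2l leq_subr orbT.
set a := w i %/ s.
transitivity (\sum_(u < N) ((a * s <= u) && (u < a * s + s))).
  apply: eq_bigr => u _; congr nat_of_bool.
  by rewrite eqn_leq -ltnS ltn_divLR // leq_divRL // mulSn addnC andbC.
have : a * s <= w i by rewrite leq_divM.
have : a * s + s <= N.
  rewrite -mulSnr -[X in _ <= X](divnK sN) leq_mul2r.
  by rewrite ltn_divLR // divnK // ltn_ord orbT.
rewrite sum_interval; lia.
Qed.

Lemma gnear_card j w : \sum_w' gnear j w w' <= (2 * K + 1) ^ #|iota| * 2 ^ (q * (J1 - j)).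
Proof.
pose F i := [pred u : 'I_N | (w i %/ side j i <= u %/ side j i + K) && (u %/ side j i <= w i %/ side j i + K)].
have -> : \sum_w' gnear j w w' = \sum_(w' : Omega) [forall i, F i (w' i)] by [].
rewrite (card_familyE F) -prod_side -prod_nat_const -big_split /=.
apply: leq_prod => i _.
set s := side j i; have s0 : 0 < s := side_gt0 j i.
set a := w i %/ s.
apply: (@leq_trans (\sum_(u < N) (((a - K) * s <= u) && (u < (a - K) * s + (2 * K + 1) * s)))).
  2: by rewrite sum_interval; lia.
apply: leq_sum => u _; rewrite /F /= -/s -/a -mulnDl.
case: andP => // -[h1 h2]; rewrite lt0b -leq_divRL // -ltn_divLR //.
by move: h1 h2; clearbody a; move: (u %/ s) => x; lia.
Qed.
End Grid.

Local Open Scope ring_scope.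

(** * Separation along vertical lines *)

Lemma convex_lt (R : realFieldType) (a b c th : R) : 0 <= th <= 1 -> a < c -> b < c ->
  a + th * (b - a) < c.
Proof.
move=> /andP[t0]; rewrite le_eqVlt => /predU1P[->|t1] ac bc; first lra.
have := mulr_ge0 t0 (ltW (_ : 0 < c - b)).
have : 0 < (1 - th) * (c - a) by apply: mulr_gt0; lra.
by move=> h /(_ ltac:(lra)); lra.
Qed.

Lemma convex_norm_lt (R : realFieldType) (x a b c th : R) : 0 <= th <= 1 ->
  `|a - x| < c -> `|b - x| < c -> `|a + th * (b - a) - x| < c.
Proof.
rewrite !ltr_norml => t01 /andP[a1 a2] /andP[b1 b2]; apply/andP; split.
  have := @convex_lt R (x - a) (x - b) c th t01; lra.
have := @convex_lt R (a - x) (b - x) c th t01; lra.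
Qed.

Section Separation.
Variables (R : archiRealFieldType) (iota : finType) (e : iota -> nat).
Hypothesis e12 : forall i, (0 < e i <= 2)%N.

Definition inbox (y : iota -> R) (r : R) (w : iota -> R) :=
  forall i, `|w i - y i| < r ^+ e i.

Lemma e_cases i : e i = 1%N \/ e i = 2%N.
Proof. by have := e12 i; case: (e i) => [|[|[|]]] //; [left|right]. Qed.

Lemma inbox_refl y r : 0 < r -> inbox y r y.
Proof. by move=> r0 i; rewrite subrr normr0 exprn_gt0. Qed.

Lemma inbox_le y r r' w : 0 <= r -> r <= r' -> inbox y r w -> inbox y r' w.
Proof.
move=> r0 rr' h i; apply: lt_le_trans (h i) _.
by rewrite lerXn2r // nnegrE (le_trans r0).
Qed.

Lemma inbox_trans y z w r r' : 0 <= r -> 0 <= r' ->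
  inbox y r z -> inbox z r' w -> inbox y (r + r') w.
Proof.
move=> r0 r'0 h h' i; have := h i; have := h' i.
have -> : w i - y i = (w i - z i) + (z i - y i) by ring.
move=> a b; apply: (le_lt_trans (ler_normD _ _)).
have : r ^+ e i + r' ^+ e i <= (r + r') ^+ e i by case: (e_cases i) => ->; rewrite ?expr1 //; nra.
lra.
Qed.

Lemma inbox_convex y r w w' th : 0 <= th <= 1 -> inbox y r w -> inbox y r w' ->
  inbox y r (fun i => w i + th * (w' i - w i)).
Proof.
by move=> t01 h h' i; apply: convex_norm_lt; rewrite ?h ?h'.
Qed.

Variables (E : (iota -> R) -> R -> Prop).
Variable conn : (iota -> R) -> R -> (iota -> R) -> R -> Prop.
Hypothesis conn_sym : forall y s y' s', conn y s y' s' -> conn y' s' y s.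
Hypothesis conn_trans : forall y s y' s' y'' s'',
  conn y s y' s' -> conn y' s' y'' s'' -> conn y s y'' s''.
Hypothesis conn_seg : forall y s y' s',
  (forall th : R, 0 <= th <= 1 -> ~ E (fun i => y i + th * (y' i - y i)) (s + th * (s' - s))) ->
  conn y s y' s'.

Definition flevel y r u := forall w, inbox y r w -> ~ E w u.

Lemma flevel_conn y r u w w' : flevel y r u -> inbox y r w -> inbox y r w' -> conn w u w' u.
Proof.
move=> fl h h'; apply: conn_seg => th th01; rewrite subrr mulr0 addr0.
by apply: fl; apply: inbox_convex.
Qed.

Lemma vertical_hit w u1 u2 : u1 <= u2 -> ~ conn w u1 w u2 ->
  exists v, u1 <= v <= u2 /\ E w v.
Proof.
move=> u12 nc; apply: contrapT => nex; apply: nc; apply: conn_seg => th /andP[t0 t1].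
have -> : (fun i => w i + th * (w i - w i)) = w.
  by apply/funext => i; rewrite subrr mulr0 addr0.
by move=> hE; apply: nex; eexists; split; [|exact: hE]; apply/andP; split; nra.
Qed.

Definition double_cover y r k lo hi := exists z u,
  (forall w v, inbox z k w -> `|v - u| < k -> inbox y r w /\ ~ E w v) /\
  (forall w, inbox z k w -> (exists v, u <= v <= hi /\ E w v) /\ (exists v, lo <= v <= u /\ E w v)).

Lemma double_cover_le y r k lo hi lo' hi' : lo' <= lo -> hi <= hi' ->
  double_cover y r k lo hi -> double_cover y r k lo' hi'.
Proof.
move=> l h [z [u [h1 h2]]]; exists z, u; split=> // w /h2 [[v [a b]] [v' [a' b']]].
by split; [exists v|exists v']; split=> //; lra.
Qed.

Definition inbox2 z s k (w : iota -> R) (v : R) := inbox z k w /\ `|v - s| < k.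

Definition two_box y s r k := exists z1 s1 z2 s2,
  (forall w v, inbox2 z1 s1 k w v \/ inbox2 z2 s2 k w v -> inbox2 y s r w v /\ ~ E w v) /\
  (forall w v w' v', inbox2 z1 s1 k w v -> inbox2 z2 s2 k w' v' -> ~ conn w v w' v').

Lemma inbox2_conn z s k w v w' v' : (forall w v, inbox2 z s k w v -> ~ E w v) ->
  inbox2 z s k w v -> inbox2 z s k w' v' -> conn w v w' v'.
Proof.
move=> fr [a b] [a' b']; apply: conn_seg => th th01; apply: fr; split.
  exact: inbox_convex.
exact: convex_norm_lt.
Qed.

(* If the free levels below and above p lie in one component, then one of the two
   boxes at p is a bubble: every vertical line through it meets E both above and below. *)
Lemma bubble y r p s rho k ub um : 0 < r -> 0 < k ->
  flevel y r ub -> flevel y r um -> conn y ub y um ->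
  two_box p s rho k -> (forall w, inbox p rho w -> inbox y r w) ->
  ub <= s - rho -> s + rho <= um -> double_cover y r k ub um.
Proof.
move=> r0 k0 fb fm bm [z1 [s1 [z2 [s2 [hfree hsep]]]]] hpy hb hm.
(* The two boxes are not connected to each other, so one of them is not connected to [um], hence not
   to [ub] either. *)
have [zD [sD [hD nD]]] : exists z u, (forall w v, inbox2 z u k w v -> inbox2 p s rho w v /\ ~ E w v) /\
   (forall w v, inbox2 z u k w v -> ~ conn w v y um).
  have c w : inbox w k w by exact: inbox_refl.
  have c2 z u : inbox2 z u k z u by split; rewrite ?subrr ?normr0.
  have [cz1|nz1] := pselect (conn z1 s1 y um).
    exists z2, s2; split=> [w v h|w v h cw]; first by apply: hfree; right.
    by apply: (hsep z1 s1 w v) => //; apply: conn_trans cz1 (conn_sym cw).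
  exists z1, s1; split=> [w v h|w v h cw]; first by apply: hfree; left.
  apply: nz1; apply: conn_trans cw; apply: inbox2_conn (c2 _ _) h => w' v' h'.
  by case: (hfree w' v'); [left|].
exists zD, sD; split.
  by move=> w v hw hv; case: (hD w v) => // -[/hpy].
move=> w hw; have hwD : inbox2 zD sD k w sD by split; rewrite ?subrr ?normr0.
have [[/hpy hwy]] := hD _ _ hwD; rewrite ltr_norml => /andP[h1 h2] _.
have yy : inbox y r y by exact: inbox_refl.
have cm : conn w um y um by exact: flevel_conn fm _ _.
have cb : conn w ub y ub by exact: flevel_conn fb _ _.
split; apply: vertical_hit; try lra.
  by move=> h; apply: (nD _ _ hwD); apply: conn_trans h cm.
move=> h; apply: (nD _ _ hwD); apply: conn_trans (conn_sym h) _.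
exact: conn_trans cb bm.
Qed.

(** If two neighboring free levels are connected, the point between them supplies a bubble.
    Otherwise the middle level is cut off from both others, and the box of size [k] around it
    serves. *)
Lemma double_coverP y s y' s' r rho k ub um ut : 0 < k -> k <= r ->
  flevel y r ub -> flevel y r um -> flevel y r ut ->
  (forall w v, inbox2 y um k w v -> ~ E w v) ->
  two_box y s rho k -> two_box y' s' rho k ->
  (forall w, inbox y rho w -> inbox y r w) -> (forall w, inbox y' rho w -> inbox y r w) ->
  ub <= s - rho -> s + rho <= um -> um <= s' - rho -> s' + rho <= ut -> 0 < rho ->
  double_cover y r k ub ut.
Proof.
move=> k0 kr fb fm ft fk tp tq hy hy' h1 h2 h3 h4 rho0.
have r0 : 0 < r by lra.
have [c1|n1] := pselect (conn y ub y um).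
  by apply: double_cover_le (bubble r0 k0 fb fm c1 tp hy h1 h2); lra.
have [c2|n2] := pselect (conn y um y ut).
  by apply: double_cover_le (bubble r0 k0 fm ft c2 tq hy' h3 h4); lra.
have yy : inbox y r y by exact: inbox_refl.
exists y, um; split.
  by move=> w v hw hv; split; [apply: inbox_le hw; lra|apply: fk].
move=> w hw; have hw' : inbox y r w by apply: inbox_le hw; lra.
split; apply: vertical_hit; try lra.
  move=> h; apply: n2; apply: conn_trans (flevel_conn fm yy hw') _.
  by apply: conn_trans h (flevel_conn ft hw' yy).
by move=> h; apply: n1; apply: conn_trans (flevel_conn fb yy hw') _;
  apply: conn_trans h (flevel_conn fm hw' yy).
Qed.

Variables (t H : nat).

(** The bounds on [nu] leave one more slab below and above within the heights from 0 to [3 * H], so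
    that boxes of size [rho] at points of the tower stay in that range. *)
Definition tower y rho := exists nu : nat, (0 < nu)%N /\
  (nu + t + 1)%:R * rho <= (3 * H)%:R /\
  forall i, (i < t)%N -> exists w u, inbox y (4 * rho) w /\
    (nu + i)%:R * rho <= u < (nu + i).+1%:R * rho /\ E w u.

Lemma free_level y (rho x : R) : 0 < rho -> ~ tower y rho -> rho <= x ->
  x + (t + 2)%:R * rho <= (3 * H)%:R ->
  exists u : R, x + rho / 2 <= u <= x + (t%:R + 1/2) * rho /\
    forall w v, inbox y (4 * rho) w -> `|v - u| < rho / 2 -> ~ E w v.
Proof.
move=> rho0 nt xr xt; apply: contrapT => nex; apply: nt.
have xr0 : 0 <= x / rho by apply: divr_ge0; lra.
have /andP[tr1 tr2] := truncn_itv xr0.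
rewrite ler_pdivlMr // in tr1; rewrite ltr_pdivrMr // in tr2.
(* The slabs begin at the first multiple of [rho] strictly above [x]; this accounts for the offsets
   [1 / 2] and [t + 1 / 2] of the middle of a free slab. *)
set n := Num.truncn _ in tr1 tr2; exists n.+1; split=> //; split.
  apply: le_trans xt; rewrite -!natr1 !natrD -natr1 in tr2 *; lra.
move=> i it; apply: contrapT => nhit; apply: nex.
exists ((n.+1 + i)%:R * rho + rho / 2).
have it' : i%:R + 1 <= t%:R :> R by rewrite natr1 ler_nat.
have i0 : 0 <= i%:R :> R by [].
split.
  rewrite natrD -!natr1 in tr2 *; apply/andP; split; nra.
move=> w v hw hv hE; apply: nhit; exists w, v; split=> //; split=> //.
move: hv; rewrite ltr_norml -(natr1 (n.+1 + i)) => /andP[? ?]; apply/andP; split; lra.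
Qed.

(** The middle of a free slab is found within [(t + 1 / 2) * rho] of the start of the search, and it
    has to stay at distance [rho] from both points of the pair: [t + 5 / 2] units are needed. *)
Definition hgt := (t + 3)%N.

Lemma steep_double y s y' s' (rho k : R) : 0 < rho -> 0 < k -> k <= rho / 2 ->
  ~ tower y rho -> two_box y s rho k -> two_box y' s' rho k ->
  inbox y (2 * rho) y' -> hgt%:R * rho < s' - s -> hgt%:R * rho <= H%:R ->
  H%:R <= s -> s' <= (2 * H)%:R ->
  double_cover y (4 * rho) k (s - hgt%:R * rho) (s' + hgt%:R * rho).
Proof.
move=> rho0 k0 kr nt tp tq yy' st hH Hs s'H.
have eh : hgt%:R = t%:R + 3 :> R by rewrite natrD.
rewrite eh !natrM in st hH s'H *.
have t0 : 0 <= t%:R :> R by [].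
have [ub [/andP[b1 b2] fb]] : exists u : R, s - (t%:R + 2) * rho + rho / 2 <= u <= s - (t%:R + 2) * rho + (t%:R + 1/2) * rho /\
    forall w v, inbox y (4 * rho) w -> `|v - u| < rho / 2 -> ~ E w v.
  by apply: free_level => //; rewrite ?natrM ?natrD; nra.
have [um [/andP[m1 m2] fm]] : exists u : R, s + rho + rho / 2 <= u <= s + rho + (t%:R + 1/2) * rho /\
    forall w v, inbox y (4 * rho) w -> `|v - u| < rho / 2 -> ~ E w v.
  by apply: free_level => //; rewrite ?natrM ?natrD; nra.
have [ut [/andP[t1 t2] ft]] : exists u : R, s' + rho + rho / 2 <= u <= s' + rho + (t%:R + 1/2) * rho /\
    forall w v, inbox y (4 * rho) w -> `|v - u| < rho / 2 -> ~ E w v.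
  by apply: free_level => //; rewrite ?natrM ?natrD; nra.
have fl u : (forall w v, inbox y (4 * rho) w -> `|v - u| < rho / 2 -> ~ E w v) -> flevel y (4 * rho) u.
  by move=> h w hw; apply: h => //; rewrite subrr normr0; lra.
have trho : 0 <= t%:R * rho by apply: mulr_ge0 => //; lra.
have yy2 w : inbox y' rho w -> inbox y (4 * rho) w.
  move=> hw; apply: (@inbox_le y (2 * rho + rho)); [lra|lra|].
  by apply: inbox_trans hw; [lra|lra|].
have yy1 w : inbox y rho w -> inbox y (4 * rho) w by apply: inbox_le; lra.
have fk w v : inbox2 y um k w v -> ~ E w v.
  by move=> [hw hv]; apply: fm; [apply: inbox_le hw; lra|lra].
apply: (@double_cover_le _ _ _ ub ut); [lra|lra|].
refine (double_coverP k0 _ (fl _ fb) (fl _ fm) (fl _ ft) fk tp tq yy1 yy2 _ _ _ _ _); clear -rho0 b1 b2 m1 m2 t1 t2 st kr trho; lra.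
Qed.

End Separation.

(** * Cells, rows and hits at finite resolution *)

Section Discrete.
Variables (R : archiRealFieldType) (iota : finType) (e : iota -> nat).
Hypothesis e12 : forall i, (0 < e i <= 2)%N.
Variables (E : (iota -> R) -> R -> Prop) (a H J : nat).

Notation J1 := (J + a)%N.
(** A point within a box of size [6 * rho] is at most [6 ^ 2] cells away, the time direction being
    the worst. The base of side 17 is centered at the unit box [[8, 9)] and leaves room for boxes of
    size [4 * rho] with [rho <= 1 / 2], on which coordinates move by less than 4. *)
Notation K := 36%N.
Notation N := (17 * 2 ^ (2 * J1))%N.
Notation V := (3 * H * 2 ^ J1)%N.
Notation Omega := {ffun iota -> 'I_N}.
Notation q := (\sum_i e i)%N.
Notation cell := (@gcell iota e J1 N).
Notation near := (@gnear iota e J1 K N).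

Definition rho (j : nat) : R := (2 ^ j)%:R^-1.
Definition mesh i : R := (2 ^ (e i * J1))%:R.
Definition pos (w : Omega) : iota -> R := fun i => (w i)%:R / mesh i.
Definition incell (w : Omega) (y : iota -> R) := forall i, (w i)%:R <= y i * mesh i < (w i).+1%:R.
Definition inrow (nu : 'I_V) (s : R) := nu%:R <= s * (2 ^ J1)%:R < nu.+1%:R.
(** All directions share one index range, sized for exponent 2; the bound 17 cuts off what exceeds
    the base in directions of exponent 1. *)
Definition hitp (w : Omega) (nu : 'I_V) : bool :=
  `[< exists y s, [/\ E y s, incell w y, inrow nu s & forall i, y i < 17] >].
Definition hits (w : Omega) := #|[set nu | hitp w nu]|.
Definition hitnear y s r (w : Omega) (nu : 'I_V) : bool :=
  `[< exists z v, [/\ E z v, incell w z, inrow nu v & inbox2 e y s r z v] >].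

Lemma rho_gt0 j : 0 < rho j. Proof. by rewrite invr_gt0 ltr0n expn_gt0. Qed.

Lemma rhoD j l : rho (j + l) = rho j * rho l.
Proof. by rewrite /rho expnD natrM invfM. Qed.

Lemma rho_le1 j : rho j <= 1.
Proof. by rewrite invf_le1 ?ltr0n ?expn_gt0 // ler1n expn_gt0. Qed.

Lemma rho_half j : (0 < j)%N -> rho j <= 1 / 2.
Proof.
case: j => // j _; rewrite -add1n rhoD {1}/rho expn1.
have := rho_le1 j; have := rho_gt0 j; nra.
Qed.

Lemma mesh_gt0 i : 0 < mesh i. Proof. by rewrite ltr0n expn_gt0. Qed.

Lemma rho_side j i : (j <= J1)%N -> rho j ^+ e i * mesh i = (side e J1 j i)%:R.
Proof.
move=> jJ; rewrite /rho /mesh /side exprVn -natrX -expnM (mulnC j).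
have -> : (e i * J1 = e i * j + e i * (J1 - j))%N by rewrite -mulnDr subnKC.
by rewrite expnD natrM mulKf // pnatr_eq0 -lt0n expn_gt0.
Qed.

Lemma rho_J1 j : (j <= J1)%N -> rho j * (2 ^ J1)%:R = (2 ^ (J1 - j))%:R.
Proof.
move=> jJ; rewrite /rho -{1}(subnKC jJ) expnD natrM mulKf //;
  by rewrite pnatr_eq0 -lt0n expn_gt0.
Qed.

Lemma incell_pos w : incell w (pos w).
Proof. by move=> i; rewrite divfK ?gt_eqF ?mesh_gt0 // lexx ltr_nat ltnS leqnn. Qed.

Lemma leq_div_add (x y s c : nat) : (0 < s)%N -> (x <= y + c * s)%N -> (x %/ s <= y %/ s + c)%N.
Proof.
by move=> s0 xy; apply: (leq_trans (leq_div2r s xy)); rewrite divnDMl // leqnn.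
Qed.

Lemma near_of_inbox j w w' z : (j <= J1)%N -> inbox e (pos w) (6 * rho j) z -> incell w' z ->
  near j w w'.
Proof.
move=> jJ hz hw'; apply/forallP => i.
have s0 := side_gt0 e J1 j i.
have := hz i; have /andP[h1 h2] := hw' i; have /andP[h3 h4] := incell_pos w i.
have m0 := mesh_gt0 i.
rewrite exprMn -(ltr_pM2r m0) -mulrA rho_side //.
rewrite -{1}(gtr0_norm m0) -normrM mulrBl ltr_norml => /andP[h5 h6].
have h7 : 6 ^+ e i * (side e J1 j i)%:R <= (K * side e J1 j i)%:R :> R.
  rewrite natrM ler_wpM2r //; case: (e_cases e12 i) => ->; rewrite ?expr1 ?expr2; lra.
rewrite /pos divfK ?gt_eqF // in h3 h4 h5 h6.
apply/andP; split; apply: leq_div_add => //; rewrite -ltnS -(ltr_nat R) -natr1 natrD.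
  rewrite -natr1 in h2; lra.
rewrite -natr1 in h4; lra.
Qed.

Lemma inbox_of_cell j w w' z z' : (j <= J1)%N -> cell j w = cell j w' ->
  incell w z -> incell w' z' -> inbox e z (rho j) z'.
Proof.
move=> jJ /eqP/gcellP h hz hz' i; have s0 := side_gt0 e J1 j i.
have m0 := mesh_gt0 i; have /andP[h1 h2] := hz i; have /andP[h3 h4] := hz' i.
rewrite -(ltr_pM2r m0) rho_side // -{1}(gtr0_norm m0) -normrM mulrBl.
have := h i; set s := side _ _ _ _ in s0 *; set c := (w i %/ s)%N => wc.
have b1 : (c * s <= w i)%N by rewrite leq_divM.
have b2 : (c * s <= w' i)%N by rewrite wc leq_divM.
have b3 : ((w i).+1 <= c * s + s)%N by rewrite -mulSnr -ltn_divLR.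
have b4 : ((w' i).+1 <= c * s + s)%N by rewrite -mulSnr -ltn_divLR // -wc.
rewrite -(ler_nat R) in b1; rewrite -(ler_nat R) in b2.
rewrite -(ler_nat R) natrD in b3; rewrite -(ler_nat R) natrD in b4.
rewrite ltr_norml; apply/andP; split; lra.
Qed.

Lemma exists_cell z : (forall i, 0 <= z i < 17) -> exists w, incell w z.
Proof.
move=> hz.
have h i : (Num.truncn (z i * mesh i) < N)%N.
  have /andP[z0 z17] := hz i; have m0 := mesh_gt0 i.
  rewrite truncn_lt_nat; last by apply: mulr_ge0 => //; lra.
  apply: (@lt_le_trans _ _ (17 * mesh i)); first by rewrite ltr_pM2r.
  rewrite natrM ler_pM2l // ler_nat leq_exp2l // leq_mul2r.
  by have /andP[_ ->] := e12 i; rewrite orbT.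
exists [ffun i => Ordinal (h i)] => i; rewrite ffunE /=.
apply: truncn_itv; apply: mulr_ge0; first by have /andP[] := hz i.
exact/ltW/mesh_gt0.
Qed.

Lemma exists_row s : 0 <= s < (3 * H)%:R -> exists nu, inrow nu s.
Proof.
move=> /andP[s0 sH].
have p0 : 0 < (2 ^ J1)%:R :> R by rewrite ltr0n expn_gt0.
have h : (Num.truncn (s * (2 ^ J1)%:R) < V)%N.
  by rewrite truncn_lt_nat ?mulr_ge0 // natrM ltr_pM2r.
by exists (Ordinal h); apply: truncn_itv; rewrite mulr_ge0.
Qed.

Definition dom (w : Omega) := [forall i, (8 * 2 ^ (e i * J1) <= w i)%N && (w i < 8 * 2 ^ (e i * J1) + 2 ^ (e i * J1))%N].

Lemma domP w : dom w -> forall i, 8 <= pos w i < 9.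
Proof.
move=> /forallP h i; have /andP[h1 h2] := h i; have m0 := mesh_gt0 i.
rewrite /pos ler_pdivlMr // ltr_pdivrMr //.
rewrite /mesh -!natrM ler_nat ltr_nat h1; apply: (leq_trans h2); lia.
Qed.

Lemma card_dom : #|[set w | dom w]| = (2 ^ (q * J1))%N.
Proof.
rewrite card_sum1.
rewrite (@card_familyE iota N (fun i => [pred u : 'I_N | (8 * 2 ^ (e i * J1) <= u)%N && (u < 8 * 2 ^ (e i * J1) + 2 ^ (e i * J1))%N])).
rewrite big_distrl expn_sum; apply: eq_bigr => i _ /=.
rewrite sum_interval.
have : (2 ^ (e i * J1) <= 2 ^ (2 * J1))%N.
  by rewrite leq_exp2l // leq_mul2r; have /andP[_ ->] := e12 i; rewrite orbT.
lia.
Qed.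

Lemma N_dvd i : (2 ^ (e i * J1) %| N)%N.
Proof.
apply: dvdn_mull; rewrite dvdn_exp2l // leq_mul2r.
by have /andP[_ ->] := e12 i; rewrite orbT.
Qed.

Variables (CL t' : nat).
(** Lower regularity in counted form. *)
Hypothesis hits_lower : forall j y s, (j <= J)%N -> E y s -> (forall i, 4 <= y i <= 13) ->
  rho j <= s <= (3 * H)%:R - rho j ->
  (2 ^ (q * (J1 - j)) <= CL * #|[set p : Omega * 'I_V | hitnear y s (rho j) p.1 p.2]|)%N.

Notation t := (3 * t')%N.
Notation tower := (tower e E t H).

(** Every third slab of the tower contributes the hits near one of its points. They lie in that slab
    and its two neighbors, so different contributions are disjoint. *)
Lemma tower_near j w : (0 < j <= J)%N -> dom w -> tower (pos w) (rho j) ->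
  (t' * 2 ^ (q * (J1 - j)) <= CL * \sum_(w' | near j w w') hits w')%N.
Proof.
move=> /andP[j0 jJ] hw [nu0 [nu00 [nuH htow]]].
have jJ1 : (j <= J1)%N by rewrite (leq_trans jJ) // leq_addr.
have r0 := rho_gt0 j; have r2 := rho_half j0.
set s := (2 ^ (J1 - j))%N; have s0 : (0 < s)%N by rewrite expn_gt0.
pose X i (p : Omega * 'I_V) :=
  [&& near j w p.1, hitp p.1 p.2, (nu0 + 3 * i <= (p.2 %/ s).+1)%N & (p.2 %/ s < nu0 + 3 * i + 2)%N].
have hX (i : 'I_t') : (2 ^ (q * (J1 - j)) <= CL * \sum_p X i p)%N.
  have it : (3 * i < t)%N by rewrite ltn_mul2l ltn_ord.
  have [z [u [hz [/andP[u1 u2] Ezu]]]] := htow _ it.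
  have z413 k : 4 <= z k <= 13.
    have := hz k; have /andP[p1 p2] := domP hw k.
    have : (4 * rho j) ^+ e k <= 4.
      by case: (e_cases e12 k) => ->; rewrite ?expr1 ?expr2; nra.
    by rewrite ltr_norml => ? /andP[? ?]; apply/andP; split; lra.
  have uH : rho j <= u <= (3 * H)%:R - rho j.
    have n1 : 1 <= (nu0 + 3 * i)%:R :> R by rewrite ler1n; lia.
    have n2 : (nu0 + 3 * i).+1%:R + 1 <= (nu0 + t + 1)%:R :> R by rewrite natr1 ler_nat; lia.
    apply/andP; split; nra.
  apply: leq_trans (hits_lower jJ Ezu z413 uH) _; rewrite leq_mul2l; apply/orP; right.
  rewrite card_sum1; apply: leq_sum => -[w' nu] _ /=.
  case: (boolP (hitnear _ _ _ _ _)) => // /asboolP[x [v [Exv xc nv [xb vb]]]].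
  move: (nv) (vb); rewrite /inrow ltr_norml => /andP[n1 n2] /andP[v1 v2].
  have P0 : 0 < (2 ^ J1)%:R :> R by rewrite ltr0n expn_gt0.
  have rs : rho j * (2 ^ J1)%:R = s%:R by exact: rho_J1.
  have s0R : 0 < s%:R :> R by rewrite ltr0n.
  have d1 : ((nu %/ s)%:R * s%:R <= nu%:R :> R) by rewrite -natrM ler_nat leq_divM.
  have d2 : (nu.+1%:R <= (nu %/ s).+1%:R * s%:R :> R) by rewrite -natrM ler_nat -ltn_divLR.
  rewrite -(ltr_pM2r P0) mulNr mulrBl in v1; rewrite -(ltr_pM2r P0) in v2.
  rewrite -(ler_pM2r P0) -mulrA rs in u1; rewrite -(ltr_pM2r P0) -mulrA rs in u2.
  rewrite rs in v1 v2.
  rewrite lt0b; apply/and4P; split=> /=.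
  - apply: near_of_inbox xc => //; apply: (@inbox_le _ _ _ _ (4 * rho j + rho j)); [lra|lra|].
    by apply: inbox_trans hz xb => //; lra.
  - apply/asboolP; exists x, v; split=> // k.
    have := xb k; have /andP[? ?] := z413 k.
    have : rho j ^+ e k <= 1 by case: (e_cases e12 k) => ->; rewrite ?expr1 ?expr2; nra.
    by rewrite ltr_norml => ? /andP[? ?]; lra.
  - rewrite -ltnS -(ltr_nat R) -(ltr_pM2r s0R) -[X in _ < X * _]natr1 mulrDl.
    clear -d1 d2 n1 n2 u1 u2 v1 v2; lra.
  - rewrite -(ltr_nat R) -(ltr_pM2r s0R) addn2 -[X in _ < X * _]natr1 mulrDl.
    clear -d1 d2 n1 n2 u1 u2 v1 v2; lra.
have -> : (\sum_(w' | near j w w') hits w' = \sum_(p : Omega * 'I_V | near j w p.1) hitp p.1 p.2)%N.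
  transitivity (\sum_(w' | near j w w') \sum_nu hitp w' nu)%N.
    by apply: eq_bigr => w' _; rewrite /hits card_sum1.
  by rewrite pair_big_dep; apply: eq_bigl => p; rewrite andbT.
apply: (@leq_trans (\sum_(i < t') (CL * \sum_p X i p))%N).
  rewrite -[X in (X * _)%N](card_ord t') -sum_nat_const; exact: leq_sum.
rewrite -big_distrr leq_mul2l exchange_big /=; apply/orP; right.
rewrite [X in (_ <= X)%N]big_mkcond /=; apply: leq_sum => -[w' nu] _ /=.
have [/existsP[i0 h0]|] := boolP [exists i : 'I_t', X i (w', nu)]; last first.
  by rewrite negb_exists => /forallP h; rewrite big1 // => i _; rewrite (negbTE (h i)).
have /and4P[/= -> -> l1 l2] := h0; rewrite (bigD1 i0) //= h0 big1 // => i ii0.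
case: (boolP (X _ _)) => // /and4P[/= _ _ l3 l4]; case/eqP: ii0; apply: val_inj => /=; lia.
Qed.

End Discrete.

Section Discrete2.
Variables (R : archiRealFieldType) (iota : finType) (e : iota -> nat).
Hypothesis e12 : forall i, (0 < e i <= 2)%N.
Variables (E : (iota -> R) -> R -> Prop) (a H J : nat).
Notation J1 := (J + a)%N.
Notation K := 36%N.
Notation N := (17 * 2 ^ (2 * J1))%N.
Notation V := (3 * H * 2 ^ J1)%N.
Notation Omega := {ffun iota -> 'I_N}.
Notation q := (\sum_i e i)%N.
Notation cell := (@gcell iota e J1 N).
Notation near := (@gnear iota e J1 K N).
Notation rho := (@rho R).
Notation pos := (@pos R iota e a J).
Notation hitp := (@hitp R iota e E a H J).

(** The free box contains the cell of its center at level [j + a]. Every column over that cell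
    misses the rows close to [u] but is hit above and below; the hits nearest to [u] on the two
    sides bound the gap. *)
Lemma double_gap j (w : Omega) lo hi (c D : nat) : (0 < j <= J)%N -> dom e w ->
  double_cover e E (pos w) (4 * rho j) (rho (j + a)) lo hi ->
  0 <= lo -> hi < (3 * H)%:R -> hi - lo <= c%:R * rho j -> (c < 2 ^ D)%N ->
  exists w' : Omega, (exists z, inbox e (pos w) (4 * rho j) z /\ incell e w' z) /\
    forall w'' : Omega, cell (j + a) w'' = cell (j + a) w' -> gap_scale (hitp w'') J1 a D j.
Proof.
move=> /andP[j0 jJ] dw [z [u [hfree hcov]]] lo0 hiH hilo cD.
have r0 : 0 < rho j := rho_gt0 R j; have k0 : 0 < rho (j + a) := rho_gt0 R _.
have r2 : rho j <= 1 / 2 := rho_half R j0.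
have jaJ1 : (j + a <= J1)%N by rewrite leq_add2r.
have jJ1 : (j <= J1)%N by rewrite (leq_trans jJ) // leq_addr.
have zz := inbox_refl e z k0.
have [hzy _] : inbox e (pos w) (4 * rho j) z /\ ~ E z u.
  by apply: hfree; rewrite ?subrr ?normr0.
have z413 i : 4 < z i < 13.
  have := hzy i; have /andP[p1 p2] := domP R dw i.
  have : (4 * rho j) ^+ e i <= 4.
    by case: (e_cases e12 i) => ->; rewrite ?expr1 ?expr2; nra.
  by rewrite ltr_norml => ? /andP[? ?]; apply/andP; split; lra.
have [w' hw'] : exists w' : Omega, incell e w' z.
  by apply: exists_cell => // i; have /andP[? ?] := z413 i; apply/andP; split; lra.
exists w'; split; first by exists z.
move=> w'' hc.
have hbox x : incell e w'' x -> inbox e z (rho (j + a)) x.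
  by move=> hx; apply: inbox_of_cell (esym hc) hw' hx.
have P0 : 0 < (2 ^ J1)%:R :> R by rewrite ltr0n expn_gt0.
set P := (2 ^ J1)%:R in P0.
have ks : rho (j + a) * P = (2 ^ (J1 - (j + a)))%:R by exact: rho_J1.
have rs : rho j * P = (2 ^ (J1 - j))%:R by exact: rho_J1.
have k1 : 1 <= rho (j + a) * P by rewrite ks ler1n expn_gt0.
have hitE nu : hitp w'' nu -> nu.+1%:R > (u + rho (j + a)) * P \/ nu%:R <= (u - rho (j + a)) * P.
  move=> /asboolP[x [v [Exv xc /andP[n1 n2] _]]].
  have [lt|] := ltP `|v - u| (rho (j + a)).
    by have [_] := hfree x v (hbox _ xc) lt.
  rewrite ler_normr => /orP[h|h]; [left|right].
    by apply: (le_lt_trans _ n2); rewrite -/P ler_pM2r //; lra.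
  by apply: (le_trans n1); rewrite -/P ler_pM2r //; lra.
have hitI v : lo <= v <= hi -> E (pos w'') v ->
    exists nu, [/\ hitp w'' nu, nu%:R <= v * P & v * P < nu.+1%:R].
  move=> /andP[v1 v2] Ev.
  have [nu /andP[n1 n2]] : exists nu : 'I_V, inrow nu v.
    have vv : 0 <= v < (3 * H)%:R by apply/andP; split; lra.
    exact: (exists_row a J vv).
  exists nu; split=> //; apply/asboolP; exists (pos w''), v; split=> //.
  - exact: incell_pos.
  - by apply/andP.
  - move=> i; have /andP[? ?] := z413 i.
    have := hbox _ (incell_pos R e w'') i.
    have : rho (j + a) ^+ e i <= 1.
      by apply: exprn_ile1; [exact: ltW|exact: rho_le1].
    by rewrite ltr_norml => ? /andP[? ?]; lra.
have [[v2 [/andP[uv2 v2hi] Ev2]] [v1 [/andP[lov1 v1u] Ev1]]] := hcov _ (hbox _ (incell_pos R e w'')).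
have [m2 [hm2 m2v m2v']] : exists nu, [/\ hitp w'' nu, nu%:R <= v2 * P & v2 * P < nu.+1%:R].
  by apply: hitI => //; apply/andP; split; lra.
have [m1 [hm1 m1v m1v']] : exists nu, [/\ hitp w'' nu, nu%:R <= v1 * P & v1 * P < nu.+1%:R].
  by apply: hitI => //; apply/andP; split; lra.
(* A row is no taller than [rho (j + a)], so by [hitE] a hit row whose top exceeds [u] reaches past
   [u + rho (j + a)], and any other hit row starts at or below [u - rho (j + a)]. *)
pose up (nu : 'I_V) := hitp w'' nu && ((u * P < nu.+1%:R) : bool).
pose dn (nu : 'I_V) := hitp w'' nu && ~~ ((u * P < nu.+1%:R) : bool).
have um2 : up m2 by rewrite /up hm2 /=; apply: le_lt_trans m2v'; rewrite ler_pM2r.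
have dm1 : dn m1.
  rewrite /dn hm1 /= -leNgt.
  case: (hitE _ hm1) => h.
    have : (u + rho (j + a)) * P < v1 * P + 1.
      by rewrite -natr1 in h; clear -h m1v; lra.
    have : v1 * P <= u * P by rewrite ler_pM2r.
    rewrite mulrDl; clear -k0 k1; lra.
  rewrite -natr1; rewrite mulrBl in h; clear -h k1; lra.
case: (@arg_minnP _ m2 up (fun nu => nat_of_ord nu) um2) => n2 /andP[hn2 un2] min2.
case: (@arg_maxnP _ m1 dn (fun nu => nat_of_ord nu) dm1) => n1 /andP[hn1 un1] max1.
have a2 : (u + rho (j + a)) * P < n2.+1%:R.
  case: (hitE _ hn2) => // h; rewrite mulrBl in h; rewrite -natr1 in un2; clear -h un2 k1; lra.
have a1 : n1%:R <= (u - rho (j + a)) * P.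
  by case: (hitE _ hn1) => // h; rewrite -leNgt in un1; rewrite mulrDl in h; clear -h un1 k1; lra.
have n12 : (n1 < n2)%N.
  by rewrite -(ltr_nat R); rewrite -natr1 mulrDl in a2; rewrite mulrBl in a1; clear -a1 a2 k1; lra.
have gn : gap (hitp w'') n1 n2.
  apply/and4P; split=> //; apply/forallP => l; apply/implyP => /andP[l1 l2].
  apply/negP => hl; have [ul|nul] := boolP (u * P < l.+1%:R).
    by have := min2 l; rewrite /up hl ul leqNgt l2 => /(_ isT).
  by have := max1 l; rewrite /dn hl nul /= leqNgt l1 => /(_ isT).
apply/existsP; exists n1; apply/existsP; exists n2; rewrite gn /=.
have d21 : (n2 - n1)%N%:R = n2%:R - n1%:R :> R by rewrite natrB // ltnW.
(* The row numbers differ by more than [2 * rho (j + a) * P - 1], and [rho (j + a) * P >= 1] pays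
   for the row lost to rounding. In the upper bound the lost row is paid for by [c.+1] in place of
   [c]. *)
apply/andP; split.
  have e1 : (J1 - j = a + (J1 - (j + a)))%N by clear -jaJ1; lia.
  have -> : (2 ^ (J1 - j) = 2 ^ a * 2 ^ (J1 - (j + a)))%N by rewrite -expnD -e1.
  rewrite leq_mul2l; apply/orP; right; rewrite -(ler_nat R) d21 -ks.
  rewrite -natr1 mulrDl in a2; rewrite mulrBl in a1; clear -a1 a2 k1; lra.
rewrite [X in (_ <= X)%N]expnD [X in (_ <= X)%N]mulnC; apply: (@leq_trans (c.+1 * 2 ^ (J1 - j))%N); last by rewrite leq_mul2r cD orbT.
rewrite -(ler_nat R) d21 natrM -rs -natr1.
have : n2%:R <= v2 * P by apply: le_trans m2v; rewrite ler_nat; apply: min2.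
have : m1%:R <= n1%:R :> R by rewrite ler_nat; apply: max1.
have : (v2 - v1) * P <= c%:R * rho j * P by rewrite ler_pM2r //; lra.
have : 1 <= rho j * P by rewrite rs ler1n expn_gt0.
rewrite -natr1 in m1v'; rewrite mulrBl !mulrDl mul1r; clear -m1v'; lra.
Qed.

End Discrete2.

(** The first summand is [CL * lam * 73 ^ n], with [73 = 2 * 36 + 1] near cells per direction and
    [lam = 2 * 73 ^ n * CU] the threshold at which the weak type inequality leaves half of the unit
    box free of towers. The summand [H] makes the slope at least [H], so that height differences, at
    most [H], are never steep at scale 1. *)
Definition tower_len (n CU CL H : nat) : nat := CL * (2 * 73 ^ n * CU) * 73 ^ n + H.
Definition slope (n CU CL H : nat) : nat := hgt (3 * tower_len n CU CL H).
(** Average number of bad scales: [73 ^ n * 2 ^ (q * a)] compares a neighborhood at level [j] with a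
    cell at level [j + a], [a + 4 * slope + 1] bounds the scales served by one gap, and [CU] the
    hits per cell of the unit box. *)
Definition bad_total (n q a CU CL H : nat) : nat :=
  73 ^ n * 2 ^ (q * a) * (a + 4 * slope n CU CL H + 1) * CU.
(** At least half of the unit box carries no tower and at most a quarter has [4 * bad_total] or more
    bad scales; the remaining quarter loses a power of 3 to the coloring. *)
Definition frac (n q a CU CL H : nat) : nat :=
  4 * 3 ^ (4 * bad_total n q a CU CL H).-1.

(** * Extraction of a proportion of the base without steep pairs *)

Section Discrete3.
Variables (R : archiRealFieldType) (iota : finType) (e : iota -> nat).
Hypothesis e12 : forall i, (0 < e i <= 2)%N.
Variables (E : (iota -> R) -> R -> Prop) (a H J CU CL : nat).
Notation J1 := (J + a)%N.
Notation K := 36%N.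
Notation N := (17 * 2 ^ (2 * J1))%N.
Notation V := (3 * H * 2 ^ J1)%N.
Notation Omega := {ffun iota -> 'I_N}.
Notation q := (\sum_i e i)%N.
Notation cell := (@gcell iota e J1 N).
Notation near := (@gnear iota e J1 K N).
Notation rho := (@rho R).
Notation hitp := (@hitp R iota e E a H J).
Notation hits := (@hits R iota e E a H J).
Notation pos := (@pos R iota e a J).
Notation h := (slope #|iota| CU CL H).

Hypothesis H_gt0 : (0 < H)%N.
Hypothesis a_gt0 : (0 < a)%N.
Hypothesis CU_gt0 : (0 < CU)%N.
Hypothesis CL_gt0 : (0 < CL)%N.
Hypothesis hits_upper : (\sum_w hits w <= CU * 2 ^ (q * J1))%N.
Hypothesis hits_lower : forall j y s, (j <= J)%N -> E y s -> (forall i, 4 <= y i <= 13) ->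
  rho j <= s <= (3 * H)%:R - rho j ->
  (2 ^ (q * (J1 - j)) <= CL * #|[set p : Omega * 'I_V | hitnear e E y s (rho j) p.1 p.2]|)%N.
Variable conn : (iota -> R) -> R -> (iota -> R) -> R -> Prop.
Hypothesis conn_sym : forall y s y' s', conn y s y' s' -> conn y' s' y s.
Hypothesis conn_trans : forall y s y' s' y'' s'',
  conn y s y' s' -> conn y' s' y'' s'' -> conn y s y'' s''.
Hypothesis conn_seg : forall y s y' s',
  (forall th : R, 0 <= th <= 1 -> ~ E (fun i => y i + th * (y' i - y i)) (s + th * (s' - s))) ->
  conn y s y' s'.
Hypothesis conn_box : forall j y s, (0 < j)%N -> E y s -> (forall i, 8 <= y i < 9) ->
  H%:R <= s <= (2 * H)%:R -> two_box e E conn y s (rho j) (rho (j + a)).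
Variable f : (iota -> R) -> R.
Hypothesis f_sec : forall y, (forall i, 8 <= y i < 9) -> E y (f y) /\ H%:R <= f y <= (2 * H)%:R.

Definition steep j (w w' : Omega) :=
  h%:R * rho j < f (pos w') - f (pos w) <= 2 * h%:R * rho j /\ inbox e (pos w) (2 * rho j) (pos w').

(** A gap is required on every column over a whole cell of level [j + a], so that bad points can be
    charged to a fixed proportion of columns with gaps. *)
Definition bad j (w : Omega) := [exists w', near j w w' &&
  [forall w'', (cell (j + a) w'' == cell (j + a) w') ==> gap_scale (hitp w'') J1 a (4 * h) j]].

Definition towered (w : Omega) : bool := dom e w &&
  `[< exists2 j, (0 < j <= J)%N & tower e E (3 * tower_len #|iota| CU CL H) H (pos w) (rho j) >].

Lemma steep_bad j w w' : (0 < j <= J)%N -> dom e w -> dom e w' -> ~~ towered w ->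
  steep j w w' -> bad j w /\ bad j w'.
Proof.
move=> /andP[j0 jJ] dw dw' ntw [/andP[s1 s2] bx].
have [Ew /andP[f1 f2]] := f_sec (domP R dw).
have [Ew' /andP[f1' f2']] := f_sec (domP R dw').
have nt : ~ tower e E (3 * tower_len #|iota| CU CL H) H (pos w) (rho j).
  by move=> tw; move: ntw; rewrite /towered dw /= => /asboolP; apply; exists j; rewrite ?j0.
have r0 : 0 < rho j := rho_gt0 R j.
have jJ1 : (j <= J1)%N by rewrite (leq_trans jJ) // leq_addr.
have k2 : rho (j + a) <= rho j / 2.
  by have ra := rho_half R a_gt0; rewrite rhoD; nra.
have H2 : (2 * H)%:R = 2 * H%:R :> R by rewrite natrM.
have H3 : (3 * H)%:R = 3 * H%:R :> R by rewrite natrM.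
have hH : h%:R * rho j <= H%:R by lra.
have dc := steep_double e12 conn_sym conn_trans conn_seg r0 (rho_gt0 R (j + a)) k2 nt
  (conn_box j0 Ew (domP R dw) ltac:(rewrite f1 f2 //)) (conn_box j0 Ew' (domP R dw') ltac:(rewrite f1' f2' //))
  bx s1 hH f1 f2'.
have lo0 : 0 <= f (pos w) - h%:R * rho j by rewrite subr_ge0 (le_trans hH).
have hi3 : f (pos w') + h%:R * rho j < (3 * H)%:R by rewrite H3; rewrite H2 in f2'; lra.
have hilo : f (pos w') + h%:R * rho j - (f (pos w) - h%:R * rho j) <= (4 * h)%:R * rho j.
  by rewrite natrM; lra.
(* The window has height at most [4 * h * rho j], and [D = 4 * h] is admissible because
   [4 * h < 2 ^ (4 * h)]. *)
have [w1 [[z [hz cz]] hg]] := double_gap e12 (introT andP (conj j0 jJ)) dw dc lo0 hi3 hilo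
  (ltn_expl (4 * h) (ltnSn 1)).
have hall : [forall w'', (cell (j + a) w'' == cell (j + a) w1) ==> gap_scale (hitp w'') J1 a (4 * h) j].
  by apply/forallP => w''; apply/implyP => /eqP /hg.
split; apply/existsP; exists w1; rewrite hall andbT.
  by apply: near_of_inbox cz => //; apply: inbox_le hz; lra.
apply: near_of_inbox cz => //.
have -> : 6 * rho j = 2 * rho j + 4 * rho j by ring.
apply: inbox_trans hz => //; [lra|lra|].
by move=> i; rewrite distrC.
Qed.

Lemma card_towered : (2 * #|[set w | towered w]| <= 2 ^ (q * J1))%N.
Proof.
pose Cn := (73 ^ #|iota|)%N; have Cn0 : (0 < Cn)%N by rewrite expn_gt0.
pose lam := (2 * Cn * CU)%N; have lam0 : (0 < lam)%N by rewrite !muln_gt0 Cn0 CU_gt0.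
have hw : (lam * #|[set w | towered w]| <= Cn * \sum_w hits w)%N.
  apply: (@weak_type _ _ cell near J Cn (fun j => 2 ^ (q * (J1 - j)))%N) => //.
  - by move=> i j x y ij; apply: gcell_nest.
  - by move=> i j x y ij; apply: gnear_nest.
  - by move=> j x x' y y' h1 h2; apply: gnear_cell.
  - by move=> j x y; apply: gnear_sym.
  - by move=> j x; apply: gnear_refl.
  - by move=> j; rewrite expn_gt0.
  - by move=> j x _; apply: gcell_card => i; apply: N_dvd.
  - by move=> j x _; apply: gnear_card => i; apply: N_dvd.
  move=> w /andP[dw /asboolP[j /andP[j0 jJ] tw]]; exists j => //.
  rewrite -(leq_pmul2l CL_gt0); apply: leq_trans (tower_near e12 hits_lower _ dw tw); last by rewrite j0.
  by rewrite /tower_len !mulnA leq_mul2r; apply/orP; right; exact: leq_addr.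
rewrite -(leq_pmul2l (_ : 0 < Cn * CU)%N) ?muln_gt0 ?Cn0 //.
have -> : (Cn * CU * (2 * #|[set w | towered w]|) = lam * #|[set w | towered w]|)%N by rewrite /lam; lia.
by apply: (leq_trans hw); rewrite -mulnA leq_mul2l hits_upper orbT.
Qed.

(** At each scale [card_nbhd] charges bad points to columns with a gap; [sum_gap_scale] then sums
    over the scales on each column. *)
Lemma sum_bad : (\sum_(j <- seq.iota 1 J) #|[set w | bad j w]| <=
  bad_total #|iota| q a CU CL H * 2 ^ (q * J1))%N.
Proof.
pose Cn := (73 ^ #|iota|)%N.
pose G j w := gap_scale (hitp w) J1 a (4 * h) j.
have hb j : (j < J.+1)%N -> (#|[set w | bad j w]| <= Cn * 2 ^ (q * a) * #|[set w | G j w]|)%N.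
  rewrite ltnS => jJ.
  rewrite -(leq_pmul2r (_ : 0 < 2 ^ (q * (J1 - (j + a))))%N) ?expn_gt0 //.
  apply: (@leq_trans (#|[set w | G j w]| * (Cn * 2 ^ (q * (J1 - j))))%N).
    apply: (@card_nbhd _ _ cell near J1 Cn (fun j => 2 ^ (q * (J1 - j)))%N _ _ _ _ _ j (j + a) (G j) (bad j)).
    - by move=> i l x y ij; apply: gcell_nest.
    - by move=> l x x' y y' h1 h2; apply: gnear_cell.
    - by move=> l x y; apply: gnear_sym.
    - by move=> l x _; apply: gcell_card => i; apply: N_dvd.
    - by move=> l x _; apply: gnear_card => i; apply: N_dvd.
    - by rewrite leq_addr.
    - by rewrite leq_add2r.
    move=> w /existsP[w' /andP[nw /forallP hw']]; exists w'; split=> // z zw'.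
    by have := hw' z; rewrite zw' eqxx.
  have -> : (q * (J1 - j) = q * a + q * (J1 - (j + a)))%N by rewrite -mulnDr; congr (_ * _)%N; lia.
  by rewrite expnD; lia.
apply: (@leq_trans (\sum_(j < J.+1) (Cn * 2 ^ (q * a) * #|[set w | G j w]|))%N).
  have -> : seq.iota 1 J = index_iota 1 J.+1 by rewrite /index_iota subn1.
  rewrite -(big_mkord xpredT (fun j => Cn * 2 ^ (q * a) * #|[set w | G j w]|)%N).
  rewrite [X in (_ <= X)%N]big_ltn //; apply: leq_trans (leq_addl _ _).
  rewrite big_nat [X in (_ <= X)%N]big_nat; apply: leq_sum => j /andP[_ jJ]; exact: hb.
rewrite -big_distrr /bad_total /= -!mulnA !leq_mul2l; do 2!(apply/orP; right).
under eq_bigr do rewrite card_sum1.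
rewrite exchange_big /=; apply: (@leq_trans (\sum_w (a + 4 * h + 1) * hits w)%N).
  by apply: leq_sum => w _; apply: sum_gap_scale; rewrite leq_addr.
by rewrite -big_distrr leq_mul2l hits_upper orbT.
Qed.

Lemma half_dom : (2 ^ (q * J1) <= 2 * #|[set w | dom e w && ~~ towered w]|)%N.
Proof.
have := card_dom e12 a J; rewrite -(cardsID [set w | towered w]).
have -> : [set w | dom e w] :&: [set w | towered w] = [set w | towered w].
  by apply/setP => w; rewrite !inE /towered; case: (dom e w).
have -> : [set w | dom e w] :\: [set w | towered w] = [set w | dom e w && ~~ towered w].
  by apply/setP => w; rewrite !inE andbC.
have := card_towered; lia.
Qed.

(** The integer parts differ by 1 or 2. This is why [steep] has the upper bound [2 * h * rho j] and
    why three colors are enough. *)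
Lemma truncn_color (x y : R) : 0 <= x -> 1 < y - x <= 2 ->
  (Num.truncn x %% 3 != Num.truncn y %% 3)%N.
Proof.
move=> x0 /andP[d1 d2].
have /andP[x1 x2] := truncn_itv x0.
have /andP[y1 y2] : (Num.truncn y)%:R <= y < (Num.truncn y).+1%:R by apply: truncn_itv; lra.
have h1 : (Num.truncn x < Num.truncn y)%N.
  by rewrite -ltnS -(ltr_nat R) -natr1; rewrite -natr1 in y2 *; lra.
have h2 : (Num.truncn y < Num.truncn x + 3)%N.
  by rewrite -(ltr_nat R) natrD; rewrite -natr1 in x2; lra.
apply/eqP => h; lia.
Qed.

Lemma discrete_pieces : exists G : {set Omega}, [/\ forall w, w \in G -> dom e w,
  (2 ^ (q * J1) <= frac #|iota| q a CU CL H * #|G|)%N &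
  forall j w w', (0 < j <= J)%N -> w \in G -> w' \in G -> ~ steep j w w'].
Proof.
pose col j (w : Omega) : 'I_3 := inord (Num.truncn (f (pos w) / (h%:R * rho j)) %% 3).
set D0 := [set w | dom e w && ~~ towered w].
pose Nb := bad_total #|iota| q a CU CL H.
have Nb0 : (0 < Nb)%N by rewrite !muln_gt0 !expn_gt0 CU_gt0 addn1.
have [G [sG hG cG]] := extract_unbad bad col (seq.iota 1 J) D0 (4 * Nb).-1.
exists G.
have GD w : w \in G -> dom e w /\ ~~ towered w.
  by move/(fintype.subsetP sG); rewrite inE => /andP.
split=> [w /GD[]//||j w w' /andP[j0 jJ] wG w'G st].
  have n4 : ((4 * Nb).-1.+1 = 4 * Nb)%N by rewrite prednK // muln_gt0.
  rewrite n4 in cG; have := sum_bad; have := half_dom; rewrite -/Nb -/D0 /frac -/Nb.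
  move: cG; move: (\sum_(j <- _) _)%N => sb.
  move: (2 ^ (q * J1))%N (3 ^ _)%N #|D0| #|G| => A B C D h1 h2 h3.
  rewrite -(leq_pmul2l Nb0); nia.
have [dw nw] := GD _ wG; have [dw' nw'] := GD _ w'G.
have [bw bw'] := steep_bad (introT andP (conj j0 jJ)) dw dw' nw st.
have jin : j \in seq.iota 1 J by rewrite mem_iota j0 add1n ltnS.
have := hG j w w' jin wG w'G bw bw' => /(congr1 val) /=.
rewrite !inordK ?ltn_pmod // => /eqP; apply/negP.
have [[/andP[s1 s2] _] hr0] : steep j w w' /\ 0 < h%:R * rho j.
  by split=> //; apply: mulr_gt0; rewrite ?rho_gt0 // ltr0n /slope /hgt addn3.
have [_ /andP[f0 _]] := f_sec (domP R dw).
apply: truncn_color.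
  by apply: divr_ge0; [apply: le_trans f0|apply: ltW].
rewrite -mulrBl ltr_pdivlMr // ler_pdivrMr // mul1r mulrA s1 s2 //.
Qed.

End Discrete3.

Local Open Scope classical_set_scope.
Local Open Scope ring_scope.

(** * Hausdorff measures *)

Lemma nneseries_le (R : realType) (u : nat -> \bar R) (c : \bar R) :
  (forall k, (0 <= u k)%E) -> (forall n, (\sum_(0 <= k < n) u k <= c)%E) -> (\sum_(k <oo) u k <= c)%E.
Proof.
move=> u0 h; apply: lime_le; first by apply: is_cvg_nneseries.
by apply: nearW => n; apply: h.
Qed.

Section HausdorffTools.
Variables (R : realType) (T : Type) (d : T -> T -> R) (s : nat).
Implicit Types (A B : set T) (F : nat -> set T).
Local Notation dm := (diamd d).
Local Notation phi A := (((fine (dm A)) ^+ s.+1)%:E)%E.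
Local Notation hc := (hausdorff_content d s.+1).
Local Notation hm := (hausdorff_measure d s.+1).

Lemma diamd_ge0 A : (0 <= dm A)%E.
Proof. by apply: ereal_sup_ubound; right. Qed.

Lemma diamd_ub A x y : A x -> A y -> ((d x y)%:E <= dm A)%E.
Proof. by move=> Ax Ay; apply: ereal_sup_ubound; left; exists (x, y). Qed.

Lemma diamd_le A (c : R) : 0 <= c -> (forall x y, A x -> A y -> d x y <= c) -> (dm A <= c%:E)%E.
Proof.
move=> c0 h; apply: ge_ereal_sup => _ [[[x y] /= [Ax Ay] <-]|->]; last by rewrite lee_fin.
by rewrite lee_fin h.
Qed.

Lemma diamd_set0 : dm set0 = 0%E.
Proof. by apply/eqP; rewrite eq_le diamd_ge0 andbT; apply: diamd_le. Qed.

Lemma phi_ge0 A : (0 <= phi A)%E.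
Proof. by rewrite lee_fin exprn_ge0 // fine_ge0 // diamd_ge0. Qed.

Lemma phi_set0 : phi set0 = 0%E.
Proof. by rewrite diamd_set0 expr0n. Qed.

Lemma phi_le A (r : R) : 0 <= r -> (dm A <= r%:E)%E -> (phi A <= (r ^+ s.+1)%:E)%E.
Proof.
move=> r0 h; rewrite lee_fin lerXn2r ?nnegrE ?fine_ge0 ?diamd_ge0 //.
have := h; have := diamd_ge0 A; case: (dm A) => //= x; by rewrite lee_fin.
Qed.

Lemma content_lb delta A (c : \bar R) :
  (forall F, A `<=` \bigcup_k F k -> (forall k, (dm (F k) <= delta%:E)%E) ->
    (c <= \sum_(k <oo) phi (F k))%E) -> (c <= hc delta A)%E.
Proof. by move=> h; apply: le_ereal_inf_tmp => _ [F [h1 h2] <-]; apply: h. Qed.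

Lemma content_ub delta A F : A `<=` \bigcup_k F k -> (forall k, (dm (F k) <= delta%:E)%E) ->
  (hc delta A <= \sum_(k <oo) phi (F k))%E.
Proof. by move=> h1 h2; apply: ereal_inf_lbound; exists F. Qed.

Lemma content_measure delta A : 0 < delta -> (hc delta A <= hm A)%E.
Proof. by move=> d0; apply: ereal_sup_ubound; exists delta. Qed.

Lemma measure_ub A (c : \bar R) : (forall delta, 0 < delta -> (hc delta A <= c)%E) -> (hm A <= c)%E.
Proof. by move=> h; apply: ge_ereal_sup => _ [delta d0 <-]; apply: h. Qed.

Lemma content_mono delta A B : A `<=` B -> (hc delta A <= hc delta B)%E.
Proof.
move=> AB; apply: content_lb => F BF dF; apply: content_ub => //.
exact: subset_trans AB BF.
Qed.

Lemma measure_mono A B : A `<=` B -> (hm A <= hm B)%E.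
Proof.
move=> AB; apply: measure_ub => delta d0.
exact: le_trans (content_mono _ AB) (content_measure _ d0).
Qed.

Lemma content_anti delta delta' A : delta <= delta' -> (hc delta' A <= hc delta A)%E.
Proof.
move=> dd; apply: content_lb => F AF dF; apply: content_ub => // k.
by apply: le_trans (dF k) _; rewrite lee_fin.
Qed.

Lemma content_finite_cover delta A (N : nat) (B : 'I_N -> set T) (r : R) : 0 <= r -> r <= delta ->
  A `<=` [set x | exists i, B i x] -> (forall i, (dm (B i) <= r%:E)%E) ->
  (hc delta A <= (N%:R * r ^+ s.+1)%:E)%E.
Proof.
move=> r0 rd AB dB.
pose F k := if insub k is Some i then B i else set0.
apply: (@le_trans _ _ (\sum_(k <oo) phi (F k))%E).
  apply: content_ub.
    move=> x /AB [i Bx]; exists (i : nat) => //; rewrite /F insubT //= => h.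
    by have -> : Sub (i : nat) h = i by apply: val_inj.
  move=> k; rewrite /F; case: insubP => [i _ _|_].
    by apply: le_trans (dB i) _; rewrite lee_fin.
  by rewrite diamd_set0 lee_fin; lra.
rewrite (nneseries_split 0 N); last by move=> k _; apply: phi_ge0.
rewrite add0n [X in (_ + X)%E]eseries0 ?adde0; last first.
  move=> k Nk _; rewrite /F insubF ?phi_set0 //.
  by apply/negbTE; rewrite -leqNgt.
rewrite big_mkord; apply: (@le_trans _ _ (\sum_(i < N) (r ^+ s.+1)%:E)%E).
  apply: lee_sum => i _; rewrite /F insubT //= => h.
  by apply: phi_le => //; apply: dB.
by rewrite sumEFin lee_fin sumr_const card_ord mulr_natl.
Qed.

Lemma sum_interleave (N n : nat) (u : nat -> nat -> \bar R) : (0 < N)%N ->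
  (\sum_(0 <= k < N * n) u (k %% N)%N (k %/ N)%N = \sum_(i < N) \sum_(0 <= j < n) u i j)%E.
Proof.
move=> N0; elim: n => [|n IH].
  by rewrite muln0 big_geq // big1 // => i _; rewrite big_geq.
rewrite mulnS (addnC N) (big_cat_nat _ (leq_addr _ _)) //= IH.
have -> g : (\sum_(N * n <= k < N * n + N) g k = \sum_(i < N) (g (i + N * n)%N : \bar R))%E.
  by rewrite -{1}(add0n (N * n)%N) big_addn addKn big_mkord.
rewrite -big_split /=; apply: eq_bigr => i _.
by rewrite big_nat_recr //= addnC mulnC modnMDl modn_small // divnMDl // divn_small // addn0 addeC.
Qed.

(** Covers of the pieces, each optimal up to [eps] divided by their number, are interleaved into one
    sequence by quotient and remainder of the index. *)
Lemma measure_finite_union A (N : nat) (B : 'I_N -> set T) (c : R) : 0 <= c ->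
  A `<=` [set x | exists i, B i x] -> (forall i, (hm (B i) <= c%:E)%E) ->
  (hm A <= (N%:R * c)%:E)%E.
Proof.
move=> c0 AB hB; apply: measure_ub => delta d0.
case: N B AB hB => [|N] B AB hB.
  rewrite mul0r; have -> : A = set0 by rewrite predeqE => x; split=> // /AB [[]].
  apply: (@le_trans _ _ (0%:R * 0 ^+ s.+1)%:E); last by rewrite mul0r.
  by apply: (@content_finite_cover delta set0 0 (fun=> set0) 0) => //; [exact: ltW|case].
apply/lee_addgt0Pr => eps eps0.
pose e1 := eps / N.+1%:R; have e10 : 0 < e1 by rewrite divr_gt0.
have hF (i : 'I_N.+1) : exists F, [/\ B i `<=` \bigcup_k F k, forall k, (dm (F k) <= delta%:E)%E
    & (\sum_(k <oo) phi (F k) < (c + e1)%:E)%E].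
  have : (hc delta (B i) < (c + e1)%:E)%E.
    apply: (le_lt_trans (content_measure _ d0)); apply: (le_lt_trans (hB i)).
    by rewrite lte_fin; lra.
  by move=> /ereal_inf_lt [_ [F [h1 h2] <-] h]; exists F.
have [F {}hF] := choice hF.
pose G k := F (inord (k %% N.+1)%N) (k %/ N.+1)%N.
apply: (@le_trans _ _ (\sum_(k <oo) phi (G k))%E).
  apply: content_ub; last by move=> k; have [_ h _] := hF (inord (k %% N.+1)%N); exact: h.
  move=> x /AB [i]; have [h _ _] := hF i; move=> /h [j _ Fx].
  exists (N.+1 * j + i)%N => //; rewrite /G mulnC modnMDl modn_small // inord_val.
  by rewrite divnMDl // divn_small // addn0.
apply: nneseries_le => [k|n]; first exact: phi_ge0.
apply: (@le_trans _ _ (\sum_(0 <= k < N.+1 * n) phi (G k))%E).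
  rewrite [X in (_ <= X)%E](@big_cat_nat _ _ _ n) //=; last by rewrite leq_pmull.
  by rewrite leeDl // sume_ge0 // => k _; apply: phi_ge0.
rewrite (@sum_interleave N.+1 n (fun i j => phi (F (inord i) j))) //.
apply: (@le_trans _ _ (\sum_(i < N.+1) (c + e1)%:E)%E).
  apply: lee_sum => i _; rewrite inord_val; have [_ _ h] := hF i.
  apply: le_trans (ltW h); apply: nneseries_lim_ge => k _ _; exact: phi_ge0.
rewrite sumEFin -EFinD lee_fin sumr_const card_ord -[X in X <= _]mulr_natl mulrDr /e1.
by rewrite mulrCA divff ?mulr1 // pnatr_eq0.
Qed.

(* Each set of a cover of mesh below the separation meets at most one A i. *)
Lemma measure_separated (I : finType) (A : I -> set T) B (c r : R) : 0 <= c -> 0 < r ->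
  (forall i, A i `<=` B) -> (forall i j x y, i != j -> A i x -> A j y -> r < d x y) ->
  (forall i, (c%:E < hm (A i))%E) -> ((#|I|%:R * c)%:E <= hm B)%E.
Proof.
move=> c0 r0 AB sep hA.
have hd i : exists delta : R, 0 < delta /\ (c%:E < hc delta (A i))%E.
  by have := hA i => /ereal_sup_gt [_ [delta d0 <-] h]; exists delta.
have [de hde] := choice hd; have de0 i := (hde i).1.
pose delta := \big[Num.min/r]_i de i.
have delta0 : 0 < delta by rewrite /delta; elim/big_rec: _ => // i x _ x0; rewrite lt_min de0.
have delta_r : delta <= r.
  by rewrite /delta; elim/big_rec: _ => // i x _ x0; rewrite ge_min x0 orbT.
have delta_i i : delta <= de i by rewrite /delta (bigD1 i) //= ge_min lexx.
apply: le_trans (content_measure _ delta0); apply: content_lb => F BF dF.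
pose G i k := if `[< exists2 x, F k x & A i x >] then F k else set0.
have phiG i k : phi (G i k) = if `[< exists2 x, F k x & A i x >] then phi (F k) else 0%E.
  by rewrite /G; case: ifP => // _; rewrite phi_set0.
apply: (@le_trans _ _ (\sum_(i in I) \sum_(k <oo) phi (G i k))%E).
  apply: (@le_trans _ _ (\sum_(i in I) c%:E)%E).
    by rewrite sumEFin lee_fin sumr_const mulr_natl.
  apply: lee_sum => i _; apply: (le_trans (ltW (hde i).2)).
  apply: (le_trans (content_anti _ (delta_i i))); apply: content_ub.
    move=> x Ax; have [k _ Fx] := BF _ (AB _ _ Ax); exists k => //.
    by rewrite /G; case: asboolP => // -[]; exists x.
  by move=> k; rewrite /G; case: ifP => // _; rewrite diamd_set0 lee_fin ltW.
rewrite -nneseries_sum; last by move=> i k _; apply: phi_ge0.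
apply: lee_nneseries => [k _ _|k _]; first by apply: sume_ge0 => i _; apply: phi_ge0.
have [/existsP[i /asboolP hi]|] := boolP [exists i, `[< exists2 x, F k x & A i x >]].
  rewrite (bigD1 i) //= [X in (_ + X)%E]big1 ?adde0; first by rewrite phiG; case: ifP; rewrite ?lexx ?phi_ge0.
  move=> j ji; rewrite phiG; case: asboolP => // -[y Fy Ay].
  case: hi => x Fx Ax.
  have := diamd_ub Fx Fy; have := dF k; have := sep i j x y; rewrite eq_sym ji => /(_ isT Ax Ay).
  move=> h1 h2 h3; have := le_trans h3 h2; rewrite lee_fin => h4.
  by have := lt_le_trans h1 (le_trans h4 delta_r); rewrite ltxx.
rewrite negb_exists => /forallP h; rewrite big1 ?phi_ge0 // => i _.
by rewrite phiG (negbTE (h i)).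
Qed.

End HausdorffTools.

(** * Euclidean geometry *)

Section Euclid.
Variables (R : realType) (k : nat).
Implicit Types (v w : 'rV[R]_k) (O : 'M[R]_k).

Definition orthogonal O := O *m O^T = 1%:M.

Lemma enorm_ge0 v : 0 <= enorm v. Proof. exact: sqrtr_ge0. Qed.

Lemma enormE v : enorm v ^+ 2 = (v *m v^T) ord0 ord0.
Proof.
rewrite sqr_sqrtr; last by apply: sumr_ge0 => i _; rewrite sqr_ge0.
by rewrite mxE; apply: eq_bigr => i _; rewrite mxE expr2.
Qed.

Lemma coord_le_enorm v i : `|v ord0 i| <= enorm v.
Proof.
rewrite -sqrtr_sqr ler_wsqrtr // (bigD1 i) //= lerDl.
by apply: sumr_ge0 => j _; rewrite sqr_ge0.
Qed.

Lemma enorm_le_sum v : enorm v <= \sum_i `|v ord0 i|.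
Proof.
have s0 : 0 <= \sum_i `|v ord0 i| by apply: sumr_ge0.
rewrite -(ler_pXn2r (_ : 0 < 2)%N) ?nnegrE ?enorm_ge0 // sqr_sqrtr; last first.
  by apply: sumr_ge0 => i _; rewrite sqr_ge0.
have : \sum_i v ord0 i ^+ 2 <= (\sum_i `|v ord0 i|) ^+ 2 /\ 0 <= \sum_i `|v ord0 i|.
  elim/big_rec2: _ => [|i x y _ [h x0]]; first by rewrite expr0n.
  have := normr_ge0 (v ord0 i); rewrite -(real_normK (num_real (v ord0 i))).
  by move: `|_| => z z0; split; nra.
by case.
Qed.

Lemma enorm_lt v c : (0 < k)%N -> (forall i, `|v ord0 i| < c) -> enorm v < k%:R * c.
Proof.
move=> k0 h; apply: (le_lt_trans (enorm_le_sum v)).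
have -> : k%:R * c = \sum_(i < k) c by rewrite sumr_const card_ord mulr_natl.
case: k k0 v h => // n _ v h.
by rewrite !big_ord_recl; apply: ltr_leD => //; apply: ler_sum => i _; apply: ltW.
Qed.

Lemma enorm_le v c : (forall i, `|v ord0 i| <= c) -> enorm v <= k%:R * c.
Proof.
move=> h; apply: (le_trans (enorm_le_sum v)).
have -> : k%:R * c = \sum_(i < k) c by rewrite sumr_const card_ord mulr_natl.
by apply: ler_sum => i _.
Qed.

Lemma orthogonal_tr O : orthogonal O -> O^T *m O = 1%:M.
Proof. by rewrite /orthogonal => /mulmx1C. Qed.

Lemma enorm_mul O v : orthogonal O -> enorm (v *m O) = enorm v.
Proof.
move=> oO; apply/eqP; rewrite -(eqrXn2 (_ : 0 < 2)%N) ?enorm_ge0 //.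
by rewrite !enormE trmx_mul mulmxA -(mulmxA v) oO mulmx1.
Qed.

End Euclid.

Section Rotation.
Variables (R : realType) (m : nat).
Implicit Types (v w : 'rV[R]_m.+1) (O : 'M[R]_m.+1).

(** The reflection in the hyperplane orthogonal to [v - w]. *)
Lemma householder v w : enorm v = enorm w -> exists O, orthogonal O /\ v *m O = w.
Proof.
move=> vw; have [u uE] : exists u, u = v - w by exists (v - w).
have [u0|u0] := eqVneq u 0.
  exists 1%:M; rewrite mulmx1; split; first by rewrite /orthogonal trmx1 mulmx1.
  by apply/eqP; rewrite -subr_eq0 -uE u0.
have dot (x y : 'rV[R]_m.+1) : x *m y^T = ((x *m y^T) ord0 ord0)%:M by exact: mx11_scalar.
pose n := (u *m u^T) ord0 ord0.
have n0 : n != 0.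
  rewrite /n -enormE expf_neq0 //; apply: contraNneq u0 => e0.
  apply/eqP/rowP => i; rewrite [RHS]mxE; apply/eqP; rewrite -normr_le0 -e0; exact: coord_le_enorm.
pose O := 1%:M - (2 / n) *: (u^T *m u).
have OT : O^T = O by rewrite /O linearB /= linearZ /= trmx1 trmx_mul trmxK.
exists O; split.
  rewrite /orthogonal OT /O mulmxBl mul1mx mulmxBr mulmx1 -scalemxAl -scalemxAr.
  have -> : u^T *m u *m (u^T *m u) = n *: (u^T *m u).
    by rewrite -mulmxA (mulmxA u) dot mul_scalar_mx -scalemxAr.
  rewrite !scalerA.
  have -> : 2 / n * (2 / n) * n = 2 / n + 2 / n by field.
  by rewrite scalerDl opprB addrK subrK.
(* This is where the norms have to agree: the reflection subtracts exactly [u] from [v]. *)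
have vu : n = 2 * (v *m u^T) ord0 ord0.
  have e1 : (v *m v^T) ord0 ord0 = (w *m w^T) ord0 ord0 by rewrite -!enormE vw.
  have e2 : (v *m w^T) ord0 ord0 = (w *m v^T) ord0 ord0.
    by rewrite -[v *m w^T]trmxK trmx_mul trmxK mxE.
  have tu : u^T = v^T - w^T by rewrite uE linearB.
  rewrite /n tu uE !mulmxBr !mulmxBl; move: e1 e2; rewrite !mxE => e1 e2.
  rewrite e2 -e1; ring.
rewrite /O mulmxBr mulmx1 -scalemxAr mulmxA (dot v) mul_scalar_mx scalerA.
have -> : 2 / n * (v *m u^T) ord0 ord0 = 1 by rewrite mulrAC -vu divff.
by rewrite scale1r uE opprB addrC subrK.
Qed.

(** A reflection of determinant -1 is corrected by changing the sign of the last coordinate, which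
    preserves the axis. *)
Lemma rotation_to_axis v : exists O, rotation O /\
  forall i, i != ord_max -> (v *m O) ord0 i = 0.
Proof.
pose w : 'rV[R]_m.+1 := enorm v *: delta_mx ord0 ord_max.
have vw : enorm v = enorm w.
  rewrite {2}/enorm (bigD1 ord_max) //= big1 => [|i im].
    by rewrite !mxE !eqxx mulr1 addr0 sqrtr_sqr ger0_norm // enorm_ge0.
  by rewrite !mxE eqxx (negbTE im) /= mulr0 expr0n.
have [U [oU vU]] := householder vw.
have w0 i : i != ord_max -> w ord0 i = 0.
  by move=> im; rewrite !mxE eqxx (negbTE im) /= mulr0.
have : \det U ^+ 2 = 1 by rewrite expr2 -{2}det_tr -det_mulmx oU det1.
move/eqP; rewrite sqrf_eq1 => /orP[/eqP dU|/eqP dU].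
  by exists U; split=> [//|i im]; rewrite vU w0.
pose D : 'M[R]_m.+1 := diag_mx (\row_i (if i == ord_max then -1 else 1)).
have DT : D^T = D by rewrite tr_diag_mx.
have DD : D *m D = 1%:M.
  apply/matrixP => i j; rewrite mul_diag_mx !mxE; case: (i == ord_max); case: (i == j);
  by rewrite ?mulr1n ?mulr0n ?mulr0 ?mulr1 // mulN1r opprK.
have detD : \det D = -1.
  rewrite det_diag (bigD1 ord_max) //= big1 => [|i im]; first by rewrite mxE eqxx mulr1.
  by rewrite mxE (negbTE im).
exists (U *m D); split.
  split; first by rewrite trmx_mul DT mulmxA -(mulmxA U) DD mulmx1.
  by rewrite det_mulmx dU detD mulrNN mulr1.
move=> i im; rewrite mulmxA vU mul_mx_diag mxE w0 // mul0r //.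
Qed.

End Rotation.

(** * Avoiding the first and last times *)

Section FinTypeCovers.
Variables (R : realType) (T : Type) (d : T -> T -> R) (s : nat).

Lemma measure_fin_union (I : finType) (A : set T) (B : I -> set T) (c : R) : 0 <= c ->
  A `<=` [set x | exists i, B i x] -> (forall i, (hausdorff_measure d s.+1 (B i) <= c%:E)%E) ->
  (hausdorff_measure d s.+1 A <= (#|I|%:R * c)%:E)%E.
Proof.
move=> c0 AB hB; apply: (@measure_finite_union _ _ d s A _ (B \o enum_val)) => // [x /AB [i Bx]|i].
  by exists (enum_rank i); rewrite /= enum_rankK.
exact: hB.
Qed.

Lemma content_fin_cover (I : finType) delta A (B : I -> set T) (r : R) : 0 <= r -> r <= delta ->
  A `<=` [set x | exists i, B i x] -> (forall i, (diamd d (B i) <= r%:E)%E) ->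
  (hausdorff_content d s.+1 delta A <= (#|I|%:R * r ^+ s.+1)%:E)%E.
Proof.
move=> r0 rd AB dB; apply: (@content_finite_cover _ _ d s delta A _ (B \o enum_val)) => // [x /AB [i Bx]|i].
  by exists (enum_rank i); rewrite /= enum_rankK.
exact: dB.
Qed.
End FinTypeCovers.

Lemma cover_count (R : fieldType) (M r K : R) (m : nat) : K != 0 -> 2 != 0 :> R ->
  4 * (2 * K) ^+ m.+1 * (M * (2 * (r / K)) ^+ m.+2) = r ^+ m.+2 * M * 4 ^+ m.+3 / (2 * K).
Proof.
move=> K0 tw; rewrite !exprMn exprVn !exprS.
have -> : 4 ^+ m = 2 ^+ m * 2 ^+ m :> R by rewrite -exprMn; congr (_ ^+ _); ring.
by field; rewrite ?expf_neq0 ?K0 ?tw.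
Qed.

Section TimeGood.
Variables (R : realType) (m : nat).
Implicit Types (S : set (ppoint R m)) (P Q : ppoint R m).
Local Notation c := (m.+1%:R : R).

(** The subdivision is in space only; both uses control time separately. *)
Definition scell P (r : R) (L : nat) (k : {ffun 'I_m.+1 -> 'I_(2 * L)}) : set (ppoint R m) :=
  [set Q : ppoint R m | forall i, (k i)%:R * (r / L%:R) <= Q.1 ord0 i - P.1 ord0 i + r < (k i).+1%:R * (r / L%:R)].

Lemma pcube_cell P (r : R) L Q : 0 < r -> (0 < L)%N -> pcube P r Q -> exists k : {ffun 'I_m.+1 -> 'I_(2 * L)}, scell P r k Q.
Proof.
move=> r0 L0 [h _]; pose eta := r / L%:R.
have L0R : 0 < L%:R :> R by rewrite ltr0n.
have e0 : 0 < eta by rewrite divr_gt0.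
have hb i : 0 <= (Q.1 ord0 i - P.1 ord0 i + r) / eta < (2 * L)%:R.
  have := h i; rewrite ltr_norml => /andP[h1 h2]; apply/andP; split.
    by apply: divr_ge0; [lra|exact: ltW].
  rewrite ltr_pdivrMr // natrM -mulrA /eta [L%:R * _]mulrC divfK ?gt_eqF //; lra.
have ht i : (Num.truncn ((Q.1 ord0 i - P.1 ord0 i + r) / eta) < 2 * L)%N.
  by have /andP[? ?] := hb i; rewrite truncn_lt_nat.
exists [ffun i => Ordinal (ht i)] => i; rewrite ffunE /=.
have /andP[b0 _] := hb i; have := truncn_itv b0.
by rewrite ler_pdivlMr // ltr_pdivrMr.
Qed.

Lemma scell_diff P (r : R) L (k : {ffun 'I_m.+1 -> 'I_(2 * L)}) Q Q' : scell P r k Q -> scell P r k Q' ->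
  forall i, `|Q'.1 ord0 i - Q.1 ord0 i| < r / L%:R.
Proof.
move=> h h' i; have := h i; have := h' i; move: (r / _) => x.
rewrite -natr1 ltr_norml => /andP[? ?] /andP[? ?]; apply/andP; split; lra.
Qed.

(** A slice is covered by [(2 * L) ^ m.+1] cells of diameter at most [c * r / L]; the exponent of
    the measure is larger by one, so the total is of order [1 / L]. *)
Lemma slice_null P (r tau : R) : 0 < r -> (sigma [set Q : ppoint R m | pcube P r Q /\ Q.2 = tau] <= 0)%E.
Proof.
move=> r0; apply: measure_ub => delta d0; apply/lee_addgt0Pr => eps eps0; rewrite add0e.
pose C := 2 ^+ m.+1 * (c * r) ^+ m.+2.
have c0 : 0 < c by [].
have C0 : 0 < C by rewrite mulr_gt0 // exprn_gt0 // mulr_gt0.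
pose L := (Num.truncn (C / eps + c * r / delta)).+1.
have LR : C / eps + c * r / delta < L%:R by exact: truncnS_gt.
have L0R : 0 < L%:R :> R by rewrite ltr0n.
have p1 : 0 < C / eps by rewrite divr_gt0.
have p2 : 0 < c * r / delta by rewrite divr_gt0 // mulr_gt0.
have Ld : c * (r / L%:R) <= delta.
  by rewrite mulrA ler_pdivrMr // [delta * _]mulrC -ler_pdivrMr //; lra.
apply: (@le_trans _ _ (#|{ffun 'I_m.+1 -> 'I_(2 * L)}|%:R * (c * (r / L%:R)) ^+ m.+2)%:E).
  apply: (@content_fin_cover _ _ _ _ _ _ _ (fun k : {ffun 'I_m.+1 -> 'I_(2 * L)} => [set Q : ppoint R m | scell P r k Q /\ Q.2 = tau])) => //.
  - by rewrite mulr_ge0 // divr_ge0 // ltW.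
  - move=> Q [cQ Qt]; have [k hk] := @pcube_cell P r L Q r0 (ltn0Sn _) cQ; by exists k.
  - move=> k; apply: diamd_le.
      by rewrite mulr_ge0 // divr_ge0 // ltW.
    move=> x y [hx xt] [hy yt]; rewrite /dpar xt yt subrr normr0 sqrtr0 addr0.
    by apply: enorm_le => i; rewrite !mxE; apply/ltW/(scell_diff hy hx).
rewrite card_ffun !card_ord lee_fin natrX natrM exprMn.
have -> : 2%:R ^+ m.+1 * L%:R ^+ m.+1 * (c * (r / L%:R)) ^+ m.+2 = C / L%:R.
  have x0 : L%:R ^+ m.+1 != 0 :> R by rewrite expf_neq0 // gt_eqF.
  rewrite /C mulrA exprMn exprVn [L%:R ^+ m.+2]exprS.
  move: (L%:R ^+ m.+1) x0 ((c * r) ^+ _) => x x0 y; field.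
  by rewrite x0 gt_eqF.
rewrite ler_pdivrMr // [eps * _]mulrC -ler_pdivrMr //; lra.
Qed.

Definition time_ok S (t : R) := (T0 S < t%:E)%E /\ (t%:E < T1 S)%E.

Lemma T0_le S Q : S Q -> (T0 S <= Q.2%:E)%E.
Proof. by move=> SQ; apply: ereal_inf_lbound; exists Q. Qed.

Lemma T1_ge S Q : S Q -> (Q.2%:E <= T1 S)%E.
Proof. by move=> SQ; apply: ereal_sup_ubound; exists Q. Qed.

Lemma time_good (M : R) : 0 < M -> exists2 cT : R, 0 < cT & forall S, parabolic_ADR S M ->
  forall P0 r0, admissible S P0 r0 -> exists P1, [/\ S P1, pcube P0 (r0 / (2 * c)) P1 &
    forall t, `|t - P1.2| <= cT * r0 ^+ 2 -> time_ok S t].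
Proof.
move=> M0; have c0 : 0 < c by [].
have c1 : 1 <= c by rewrite ler1n.
pose K := (Num.truncn (4 ^+ m.+3 * M ^+ 2)).+1.
have KR : 4 ^+ m.+3 * M ^+ 2 < K%:R by exact: truncnS_gt.
have K0 : 0 < K%:R :> R by rewrite ltr0n.
exists ((2 * c * K%:R)^-1 ^+ 2); first by rewrite exprn_gt0 // invr_gt0 !mulr_gt0.
move=> S adr P0 r0 [SP0 P0a P0b r00 r0d].
pose r := r0 / (2 * c); have rr : 0 < r by rewrite divr_gt0 // mulr_gt0.
pose eta := r / K%:R; have e0 : 0 < eta by rewrite divr_gt0.
have rr0 : r <= r0 by rewrite ler_pdivrMr ?mulr_gt0 //; nra.
have K1 : 1 <= K%:R :> R by rewrite ler1n.
have er : eta <= r by rewrite ler_pdivrMr //; nra.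
have -> : (2 * c * K%:R)^-1 ^+ 2 * r0 ^+ 2 = eta ^+ 2.
  by rewrite -exprMn; congr (_ ^+ 2); rewrite /eta /r; field; rewrite !gt_eqF.
have adm Q x : S Q -> (T0 S < Q.2%:E)%E -> (Q.2%:E < T1 S)%E -> 0 < x -> x <= r0 -> admissible S Q x.
  by move=> ? ? ? ? ?; split=> //; apply: le_lt_trans r0d; rewrite lee_fin.
have [low _] := adr P0 r (adm _ _ SP0 P0a P0b rr rr0).
apply: contrapT => nex.
have bad Q : Delta S P0 r Q -> (((Q.2 - eta ^+ 2)%:E <= T0 S)%E \/ (T1 S <= (Q.2 + eta ^+ 2)%:E)%E).
  move=> [SQ cQ]; apply: contrapT => /not_orP [/negP n1 /negP n2]; apply: nex; exists Q; split=> //.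
  rewrite -!ltNge in n1 n2.
  move=> t; rewrite ler_norml => /andP[t1 t2]; split.
    by apply: (lt_le_trans n1); rewrite lee_fin; lra.
  by apply: le_lt_trans n2; rewrite lee_fin; lra.
(* Upper regularity is available only at centers with time strictly inside, so points exactly at an
   end time go into two extra slices, which are null sets. *)
pose B (kb : ({ffun 'I_m.+1 -> 'I_(2 * K)} * bool) + bool) : set (ppoint R m) :=
  match kb with
  | inl (k, b) => [set Q : ppoint R m | [/\ Delta S P0 r Q, scell P0 r k Q, (T0 S < Q.2%:E)%E, (Q.2%:E < T1 S)%E &
      if b then ((Q.2 - eta ^+ 2)%:E <= T0 S)%E else (T1 S <= (Q.2 + eta ^+ 2)%:E)%E]]
  | inr b => [set Q : ppoint R m | Delta S P0 r Q /\ (if b then T0 S else T1 S) = Q.2%:E]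
  end.
pose v := M * (2 * eta) ^+ m.+2.
have v0 : 0 <= v by rewrite mulr_ge0 ?exprn_ge0 ?mulr_ge0 // ltW.
have hcov : Delta S P0 r `<=` [set Q : ppoint R m | exists kb, B kb Q].
  move=> Q DQ; have [SQ cQ] := DQ.
  have [k hk] := pcube_cell rr (ltn0Sn _ : 0 < K)%N cQ.
  have := T0_le SQ; rewrite le_eqVlt => /orP[/eqP h|h1]; first by exists (inr true).
  have := T1_ge SQ; rewrite le_eqVlt => /orP[/eqP h|h2]; first by exists (inr false).
  by case: (bad _ DQ) => h; [exists (inl (k, true))|exists (inl (k, false))].
have hB kb : (sigma (B kb) <= v%:E)%E.
  case: kb => [[k b]|b] /=; last first.
    set tb := (if b then _ else _).
    have [[Q [DQ tQ]]|nQ] := pselect (exists Q, Delta S P0 r Q /\ tb = Q.2%:E); last first.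
      apply: (@le_trans _ _ 0%E); last by rewrite lee_fin.
      apply: le_trans (slice_null P0 0 rr); apply: measure_mono => Q [h1 h2].
      by case: nQ; exists Q.
    apply: (@le_trans _ _ 0%E); last by rewrite lee_fin.
    apply: le_trans (slice_null P0 Q.2 rr); apply: measure_mono => Q' [[h1 h2] h3]; split=> //.
    by move: h3; rewrite tQ => -[].
  have [[Q [DQ kQ Q0 Q1 bQ]]|nQ] := pselect (exists Q, B (inl (k, b)) Q); last first.
    apply: (@le_trans _ _ 0%E); last by rewrite lee_fin.
    apply: le_trans (slice_null P0 0 rr); apply: measure_mono => Q h.
    by case: nQ; exists Q.
  have er0 : 2 * eta <= r0.
    have rh : r <= r0 / 2 by rewrite ler_pM2l // lef_pV2 ?posrE ?mulr_gt0 //; lra.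
    by have := le_trans er rh; rewrite ler_pdivlMr // mulrC.
  have e20 : 0 < 2 * eta by rewrite mulr_gt0.
  have [_ up] := adr Q (2 * eta) (adm _ _ DQ.1 Q0 Q1 e20 er0).
  apply: le_trans up; apply: measure_mono => Q' [DQ' kQ' Q0' Q1' bQ']; split; first exact: DQ'.1.
  split=> [i|]; first by have := scell_diff kQ kQ' i; rewrite -/eta; lra.
  have e2 : 0 < eta ^+ 2 by rewrite exprn_gt0.
  have -> : (2 * eta) ^+ 2 = 4 * eta ^+ 2 by ring.
  have : `|Q'.2 - Q.2| <= eta ^+ 2; last by lra.
  case: (b) bQ bQ' => bQ bQ'.
    have h1 := lt_le_trans (le_lt_trans bQ Q0') (lexx _); have h2 := le_lt_trans bQ' Q0.
    by rewrite !lte_fin in h1 h2; rewrite ler_norml; apply/andP; split; lra.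
  have h1 := lt_le_trans Q1' bQ; have h2 := lt_le_trans Q1 bQ'.
  by rewrite !lte_fin in h1 h2; rewrite ler_norml; apply/andP; split; lra.
have := le_trans low (measure_fin_union v0 hcov hB); rewrite lee_fin; apply/negP; rewrite -ltNge.
rewrite card_sum card_prod card_ffun !card_ord card_bool.
have n1 : (((2 * K) ^ m.+1 * 2 + 2)%N%:R <= 4 * (2 * K%:R) ^+ m.+1 :> R).
  have : 1 <= (2 * K%:R) ^+ m.+1 :> R by rewrite exprn_ege1 //; lra.
  rewrite natrD natrM natrX natrM; lra.
apply: (@le_lt_trans _ _ (4 * (2 * K%:R) ^+ m.+1 * v)); first by rewrite ler_wpM2r.
have -> : 4 * (2 * K%:R) ^+ m.+1 * v = r ^+ m.+2 * M * 4 ^+ m.+3 / (2 * K%:R).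
  by apply: cover_count; rewrite ?gt_eqF.
have : 0 < r ^+ m.+2 by rewrite exprn_gt0.
move: (r ^+ m.+2) (4 ^+ m.+3) KR => x y yK x0.
rewrite ltr_pdivrMr ?mulr_gt0 //.
have -> : x * M * y = M^-1 * x * (y * M ^+ 2) by field; rewrite gt_eqF.
by rewrite ltr_pM2l ?mulr_gt0 ?invr_gt0 //; lra.
Qed.

End TimeGood.

(** * Charts *)

Section Coordinates.
Variable m : nat.
(* Base coordinates: Some i is the i-th space coordinate, None is time. *)
Definition bidx := option 'I_m.
Definition bexp (i : bidx) : nat := if i is Some _ then 1 else 2.

Lemma bexp12 i : (0 < bexp i <= 2)%N. Proof. by case: i. Qed.

Lemma card_bidx : #|{: bidx}| = m.+1. Proof. by rewrite card_option card_ord. Qed.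

(** The homogeneous dimension of the base equals the regularity exponent of [S], so hits and base
    cells scale alike. *)
Lemma sum_bexp : (\sum_i bexp i)%N = m.+2.
Proof.
transitivity (\sum_(i : bidx) (1 + (i == None)))%N.
  by apply: eq_bigr => -[].
rewrite big_split /= sum1_card card_bidx -[RHS]addn1; congr addn.
by rewrite (bigD1 None) //= big1 // => i /negbTE ->.
Qed.
End Coordinates.

Section Chart.
Variables (R : realType) (m : nat) (U : 'M[R]_m.+1) (o : 'rV[R]_m.+1) (ot ru : R).
Hypothesis U_orth : orthogonal U.
Hypothesis ru_gt0 : 0 < ru.
Local Notation c := (m.+1%:R : R).
Local Notation bidx := (bidx m).
Local Notation e := (@bexp m).

Definition rowof (y : bidx -> R) (s : R) : 'rV[R]_m.+1 :=
  \row_j (if unlift ord_max j is Some i then y (Some i) else s).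
(** A parabolic dilation by [ru] in a rotated frame; applying [rot U] turns the height direction
    into the last coordinate axis. *)
Definition chart_pt (y : bidx -> R) (s : R) : ppoint R m := ((o + ru *: rowof y s) *m U^T, ot + ru ^+ 2 * y None).
Definition base_coord (P : ppoint R m) : bidx -> R := fun i => match i with
  | Some i => (P.1 *m U - o) ord0 (lift ord_max i) / ru
  | None => (P.2 - ot) / ru ^+ 2 end.
Definition height_coord (P : ppoint R m) : R := (P.1 *m U - o) ord0 ord_max / ru.

Let c_gt0 : 0 < c. Proof. by []. Qed.
Let c_ge1 : 1 <= c. Proof. by rewrite ler1n. Qed.

Lemma mulUK (v : 'rV[R]_m.+1) : v *m U^T *m U = v.
Proof. by rewrite -mulmxA orthogonal_tr // mulmx1. Qed.

Lemma mulUTK (v : 'rV[R]_m.+1) : v *m U *m U^T = v.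
Proof. by rewrite -mulmxA U_orth mulmx1. Qed.

Lemma UT_orth : orthogonal U^T.
Proof. by rewrite /orthogonal trmxK orthogonal_tr. Qed.

Lemma rowof_max y s : rowof y s ord0 ord_max = s.
Proof. by rewrite mxE unlift_none. Qed.

Lemma rowof_lift y s i : rowof y s ord0 (lift ord_max i) = y (Some i).
Proof. by rewrite mxE liftK. Qed.

Lemma cy_pt y s : base_coord (chart_pt y s) = y.
Proof.
apply/funext => -[i|]; rewrite /base_coord /chart_pt /= ?mulUK addrC addKr.
  by rewrite mxE rowof_lift mulrC mulKf // gt_eqF.
by rewrite mulrC mulKf // expf_neq0 // gt_eqF.
Qed.

Lemma cs_pt y s : height_coord (chart_pt y s) = s.
Proof. by rewrite /height_coord /chart_pt /= mulUK addrC addKr mxE rowof_max mulrC mulKf // gt_eqF. Qed.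

Lemma ptK P : chart_pt (base_coord P) (height_coord P) = P.
Proof.
case: P => X t; rewrite /chart_pt /=; congr pair; last first.
  by rewrite mulrCA divff ?mulr1 ?expf_neq0 ?gt_eqF // addrC subrK.
rewrite -[RHS]mulUTK; congr (_ *m _); apply/rowP => j.
rewrite mxE [X in _ + X]mxE; case: (unliftP ord_max j) => [i ->|->].
  rewrite rowof_lift /= mulrCA divff ?mulr1 ?gt_eqF // [X in _ + X]mxE [X in _ + (_ + X)]mxE addrC subrK //.
rewrite rowof_max /height_coord /= mulrCA divff ?mulr1 ?gt_eqF // [X in _ + X]mxE [X in _ + (_ + X)]mxE addrC subrK //.
Qed.

Lemma pt_diff y s y' s' : (chart_pt y' s').1 - (chart_pt y s).1 = (ru *: (rowof y' s' - rowof y s)) *m U^T.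
Proof. by rewrite /chart_pt /= -mulmxBl opprD addrACA subrr add0r scalerBr. Qed.

(** Cubes are not invariant under rotation; going through the Euclidean norm costs the factor [c],
    here and in [pcube_chart]. *)
Lemma pt_pcube y s y' s' r : inbox2 e y s r y' s' -> pcube (chart_pt y s) (c * (ru * r)) (chart_pt y' s').
Proof.
move=> [hy hs].
have r0 : 0 < r by apply: le_lt_trans hs.
split=> [i|] /=.
  have -> : (chart_pt y' s').1 ord0 i - (chart_pt y s).1 ord0 i = ((chart_pt y' s').1 - (chart_pt y s).1) ord0 i by rewrite !mxE.
  rewrite pt_diff; apply: le_lt_trans (coord_le_enorm _ _) _.
  rewrite (enorm_mul _ UT_orth) //; apply: enorm_lt => // j.
  rewrite !mxE normrM gtr0_norm // ltr_pM2l //.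
  by case: (unliftP ord_max j) => [k _|_] //; have := hy (Some k).
have := hy None; rewrite /= => h.
have -> : ot + ru ^+ 2 * y' None - (ot + ru ^+ 2 * y None) = ru ^+ 2 * (y' None - y None) by ring.
rewrite normrM gtr0_norm ?exprn_gt0 // !exprMn.
apply: (@lt_le_trans _ _ (ru ^+ 2 * r ^+ 2)); first by rewrite ltr_pM2l ?exprn_gt0.
by rewrite ler_peMl ?mulr_ge0 ?exprn_ge1 ?(ltW ru_gt0) ?(ltW r0) // ?exprn_ege1 // ltW ?exprn_gt0.
Qed.

Lemma pcube_chart P Q r r' : pcube P r' Q -> c * r' <= ru * r -> inbox2 e (base_coord P) (height_coord P) r (base_coord Q) (height_coord Q).
Proof.
move=> [hX ht] rr.
have r'0 : 0 < r' by have := hX ord0; apply: le_lt_trans.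
have h j : `|(Q.1 *m U - o) ord0 j / ru - (P.1 *m U - o) ord0 j / ru| < r.
  rewrite -mulrBl.
  have -> : (Q.1 *m U - o) ord0 j - (P.1 *m U - o) ord0 j = ((Q.1 - P.1) *m U) ord0 j.
    rewrite mulmxBl !mxE; ring.
  rewrite normrM normfV (gtr0_norm ru_gt0) ltr_pdivrMr // mulrC; apply: lt_le_trans rr.
  apply: le_lt_trans (coord_le_enorm _ _) _; rewrite enorm_mul //; apply: enorm_lt => // i.
  by rewrite !mxE.
split; last exact: h.
move=> [i|]; first exact: h.
rewrite /= -mulrBl.
have -> : Q.2 - ot - (P.2 - ot) = Q.2 - P.2 by ring.
rewrite normrM normfV (@gtr0_norm _ (ru ^+ 2)) ?exprn_gt0 // ltr_pdivrMr ?exprn_gt0 //.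
apply: (lt_le_trans ht); rewrite -exprMn mulrC lerXn2r ?nnegrE //; first exact: ltW.
  by apply: le_trans rr; rewrite mulr_ge0 // ltW.
by apply: le_trans rr; rewrite ler_peMl // ltW.
Qed.

Lemma pt_segment y s y' s' th : chart_pt (fun i => y i + th * (y' i - y i)) (s + th * (s' - s)) =
  ((chart_pt y s).1 + th *: ((chart_pt y' s').1 - (chart_pt y s).1), (chart_pt y s).2 + th * ((chart_pt y' s').2 - (chart_pt y s).2)).
Proof.
rewrite /chart_pt /=; congr pair; last by ring.
rewrite -mulmxBl scalemxAl -mulmxDl; congr (_ *m _); apply/rowP => j.
by rewrite !mxE; case: (unlift ord_max j) => [i|]; ring.
Qed.

Lemma dpar_ge y s y' s' r : 0 <= r ->
  (exists i : bidx, r ^+ e i < `|y' i - y i|) \/ r < `|s' - s| -> ru * r < dpar (chart_pt y' s') (chart_pt y s).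
Proof.
move=> r0 h.
have key j : r < `|rowof y' s' ord0 j - rowof y s ord0 j| -> ru * r < dpar (chart_pt y' s') (chart_pt y s).
  have -> : rowof y' s' ord0 j - rowof y s ord0 j = (rowof y' s' - rowof y s) ord0 j by rewrite !mxE.
  move=> hj; rewrite /dpar pt_diff (enorm_mul _ UT_orth) //.
  apply: (@lt_le_trans _ _ (enorm (ru *: (rowof y' s' - rowof y s)))); last by rewrite lerDl sqrtr_ge0.
  apply: lt_le_trans (coord_le_enorm _ j); rewrite mxE normrM gtr0_norm // ltr_pM2l //.
case: h => [[[i|] h]|h].
- by apply: (key (lift ord_max i)); rewrite !rowof_lift.
- apply: (@lt_le_trans _ _ (Num.sqrt `|(chart_pt y' s').2 - (chart_pt y s).2|)); last by rewrite lerDr enorm_ge0.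
  rewrite /chart_pt /=.
  have -> : ot + ru ^+ 2 * y' None - (ot + ru ^+ 2 * y None) = ru ^+ 2 * (y' None - y None) by ring.
  rewrite normrM gtr0_norm ?exprn_gt0 //.
  have -> : ru * r = Num.sqrt ((ru * r) ^+ 2) by rewrite sqrtr_sqr ger0_norm // mulr_ge0 // ltW.
  rewrite ltr_sqrt ?mulr_gt0 ?exprn_gt0 //; last by apply: le_lt_trans h; exact: sqr_ge0.
  by rewrite exprMn ltr_pM2l ?exprn_gt0.
- by apply: (key ord_max); rewrite !rowof_max.
Qed.

Variable S : set (ppoint R m).
Definition cconn y s y' s' := connected_component (~` S) (chart_pt y s) (chart_pt y' s').

Lemma cconn_sym y s y' s' : cconn y s y' s' -> cconn y' s' y s.
Proof. exact: connected_component_sym. Qed.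

Lemma cconn_trans y s y' s' y'' s'' : cconn y s y' s' -> cconn y' s' y'' s'' -> cconn y s y'' s''.
Proof. exact: connected_component_trans. Qed.

Lemma segment_connected_component (P Q : ppoint R m) :
  (forall th : R, 0 <= th <= 1 -> ~ S (P.1 + th *: (Q.1 - P.1), P.2 + th * (Q.2 - P.2))) ->
  connected_component (~` S) P Q.
Proof.
move=> h; pose g (th : R) : ppoint R m := (P.1 + th *: (Q.1 - P.1), P.2 + th * (Q.2 - P.2)).
have g0 : g 0 = P by rewrite /g scale0r mul0r !addr0; case: (P).
have g1 : g 1 = Q by rewrite /g scale1r mul1r ![_ + (_ - _)]addrC !subrK; case: (Q).
apply: (@connected_component_max _ (~` S) (g @` `[0, 1]) P).
- by exists 0 => //=; rewrite in_itv /= lexx ler01.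
- by move=> _ [th /= th01 <-]; apply: h; move: th01; rewrite in_itv.
- apply: connected_continuous_connected; first exact: segment_connected.
  apply: continuous_subspaceT => th.
  have h1 : (fun th : R => P.1 + th *: (Q.1 - P.1)) x @[x --> th] --> P.1 + th *: (Q.1 - P.1).
    by apply: cvgD; [exact: cvg_cst|apply: cvgZ; [exact: cvg_id|exact: cvg_cst]].
  have h2 : (fun th : R => P.2 + th * (Q.2 - P.2)) x @[x --> th] --> P.2 + th * (Q.2 - P.2).
    by apply: cvgD; [exact: cvg_cst|apply: cvgM; [exact: cvg_id|exact: cvg_cst]].
  exact: (cvg_pair h1 h2).
- by exists 1 => //=; rewrite in_itv /= lexx ler01.
Qed.

Lemma cconn_seg y s y' s' :
  (forall th : R, 0 <= th <= 1 -> ~ S (chart_pt (fun i => y i + th * (y' i - y i)) (s + th * (s' - s)))) ->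
  cconn y s y' s'.
Proof.
by move=> h; apply: segment_connected_component => th th01; rewrite -pt_segment; apply: h.
Qed.

End Chart.

Lemma mod4_sep (x y : nat) : x != y -> (x = y %[mod 4])%N -> (x + 4 <= y)%N || (y + 4 <= x)%N.
Proof. lia. Qed.

(** * Regularity and the two cube condition in a chart *)

Section ChartedSet.
Variables (R : realType) (m : nat) (U : 'M[R]_m.+1) (o : 'rV[R]_m.+1) (ot ru : R).
Hypothesis U_orth : orthogonal U.
Hypothesis ru_gt0 : 0 < ru.
Variables (S : set (ppoint R m)) (M B Rmax : R) (Pc : ppoint R m) (H : nat).
Local Notation c := (m.+1%:R : R).
Local Notation bidx := (bidx m).
Local Notation e := (@bexp m).
Local Notation chart_pt := (chart_pt U o ot ru).
Local Notation base_coord := (base_coord U o ot ru).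
Local Notation height_coord := (height_coord U o ru).
Local Notation rho := (@rho R).
Local Notation conn := (cconn U o ot ru S).
Definition charted y s := S (chart_pt y s).
Hypothesis M_gt0 : 0 < M.
Hypothesis adr : parabolic_ADR S M.
Hypothesis Rmax_diam : (Rmax%:E < pdiam S)%E.
Hypothesis ru_Rmax : c * ru <= Rmax.
Hypothesis B_Rmax : B * ru <= Rmax.
Hypothesis S_Pc : S Pc.
Hypothesis Pc_time : time_ok S Pc.2.
(** The window exceeds the base [[0, 17)] and the heights [[0, 3 * H)] by one unit, so that small
    cubes at hit points remain inside. *)
Hypothesis region : forall y s, (forall i, -1 <= y i <= 18) -> -1 <= s <= (3 * H)%:R + 1 ->
  time_ok S (chart_pt y s).2 /\ pcube Pc (B * ru) (chart_pt y s).

Let c_gt0 : 0 < c. Proof. by []. Qed.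
Let c_ge1 : 1 <= c. Proof. by rewrite ler1n. Qed.

Lemma charted_admissible Q r : S Q -> time_ok S Q.2 -> 0 < r -> r <= Rmax -> admissible S Q r.
Proof.
move=> SQ [t0 t1] r0 rR; split=> //; apply: le_lt_trans Rmax_diam; by rewrite lee_fin.
Qed.

Lemma ru_le : ru <= Rmax.
Proof. by apply: le_trans ru_Rmax; rewrite ler_peMl // ltW. Qed.

Lemma scale_le r : 0 < r -> r <= 1 -> ru * r / c <= Rmax.
Proof.
move=> r0 r1; apply: le_trans ru_le; rewrite ler_pdivrMr //.
have : 0 < ru * r by rewrite mulr_gt0.
have : ru * r <= ru by rewrite ler_piMr // ltW.
have := c_ge1; have := ru_gt0; nra.
Qed.

(** The condition is applied at radius [ru * rho j / c], whose cube fits into the chart box of size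
    [rho j]. The cubes obtained are at least [g1] times as large, and [a] is such that chart boxes
    of size [rho (j + a)] fit into them. *)
Lemma chart_conn_box (g1 : R) a j y s : weak_ts_two_cube S g1 -> rho a * c ^+ 2 <= g1 -> (0 < H)%N ->
  (0 < j)%N -> charted y s -> (forall i, 8 <= y i < 9) -> H%:R <= s <= (2 * H)%:R ->
  two_box e charted conn y s (rho j) (rho (j + a)).
Proof.
move=> tc ag H0 j0 Ey yr /andP[s1 s2].
have r0 := rho_gt0 R j; have r1 := rho_half R j0.
have Hp : 1 <= H%:R :> R by rewrite ler1n.
have H2 : (2 * H)%:R = 2 * H%:R :> R by rewrite natrM.
have H3 : (3 * H)%:R = 3 * H%:R :> R by rewrite natrM.
rewrite H2 in s2.
have reg w v : inbox2 e y s (rho j) w v -> time_ok S (chart_pt w v).2.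
  move=> [hw hv]; apply: (region _ _).1 => [i|].
    have := hw i; have /andP[? ?] := yr i.
    have : rho j ^+ e i <= 1 by apply: exprn_ile1; [exact: ltW|exact: rho_le1].
    by rewrite ltr_norml => ? /andP[? ?]; apply/andP; split; lra.
  by move: hv; rewrite H3 ltr_norml => /andP[? ?]; apply/andP; split; lra.
have box0 : inbox2 e y s (rho j) y s by split; [exact: inbox_refl|rewrite subrr normr0].
pose r := ru * rho j / c.
have rr : 0 < r by rewrite divr_gt0 ?mulr_gt0.
have adm : admissible S (chart_pt y s) r.
  by apply: charted_admissible => //; [exact: reg|apply: scale_le => //; exact: rho_le1].
have [rh [X1 [X2 [t12 [h1 h2 h3 h4 [p [q [Ap Bq pA qB npq]]]]]]]] := tc _ _ adm.
have crk : c * (ru * rho (j + a)) <= rh.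
  apply: le_trans h1; rewrite rhoD /r.
  have -> : g1 * (ru * rho j / c) = (ru * rho j / c) * g1 by ring.
  have -> : c * (ru * (rho j * rho a)) = (ru * rho j / c) * (rho a * c ^+ 2) by field; rewrite gt_eqF.
  by rewrite ler_pM2l.
have cb X w v : inbox2 e (base_coord (X, t12)) (height_coord (X, t12)) (rho (j + a)) w v -> pcube (X, t12) rh (chart_pt w v).
  move=> /(pt_pcube o ot U_orth ru_gt0); rewrite ptK // => -[a1 a2]; split=> [i|].
    exact: lt_le_trans (a1 i) crk.
  apply: lt_le_trans a2 _; rewrite lerXn2r ?nnegrE // ?(le_trans _ crk) // ltW //;
  by rewrite !mulr_gt0 ?rho_gt0.
have inb X w v : pcube (X, t12) rh `<=` pcube (chart_pt y s) r -> pcube (X, t12) rh (chart_pt w v) -> inbox2 e y s (rho j) w v.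
  move=> sub /sub h.
  have cr : c * r <= ru * rho j by rewrite /r mulrC divfK // gt_eqF.
  have := pcube_chart o ot U_orth ru_gt0 h cr.
  by rewrite !cy_pt // !cs_pt.
exists (base_coord (X1, t12)), (height_coord (X1, t12)), (base_coord (X2, t12)), (height_coord (X2, t12)); split.
  move=> w v [/cb h|/cb h]; (split; first exact: inb h).
    have := pA (chart_pt w v); rewrite /=; move=> /(_ (conj h (reg _ _ (inb _ _ _ h3 h)))).
    by move/connected_component_sub.
  have := qB (chart_pt w v); rewrite /=; move=> /(_ (conj h (reg _ _ (inb _ _ _ h4 h)))).
  by move/connected_component_sub.
move=> w v w' v' /cb h /cb h' cn; apply: npq.
have h5 := pA (chart_pt w v) (conj h (reg _ _ (inb _ _ _ h3 h))).
have h6 := qB (chart_pt w' v') (conj h' (reg _ _ (inb _ _ _ h4 h'))).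
apply: connected_component_trans h5 _; apply: connected_component_trans cn _.
exact: connected_component_sym h6.
Qed.

Lemma inrow_diff (J a K : nat) (nu : 'I_K) (s s' : R) :
  nu%:R <= s * (2 ^ (J + a))%:R < nu.+1%:R -> nu%:R <= s' * (2 ^ (J + a))%:R < nu.+1%:R ->
  `|s' - s| < rho (J + a).
Proof.
have P0 : 0 < (2 ^ (J + a))%:R :> R by rewrite ltr0n expn_gt0.
move=> /andP[a1 a2] /andP[b1 b2].
rewrite -(ltr_pM2r P0) -{1}(gtr0_norm P0) -normrM /rho mulVf ?gt_eqF // mulrBl ltr_norml.
rewrite -natr1 in a2 b2; apply/andP; split; lra.
Qed.

(** A cube of radius [ru * rho j / c] is covered by the hit cells, each contained in a cube of
    radius [c * ru * rho (J + a)] centered on [S]. Regularity at both radii, whose quotient is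
    [2 ^ (J + a - j) / c ^ 2], gives the count and the size of [CL]. *)
Lemma chart_hits_lower (a J CL : nat) j y s : M ^+ 2 * c ^+ (2 * m.+2) <= CL%:R ->
  (j <= J)%N -> charted y s -> (forall i, 4 <= y i <= 13) ->
  rho j <= s <= (3 * H)%:R - rho j ->
  (2 ^ ((\sum_i e i) * (J + a - j)) <=
   CL * #|[set p : {ffun bidx -> 'I_(17 * 2 ^ (2 * (J + a)))} * 'I_(3 * H * 2 ^ (J + a)) |
           hitnear e charted y s (rho j) p.1 p.2]%SET|)%N.
Proof.
move=> hCL jJ Ey yr /andP[s1 s2].
set X := [set p | _]%SET.
have r0 := rho_gt0 R j; have r1 := rho_le1 R j.
have jJ1 : (j <= J + a)%N by rewrite (leq_trans jJ) // leq_addr.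
have reg w v : inbox2 e y s (rho j) w v -> (forall i, 3 < w i < 14) /\ 0 <= v < (3 * H)%:R.
  move=> [hw hv]; split=> [i|].
    have := hw i; have /andP[? ?] := yr i.
    have : rho j ^+ e i <= 1 by apply: exprn_ile1; [exact: ltW|].
    by rewrite ltr_norml => ? /andP[? ?]; apply/andP; split; lra.
  by move: hv; rewrite ltr_norml => /andP[? ?]; apply/andP; split; lra.
have regt w v : inbox2 e y s (rho j) w v -> time_ok S (chart_pt w v).2.
  move=> /reg [hw /andP[v0 v1]]; apply: (region _ _).1 => [i|].
    by have /andP[? ?] := hw i; apply/andP; split; lra.
  by apply/andP; split; lra.
have box0 : inbox2 e y s (rho j) y s by split; [exact: inbox_refl|rewrite subrr normr0].
pose r := ru * rho j / c; have rr : 0 < r by rewrite divr_gt0 ?mulr_gt0.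
pose r' := c * (ru * rho (J + a)).
have rr' : 0 < r' by rewrite !mulr_gt0 ?rho_gt0.
have r'R : r' <= Rmax.
  apply: le_trans ru_Rmax; rewrite ler_pM2l // ler_piMr ?rho_le1 // ltW //.
have adm : admissible S (chart_pt y s) r.
  by apply: charted_admissible => //; [exact: regt|exact: scale_le].
have [low _] := adr adm.
pose Bx (x : {p | p \in X}) : set (ppoint R m) :=
  [set Q : ppoint R m | [/\ S Q, incell e (val x).1 (base_coord Q) & inrow (val x).2 (height_coord Q)]].
have cov : Delta S (chart_pt y s) r `<=` [set Q : ppoint R m | exists x, Bx x Q].
  move=> Q [SQ cQ].
  have bQ : inbox2 e y s (rho j) (base_coord Q) (height_coord Q).
    have cr : c * r <= ru * rho j by rewrite /r mulrC divfK // gt_eqF.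
    have := pcube_chart o ot U_orth ru_gt0 cQ cr.
    by rewrite !cy_pt // !cs_pt.
  have [hw hv] := reg _ _ bQ.
  have [w hww] : exists w : {ffun bidx -> 'I_(17 * 2 ^ (2 * (J + a)))}, incell e w (base_coord Q).
    apply: exists_cell => [i|i]; first exact: bexp12.
    by have /andP[lo hi] := hw i; rewrite (le_trans _ (ltW lo)) ?(lt_trans hi) ?ltr_nat ?ler0n.
  have [nu hnu] := exists_row a J hv.
  have xX : (w, nu) \in X.
    by rewrite inE /=; apply/asboolP; exists (base_coord Q), (height_coord Q); split=> //; rewrite /charted ptK.
  by exists (exist _ (w, nu) xX).
have hB x : (sigma (Bx x) <= (M * r' ^+ m.+2)%:E)%E.
  case: x => -[w nu] xX; rewrite /Bx /=.
  have := xX; rewrite inE /= => /asboolP[z [v [Ez cz rz bz]]].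
  have adm' : admissible S (chart_pt z v) r' by apply: charted_admissible => //; exact: regt.
  have [_ up] := adr adm'; apply: le_trans up; apply: measure_mono => Q [SQ cQ rQ]; split=> //.
  rewrite -[Q](ptK o ot U_orth ru_gt0); apply: pt_pcube => //; split.
    exact: inbox_of_cell (leqnn _) _ cz cQ.
  exact: inrow_diff rz rQ.
have v0 : 0 <= M * r' ^+ m.+2 by rewrite mulr_ge0 // ?exprn_ge0 // ltW.
have := le_trans low (measure_fin_union v0 cov hB); rewrite lee_fin card_sig.
have -> : #|[pred x | x \in X]| = #|X| by apply: eq_card.
have -> : r = r' * ((2 ^ (J + a - j))%:R / c ^+ 2).
  rewrite /r /r' -(rho_J1 R jJ1) /rho; field.
  by rewrite !gt_eqF // ltr0n expn_gt0.
rewrite exprMn mulrCA [X in _ <= X]mulrA [X in _ <= X]mulrC ler_pM2l ?exprn_gt0 // => hX.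
rewrite sum_bexp -(ler_nat R) natrM mulnC expnM natrX.
move: hX; rewrite exprMn exprVn -exprM.
move: (_ ^+ m.+2) => z; have k0 : 0 < c ^+ (2 * m.+2) by rewrite exprn_gt0.
rewrite mulrA ler_pdivrMr // ler_pdivrMl // => hz.
apply: (le_trans hz); move: hCL k0; move: (c ^+ _) => k hCL k0.
have -> : M * (#|X|%:R * M * k) = (M ^+ 2 * k) * #|X|%:R by ring.
by rewrite ler_wpM2r.
Qed.

Lemma cell_sep (a J : nat) (w w' : {ffun bidx -> 'I_(17 * 2 ^ (2 * (J + a)))}) z z' i :
  incell e w z -> incell e w' z' -> w i != w' i -> (w i = w' i %[mod 4])%N ->
  3 * rho (J + a) ^+ e i < `|z' i - z i|.
Proof.
move=> hz hz' ne md; have m0 := mesh_gt0 R e a J i.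
have /andP[a1 a2] := hz i; have /andP[b1 b2] := hz' i.
rewrite -(ltr_pM2r m0) -mulrA rho_side // /side subnn muln0 mulr1.
rewrite -{1}(gtr0_norm m0) -normrM mulrBl ltr_normr.
have : (w i + 4 <= w' i)%N || (w' i + 4 <= w i)%N.
  have ne' : (w i != w' i :> nat) by [].
  exact: mod4_sep.
rewrite -natr1 in a2; rewrite -natr1 in b2.
case/orP; rewrite -(ler_nat R) natrD => h; apply/orP; [left|right]; lra.
Qed.

Lemma row_sep (a J K : nat) (nu nu' : 'I_K) (s s' : R) :
  nu%:R <= s * (2 ^ (J + a))%:R < nu.+1%:R -> nu'%:R <= s' * (2 ^ (J + a))%:R < nu'.+1%:R ->
  nu != nu' -> (nu = nu' %[mod 4])%N -> 3 * rho (J + a) < `|s' - s|.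
Proof.
have P0 : 0 < (2 ^ (J + a))%:R :> R by rewrite ltr0n expn_gt0.
move=> /andP[a1 a2] /andP[b1 b2] ne md.
rewrite -(ltr_pM2r P0) -mulrA /rho mulVf ?gt_eqF // mulr1.
rewrite -{1}(gtr0_norm P0) -normrM mulrBl ltr_normr.
have : (nu + 4 <= nu')%N || (nu' + 4 <= nu)%N.
  have ne' : (nu != nu' :> nat) by [].
  exact: mod4_sep.
rewrite -natr1 in a2; rewrite -natr1 in b2.
case/orP; rewrite -(ler_nat R) natrD => h; apply/orP; [left|right]; lra.
Qed.

(** Different hits in one residue class modulo 4 are more than 3 sides apart in some direction, so
    small cubes at points of [S] chosen in them stay [ru * rho (J + a)] apart. By
    [measure_separated] their lower bounds add up to at most the upper bound for
    [Delta S Pc (B * ru)]. *)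
Lemma hit_class_card (a J : nat) (I : finType)
  (w : I -> {ffun bidx -> 'I_(17 * 2 ^ (2 * (J + a)))}) (nu : I -> 'I_(3 * H * 2 ^ (J + a))) :
  (forall x, hitp e charted (w x) (nu x)) ->
  (forall x x', x != x' -> (exists i, w x i != w x' i) \/ nu x != nu x') ->
  (forall x x' i, (w x i = w x' i %[mod 4])%N) -> (forall x x', (nu x = nu x' %[mod 4])%N) ->
  #|I|%:R <= 2 * M ^+ 2 * (2 * c * B) ^+ m.+2 * ((2 ^ (J + a))%:R) ^+ m.+2.
Proof.
move=> hh hne hw hnu.
have r0 := rho_gt0 R (J + a); have r1 := rho_le1 R (J + a).
have B0 : 0 < B * ru.
  have y0 (i : bidx) : -1 <= (0 : R) <= 18 by rewrite oppr_le0 ler01 ler0n.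
  have s0 : -1 <= (0 : R) <= (3 * H)%:R + 1 by rewrite oppr_le0 ler01 addr_ge0 ?ler0n.
  by have [_ [/(_ ord0) h _]] := @region (fun=> 0) 0 y0 s0; apply: le_lt_trans h.
have hQ x : exists Q, [/\ S Q, incell e (w x) (base_coord Q), inrow (nu x) (height_coord Q) & forall i, base_coord Q i < 17].
  have /asboolP[y [s [Ey cw rn y17]]] := hh x; exists (chart_pt y s); split=> //; rewrite ?cy_pt ?cs_pt //.
have [q hq] := choice hQ.
have qr x : (forall i, 0 <= base_coord (q x) i < 17) /\ 0 <= height_coord (q x) < (3 * H)%:R.
  have [_ cw rn y17] := hq x; split=> [i|].
    rewrite y17 andbT; have /andP[h _] := cw i.
    by rewrite -(pmulr_lge0 _ (mesh_gt0 R e a J i)); apply: le_trans h.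
  have P0 : 0 < (2 ^ (J + a))%:R :> R by rewrite ltr0n expn_gt0.
  move/andP: rn => [n1 n2]; apply/andP; split.
    by rewrite -(pmulr_lge0 _ P0); apply: le_trans n1.
  rewrite -(ltr_pM2r P0); apply: (lt_le_trans n2).
  by rewrite -natrM ler_nat; exact: ltn_ord.
pose r := ru * rho (J + a) / (2 * c).
have rr : 0 < r by rewrite divr_gt0 // !mulr_gt0.
have rR : r <= Rmax.
  apply: le_trans (scale_le r0 r1); rewrite ler_pM2l ?mulr_gt0 // lef_pV2 ?posrE ?mulr_gt0 //.
  by have := c_gt0; lra.
have cr : c * r = ru * (rho (J + a) / 2) by rewrite /r; field; rewrite gt_eqF.
have near_q x Q : pcube (q x) r Q -> inbox2 e (base_coord (q x)) (height_coord (q x)) (rho (J + a) / 2) (base_coord Q) (height_coord Q).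
  by move=> h; apply: (pcube_chart o ot U_orth ru_gt0 h); rewrite cr.
pose A x := Delta S (q x) r.
have AB x : A x `<=` Delta S Pc (B * ru).
  move=> Q [SQ /near_q [h1 h2]]; split=> //; rewrite -[Q](ptK o ot U_orth ru_gt0).
  have [hy hs] := qr x; apply: (region _ _).2 => [i|].
    have := h1 i; have : (rho (J + a) / 2) ^+ e i <= 1 by apply: exprn_ile1; lra.
    by rewrite ltr_norml => ? /andP[? ?]; have /andP[? ?] := hy i; apply/andP; split; lra.
  by move: h2 hs; rewrite ltr_norml => /andP[? ?] /andP[? ?]; apply/andP; split; lra.
have sep x x' Q Q' : x != x' -> A x Q -> A x' Q' -> ru * rho (J + a) < dpar Q Q'.
  move=> xx' [_ /near_q [b1 b2]] [_ /near_q [b1' b2']].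
  have [_ cw rn _] := hq x; have [_ cw' rn' _] := hq x'.
  rewrite -[Q](ptK o ot U_orth ru_gt0) -[Q'](ptK o ot U_orth ru_gt0).
  apply: dpar_ge => //; first exact: ltW.
  case: (hne _ _ xx') => [[i hi]|hn].
    left; exists i; have := cell_sep cw cw' hi (hw _ _ _).
    have := b1 i; have := b1' i.
    have : (rho (J + a) / 2) ^+ e i <= rho (J + a) ^+ e i / 2 /\ 0 < rho (J + a) ^+ e i.
      by rewrite exprn_gt0 //; split=> //; case: i {hi} => [i|] /=; rewrite ?expr1 ?expr2; nra.
    move: (_ ^+ e i) (_ ^+ e i) => x1 x2 [x12 x20].
    rewrite !ltr_norml ltr_normr => /andP[? ?] /andP[? ?] /orP[?|?].
      by rewrite distrC ltr_normr; apply/orP; left; lra.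
    by rewrite ltr_normr; apply/orP; left; lra.
  right; have := row_sep rn rn' hn (hnu _ _).
  move: b2 b2'; rewrite !ltr_norml ltr_normr => /andP[? ?] /andP[? ?] /orP[?|?].
    by rewrite distrC ltr_normr; apply/orP; left; lra.
  by rewrite ltr_normr; apply/orP; left; lra.
(* Half of the regularity bound, because [measure_separated] asks for a strict inequality. *)
pose v := M^-1 * r ^+ m.+2 / 2.
have v0 : 0 < v by rewrite divr_gt0 // mulr_gt0 ?invr_gt0 ?exprn_gt0.
have low x : (v%:E < sigma (A x))%E.
  have [SQ _ _ _] := hq x.
  have tQ : time_ok S (q x).2.
    rewrite -[q x](ptK o ot U_orth ru_gt0); have [hy /andP[hs1 hs2]] := qr x.
    apply: (region _ _).1 => [i|]; last by apply/andP; split; lra.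
    by have /andP[? ?] := hy i; apply/andP; split; lra.
  have [low _] := adr (charted_admissible SQ tQ rr rR).
  by apply: lt_le_trans low; rewrite lte_fin; rewrite /v in v0 *; lra.
have [_ up] := adr (charted_admissible S_Pc Pc_time B0 B_Rmax).
have rp : 0 < ru * rho (J + a) by rewrite mulr_gt0.
have := le_trans (measure_separated (ltW v0) rp AB sep low) up.
rewrite lee_fin -ler_pdivlMr // => h; apply: (le_trans h).
have rE : (2 ^ (J + a))%:R = (rho (J + a))^-1 :> R by rewrite invrK.
rewrite rE /v /r le_eqVlt; apply/orP; left; apply/eqP.
rewrite !exprMn !exprVn !exprMn.
have r0' : rho (J + a) ^+ m.+2 != 0 by rewrite expf_neq0 // gt_eqF.
have ru0 : ru ^+ m.+2 != 0 by rewrite expf_neq0 // gt_eqF.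
have c0 : c ^+ m.+2 != 0 by rewrite expf_neq0 // gt_eqF.
have t0 : 2 ^+ m.+2 != 0 :> R by rewrite expf_neq0 // gt_eqF.
move: (_ ^+ m.+2) (ru ^+ _) (c ^+ _) (2 ^+ _) (B ^+ _) r0' ru0 c0 t0 => x1 x2 x3 x4 x5 h1 h2 h3 h4.
by field; rewrite ?h1 ?h2 ?h3 ?h4 ?gt_eqF.
Qed.

(** There are [4 ^ m.+2] residue classes: [m.+1] base coordinates and the row. *)
Lemma chart_hits_upper (a J CU : nat) : (4 ^ m.+2)%:R * (2 * M ^+ 2 * (2 * c * B) ^+ m.+2) <= CU%:R ->
  (\sum_(w : {ffun bidx -> 'I_(17 * 2 ^ (2 * (J + a)))}) hits e charted H w <= CU * 2 ^ ((\sum_i e i) * (J + a)))%N.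
Proof.
move=> hCU; pose W := {ffun bidx -> 'I_(17 * 2 ^ (2 * (J + a)))}.
pose V := 'I_(3 * H * 2 ^ (J + a)).
pose colors := ({ffun bidx -> 'I_4} * 'I_4)%type.
pose color (p : W * V) : colors := ([ffun i => inord (p.1 i %% 4)], inord (p.2 %% 4)).
pose X (k : colors) (p : W * V) := hitp e charted p.1 p.2 && (color p == k).
have hX k : #|[pred p | X k p]|%:R <= 2 * M ^+ 2 * (2 * c * B) ^+ m.+2 * ((2 ^ (J + a))%:R) ^+ m.+2.
  rewrite -card_sig.
  apply: (@hit_class_card a J {p | X k p} (fun x => (val x).1) (fun x => (val x).2)).
  - by move=> [p /= /andP[]].
  - move=> [p hp] [p' hp'] /= ne; apply: contrapT => /not_orP [n1 /negP]; rewrite negbK => /eqP n2.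
    case/eqP: ne; apply: val_inj => /=; case: p p' {hp hp'} n1 n2 => [w nu] [w' nu'] /= n1 ->.
    congr pair; apply/ffunP => i; apply: contrapT => /eqP h; apply: n1; by exists i.
  - move=> [p /= /andP[_ /eqP c1]] [p' /= /andP[_ /eqP c2]] i.
    have := congr1 (fun k : colors => nat_of_ord (k.1 i)) (etrans c1 (esym c2)).
    by rewrite /= !ffunE !inordK ?ltn_pmod.
  - move=> [p /= /andP[_ /eqP c1]] [p' /= /andP[_ /eqP c2]].
    have := congr1 (fun k : colors => nat_of_ord k.2) (etrans c1 (esym c2)).
    by rewrite /= !inordK ?ltn_pmod.
have -> : (\sum_(w : W) hits e charted H w = \sum_(k : colors) #|[pred p | X k p]|)%N.
  transitivity (\sum_(p : W * V) hitp e charted p.1 p.2)%N.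
    by rewrite -(pair_bigA _ (fun w nu => nat_of_bool (hitp e charted w nu))); apply: eq_bigr => w _; rewrite /hits card_sum1.
  rewrite (eq_bigr (fun k => \sum_(p : W * V) X k p)%N); last first.
    by move=> k _; rewrite -card_sum1; apply: eq_card => p; rewrite !inE.
  rewrite exchange_big /=; apply: eq_bigr => p _; rewrite (bigD1 (color p)) //= /X eqxx andbT big1 ?addn0 //.
  by move=> k kp; rewrite eq_sym (negbTE kp) andbF.
have pE : (2 ^ (m.+2 * (J + a)))%:R = ((2 ^ (J + a))%:R) ^+ m.+2 :> R by rewrite mulnC expnM natrX.
rewrite sum_bexp -(ler_nat R) natr_sum natrM pE.
apply: (@le_trans _ _ (\sum_(k : colors) (2 * M ^+ 2 * (2 * c * B) ^+ m.+2 * ((2 ^ (J + a))%:R) ^+ m.+2))).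
  by apply: ler_sum => k _; apply: hX.
rewrite sumr_const -[X in X <= _]mulr_natl card_prod card_ffun !card_ord card_bidx -expnSr [X in X <= _]mulrA.
by apply: ler_wpM2r => //; rewrite exprn_ge0.
Qed.

Lemma chart_conn_seg y s y' s' :
  (forall th : R, 0 <= th <= 1 -> ~ charted (fun i => y i + th * (y' i - y i)) (s + th * (s' - s))) ->
  conn y s y' s'.
Proof. exact: cconn_seg. Qed.

(* Every vertical segment joining the two cubes meets S. *)
Lemma chart_section (PA PB : ppoint R m) (r : R) (ht : R) :
  c * ru <= r -> H%:R <= ht <= (2 * H)%:R -> (0 < H)%N ->
  (forall i, base_coord PA i = 17 / 2) -> (forall i, base_coord PB i = 17 / 2) -> height_coord PA = H%:R -> height_coord PB = ht ->
  different_components S (pcube PA r `&` slab S) (pcube PB r `&` slab S) ->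
  exists f : (bidx -> R) -> R, forall y, (forall i, 8 <= y i < 9) ->
    charted y (f y) /\ H%:R <= f y <= (2 * H)%:R.
Proof.
move=> cr /andP[h1 h2] H0 yA yB sA sB [p [q [Ap Bq pA qB npq]]].
suff h y : exists v, (forall i, 8 <= y i < 9) -> charted y v /\ H%:R <= v <= (2 * H)%:R.
  by have [f hf] := choice h; exists f.
have [yr|ny] := pselect (forall i, 8 <= y i < 9); last by exists 0 => /ny.
have Hp : 1 <= H%:R :> R by rewrite ler1n.
have H2 : (2 * H)%:R = 2 * H%:R :> R by rewrite natrM.
have H3 : (3 * H)%:R = 3 * H%:R :> R by rewrite natrM.
have reg v : H%:R <= v <= ht -> time_ok S (chart_pt y v).2.
  move=> /andP[? ?]; apply: (region _ _).1 => [i|].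
    by have /andP[? ?] := yr i; apply/andP; split; lra.
  by rewrite H3; rewrite H2 in h2; apply/andP; split; lra.
have incube P v : (forall i, base_coord P i = 17 / 2) -> height_coord P = v -> pcube P r (chart_pt y v).
  move=> yP sP.
  (* Coordinates differ from [17 / 2] by at most [1 / 2], and [1 / 2 < (3 / 4) ^ 2] covers time as
     well. *)
  have : inbox2 e (base_coord P) (height_coord P) (3 / 4) y v.
    split=> [i|]; last by rewrite sP subrr normr0; lra.
    rewrite yP; have /andP[? ?] := yr i.
    by case: (e_cases (@bexp12 m) i) => ->; rewrite ltr_norml ?expr1 ?expr2; apply/andP; split; lra.
  move=> /(pt_pcube o ot U_orth ru_gt0); rewrite ptK // => -[a1 a2].
  have le1 : c * (ru * (3 / 4)) <= r.
    apply: le_trans cr; rewrite ler_pM2l // ler_piMr ?ltW //; lra.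
  have le0 : 0 <= c * (ru * (3 / 4)) by rewrite !mulr_ge0 // ?ltW //; lra.
  split=> [i|]; first exact: lt_le_trans (a1 i) le1.
  by apply: lt_le_trans a2 _; rewrite lerXn2r ?nnegrE ?(le_trans le0).
have hA := pA _ (conj (incube PA _ yA sA) (reg _ (introT andP (conj (lexx _) h1)))).
have hB := qB _ (conj (incube PB _ yB sB) (reg _ (introT andP (conj h1 (lexx _))))).
have nc : ~ conn y H%:R y ht.
  move=> cn; apply: npq; apply: connected_component_trans hA _.
  by apply: connected_component_trans cn _; exact: connected_component_sym.
have [v [/andP[v1 v2] Ev]] := vertical_hit chart_conn_seg h1 nc.
exists v => _; split=> //; apply/andP; split=> //; exact: le_trans h2.
Qed.

End ChartedSet.

(** * Passing to the limit *)

Section McShane.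
Variables (R : realType) (k : nat).

Lemma enormD (v w : 'rV[R]_k) : enorm (v + w) <= enorm v + enorm w.
Proof.
have cauchy : \sum_i v ord0 i * w ord0 i <= enorm v * enorm w.
  have e0 (x : 'rV[R]_k) : enorm x = 0 -> forall i, x ord0 i = 0.
    by move=> x0 i; apply/eqP; rewrite -normr_le0 -x0; exact: coord_le_enorm.
  have [v0|v0] := eqVneq (enorm v) 0.
    by rewrite v0 mul0r big1 // => i _; rewrite e0 // mul0r.
  have [w0|w0] := eqVneq (enorm w) 0.
    by rewrite w0 mulr0 big1 // => i _; rewrite [w _ _]e0 // mulr0.
  have vp : 0 < enorm v by rewrite lt_neqAle eq_sym v0 enorm_ge0.
  have wp : 0 < enorm w by rewrite lt_neqAle eq_sym w0 enorm_ge0.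
  have sq (x : 'rV[R]_k) : \sum_i x ord0 i ^+ 2 = enorm x ^+ 2.
    by rewrite sqr_sqrtr // sumr_ge0 // => i _; rewrite sqr_ge0.
  apply: (@le_trans _ _ (\sum_i (enorm w / enorm v / 2 * v ord0 i ^+ 2 + enorm v / enorm w / 2 * w ord0 i ^+ 2))).
    apply: ler_sum => i _; move: (v ord0 i) (w ord0 i) => x y.
    rewrite -subr_ge0.
    have -> : enorm w / enorm v / 2 * x ^+ 2 + enorm v / enorm w / 2 * y ^+ 2 - x * y =
       (enorm w * x - enorm v * y) ^+ 2 / (2 * enorm v * enorm w) by field; rewrite v0 w0.
    by rewrite divr_ge0 ?sqr_ge0 // !mulr_ge0 // ltW.
  rewrite big_split /= -!mulr_sumr !sq le_eqVlt; apply/orP; left; apply/eqP.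
  by field; rewrite v0 w0.
have s0 : 0 <= enorm v + enorm w by rewrite addr_ge0 ?enorm_ge0.
rewrite -(ler_pXn2r (_ : 0 < 2)%N) ?nnegrE ?enorm_ge0 //.
have -> : enorm (v + w) ^+ 2 = enorm v ^+ 2 + enorm w ^+ 2 + 2 * \sum_i v ord0 i * w ord0 i.
  rewrite ![enorm _ ^+ 2]sqr_sqrtr ?sumr_ge0 // => [|i _|i _|i _]; rewrite ?sqr_ge0 //.
  rewrite mulr_sumr -!big_split /=; apply: eq_bigr => i _; rewrite mxE; ring.
rewrite sqrrD; lra.
Qed.

Lemma enormB_sym (v w : 'rV[R]_k) : enorm (v - w) = enorm (w - v).
Proof. by rewrite /enorm; congr Num.sqrt; apply: eq_bigr => i _; rewrite !mxE -sqrrN opprB. Qed.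

Lemma enorm0 : enorm (0 : 'rV[R]_k) = 0.
Proof. by rewrite /enorm big1 ?sqrtr0 // => i _; rewrite mxE expr0n. Qed.

Definition gdist (p q : 'rV[R]_k * R) : R := enorm (p.1 - q.1) + Num.sqrt `|p.2 - q.2|.

Lemma gdist_ge0 p q : 0 <= gdist p q.
Proof. by rewrite addr_ge0 ?enorm_ge0 ?sqrtr_ge0. Qed.

Lemma gdist_sym p q : gdist p q = gdist q p.
Proof. by rewrite /gdist enormB_sym distrC. Qed.

Lemma gdist_xx p : gdist p p = 0.
Proof. by rewrite /gdist !subrr enorm0 normr0 sqrtr0 addr0. Qed.

Lemma gdist_triangle q p r : gdist p r <= gdist p q + gdist q r.
Proof.
have sqD (x y : R) : 0 <= x -> 0 <= y -> Num.sqrt (x + y) <= Num.sqrt x + Num.sqrt y.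
  move=> x0 y0; rewrite -(ler_pXn2r (_ : 0 < 2)%N) ?nnegrE ?addr_ge0 ?sqrtr_ge0 //.
  rewrite sqrrD !sqr_sqrtr ?addr_ge0 //.
  have := mulr_ge0 (sqrtr_ge0 x) (sqrtr_ge0 y); lra.
have h1 : enorm (p.1 - r.1) <= enorm (p.1 - q.1) + enorm (q.1 - r.1).
  by apply: le_trans (enormD _ _); rewrite addrA subrK.
have h2 : Num.sqrt `|p.2 - r.2| <= Num.sqrt `|p.2 - q.2| + Num.sqrt `|q.2 - r.2|.
  apply: le_trans (sqD _ _ (normr_ge0 _) (normr_ge0 _)); rewrite ler_wsqrtr //.
  by apply: le_trans (ler_normD _ _); rewrite addrA subrK.
rewrite /gdist; lra.
Qed.

(** The extension is the infimum of [v.2 + b * gdist p v.1] over [v] in [A]; the usual argument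
    works because [gdist] satisfies the triangle inequality. [A] is a relation, and the Lipschitz
    bound makes it single-valued. *)
Lemma mcshane (A : set (('rV[R]_k * R) * R)) (b : R) : 0 <= b ->
  (forall u v, A u -> A v -> `|u.2 - v.2| <= b * gdist u.1 v.1) ->
  exists psi : 'rV[R]_k -> R -> R, lip11_2 psi b /\ forall u, A u -> psi u.1.1 u.1.2 = u.2.
Proof.
move=> b0 hA; have [[a Aa]|nA] := pselect (exists a, A a); last first.
  exists (fun _ _ => 0); split=> [x t y s|u Au]; last by case: nA; exists u.
  by rewrite subrr normr0 mulr_ge0 // addr_ge0 ?enorm_ge0 ?sqrtr_ge0.
pose V p := [set v.2 + b * gdist p v.1 | v in A].
have hV p : has_inf (V p).
  split; first by exists (a.2 + b * gdist p a.1), a.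
  exists (a.2 - b * gdist p a.1) => _ [v Av <-].
  have := hA _ _ Aa Av; rewrite ler_norml => /andP[_ h].
  have : b * gdist a.1 v.1 <= b * gdist p a.1 + b * gdist p v.1.
    by rewrite -mulrDr ler_wpM2l // (gdist_sym p a.1) gdist_triangle.
  lra.
have one p p' : inf (V p) <= inf (V p') + b * gdist p p'.
  rewrite -lerBlDr; apply: lb_le_inf; first by case: (hV p').
  move=> _ [v Av <-]; rewrite lerBlDr.
  apply: (@le_trans _ _ (v.2 + b * gdist p v.1)).
    by apply: ge_inf; [case: (hV p)|exists v].
  rewrite -addrA lerD2l -mulrDr ler_wpM2l // addrC; exact: gdist_triangle.
exists (fun x t => inf (V (x, t))); split.
  move=> x t y s; have := one (x, t) (y, s); have := one (y, s) (x, t).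
  rewrite (gdist_sym (y, s)) /gdist /= => h1 h2; rewrite ler_norml; apply/andP; split; lra.
move=> [[x t] z] Au /=; apply/eqP; rewrite eq_le; apply/andP; split.
  apply: ge_inf; first by case: (hV (x, t)).
  by exists (x, t, z) => //=; rewrite gdist_xx mulr0 addr0.
apply: lb_le_inf; first by case: (hV (x, t)).
move=> _ [v Av <-]; have := hA _ _ Au Av; rewrite /= ler_norml => /andP[_ h]; lra.
Qed.
End McShane.

(** * Lipschitz bound up to the resolution *)

Section NoSteep.
Variables (R : archiRealFieldType) (iota : finType) (e : iota -> nat).
Hypothesis e12 : forall i, (0 < e i <= 2)%N.
Variables (a H J CU CL : nat) (f : (iota -> R) -> R).
Hypothesis H_gt0 : (0 < H)%N.
Hypothesis f_range : forall y, (forall i, 8 <= y i < 9) -> H%:R <= f y <= (2 * H)%:R.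
Notation Omega := {ffun iota -> 'I_(17 * 2 ^ (2 * (J + a)))}.
Notation pos := (@pos R iota e a J).
Notation h := ((slope #|iota| CU CL H)%:R : R).

Lemma slope_ge : H%:R <= h.
Proof. by rewrite ler_nat /slope /hgt /tower_len; lia. Qed.

(** The least [j] with [h * rho j < x]: it is positive because [x <= h], and minimality gives the
    upper bound. *)
Lemma exists_scale (x : R) : h * rho R J < x -> x <= h ->
  exists2 j, (0 < j <= J)%N & h * rho R j < x <= 2 * h * rho R j.
Proof.
move=> hJ xh; have ex : exists j, h * rho R j < x by exists J.
case: (ex_minnP ex) => -[|j] hj min.
  by move: hj; rewrite /rho expn0 invr1 mulr1 => /lt_le_trans /(_ xh); rewrite ltxx.
exists j.+1; first by rewrite min.
rewrite hj /= leNgt; apply/negP => lt.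
have : (j.+1 <= j)%N; last by rewrite ltnn.
apply: min; apply: le_lt_trans lt.
have -> : rho R j.+1 = rho R j / 2 by rewrite -[j.+1]addn1 rhoD {2}/rho expn1.
lra.
Qed.

(** A larger difference of heights exceeds [h * rho J] but not [h], hence falls into the range of
    some scale [j]; there [delta < 2 * rho j], and the pair would be steep. *)
Lemma no_steep_lip (w w' : Omega) (delta : R) : dom e w -> dom e w' -> 0 <= delta ->
  (forall j, (0 < j <= J)%N -> ~ @steep R iota e a H J CU CL f j w w') -> (forall i, `|pos w' i - pos w i| <= delta ^+ e i) ->
  f (pos w') - f (pos w) <= h * (delta + rho R J).
Proof.
move=> dw dw' d0 ns hd; rewrite leNgt; apply/negP => lt.
have /andP[f1 f2] := f_range (domP R dw); have /andP[f1' f2'] := f_range (domP R dw').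
have h0 : 0 < h by apply: lt_le_trans slope_ge; rewrite ltr0n.
have hd0 : 0 <= h * delta by rewrite mulr_ge0 // ltW.
rewrite mulrDr in lt; rewrite natrM in f2'; have sl := slope_ge.
have [j j0 /andP[s1 s2]] : exists2 j, (0 < j <= J)%N & h * rho R j < f (pos w') - f (pos w) <= 2 * h * rho R j.
  by apply: exists_scale; lra.
apply: (ns _ j0); split; first by rewrite s1 s2.
move=> i; apply: (le_lt_trans (hd i)).
have : delta < 2 * rho R j.
  by rewrite -(ltr_pM2l h0); have := mulr_gt0 h0 (rho_gt0 R J); lra.
have := rho_gt0 R j => rj dd.
by case: (e_cases e12 i) => ->; rewrite ?expr1 // ltrXn2r // ltW.
Qed.
End NoSteep.

(** A cluster point along an ultrafilter is a limit. *)
Lemma ultra_cluster (T : topologicalType) (K : set T) (UU : set_system nat) (q : nat -> T) :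
  UltraFilter UU -> compact K -> (forall J, K (q J)) ->
  exists P, K P /\ forall V, nbhs P V -> UU [set J | V (q J)].
Proof.
move=> uU cK qK; have pU : ProperFilter UU by exact: ultra_proper.
have [P [KP clP]] := cK (q @ UU) _ (filterE _ qK).
exists P; split=> // V nV; have [//|nU] := in_ultra_setVsetC [set J | V (q J)] uU.
by have [x []] := clP (~` V) V nU nV.
Qed.

Section Topology.
Variables (R : realType) (m : nat).

Lemma compact_box (P : ppoint R m) (b : R) :
  compact [set Q : ppoint R m | (forall i, P.1 ord0 i - b <= Q.1 ord0 i <= P.1 ord0 i + b) /\
    P.2 - b ^+ 2 <= Q.2 <= P.2 + b ^+ 2].
Proof.
have -> : [set Q : ppoint R m | (forall i, P.1 ord0 i - b <= Q.1 ord0 i <= P.1 ord0 i + b) /\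
    P.2 - b ^+ 2 <= Q.2 <= P.2 + b ^+ 2] =
  [set v : 'rV[R]_m.+1 | forall i, [set` `[P.1 ord0 i - b, P.1 ord0 i + b]%R] (v ord0 i)] `*`
  [set` `[P.2 - b ^+ 2, P.2 + b ^+ 2]%R].
  by apply/seteqP; split=> Q /= [h1 h2]; split=> //=.
apply: compact_setX; last exact: segment_compact.
exact: (@rV_compact _ _ (fun i => [set` `[P.1 ord0 i - b, P.1 ord0 i + b]%R]) (fun i => @segment_compact _ _ _)).
Qed.

Lemma nbhs_pcube (P : ppoint R m) (r : R) : 0 < r -> nbhs P (pcube P r).
Proof.
move=> r0; apply/nbhs_ballP; exists (Num.min r (r ^+ 2)) => /=.
  by rewrite lt_min r0 exprn_gt0.
move=> Q [[_ h1] h2]; split=> [i|].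
  have := h1 ord0 i; rewrite /ball /= distrC => /lt_le_trans -> //.
  by rewrite ge_min lexx.
move: h2; rewrite /ball /= distrC => /lt_le_trans -> //.
by rewrite ge_min lexx orbT.
Qed.
End Topology.

(** * Ultralimits of selections *)

Section Limit.
Variables (R : realType) (m : nat) (U : 'M[R]_m.+1) (o : 'rV[R]_m.+1) (ot ru : R).
Hypothesis U_orth : orthogonal U.
Hypothesis ru_gt0 : 0 < ru.
Variables (S : set (ppoint R m)) (B : R) (Pc : ppoint R m) (H a Fr : nat) (h : R).
Local Notation c := (m.+1%:R : R).
Local Notation bidx := (bidx m).
Local Notation e := (@bexp m).
Local Notation chart_pt := (chart_pt U o ot ru).
Local Notation base_coord := (base_coord U o ot ru).
Local Notation height_coord := (height_coord U o ru).
Local Notation rho := (@rho R).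
Local Notation charted := (charted U o ot ru S).
Local Notation Omega J := {ffun bidx -> 'I_(17 * 2 ^ (2 * (J + a)))}.
Local Notation pos := (@pos R _ e a _).
Hypothesis S_closed : closed S.
Hypothesis h_ge0 : 0 <= h.
Hypothesis region : forall y s, (forall i, -1 <= y i <= 18) -> -1 <= s <= (3 * H)%:R + 1 ->
  pcube Pc (B * ru) (chart_pt y s).
Variable f : (bidx -> R) -> R.
Hypothesis f_sec : forall y, (forall i, 8 <= y i < 9) -> charted y (f y) /\ H%:R <= f y <= (2 * H)%:R.
Variable G : forall J, {set Omega J}.
Hypothesis G_dom : forall J w, w \in G J -> dom e w.
Hypothesis G_card : forall J, (2 ^ ((\sum_i e i) * (J + a)) <= Fr * #|G J|)%N.
Hypothesis G_lip : forall J (w w' : Omega J) (delta : R), w \in G J -> w' \in G J -> 0 <= delta ->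
  (forall i, `|pos w' i - pos w i| <= delta ^+ e i) -> f (pos w') - f (pos w) <= h * (delta + rho J).
Variable UU : set_system nat.
Hypothesis UU_ultra : UltraFilter UU.
Hypothesis UU_infty : \oo `<=` UU.

Definition selection (w : forall J, Omega J) := forall J, w J \in G J.

Definition limit_of (w : forall J, Omega J) y s := forall r, 0 < r ->
  UU [set J | inbox2 e y s r (pos (w J)) (f (pos (w J)))].

(** Every selection is allowed, so that cells escaping a cover at many resolutions always produce a
    limit point, as in [finite_absorption]. *)
Definition limit_set y s := exists2 w, selection w & limit_of w y s.

#[local] Instance UU_proper : ProperFilter UU. Proof. exact: ultra_proper. Qed.

Lemma UU_and P Q : UU P -> UU Q -> UU (P `&` Q).
Proof. exact: filterI. Qed.

Lemma UU_ex P : UU P -> exists J, P J.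
Proof. exact: filter_ex. Qed.

Lemma selection_limit w : selection w -> exists y s, limit_of w y s /\ charted y s.
Proof.
move=> sel; pose q J := chart_pt (pos (w J)) (f (pos (w J))).
have qS J : S (q J) by have [] := f_sec (domP R (G_dom (sel J))).
pose K := [set Q : ppoint R m | (forall i, Pc.1 ord0 i - B * ru <= Q.1 ord0 i <= Pc.1 ord0 i + B * ru) /\
    Pc.2 - (B * ru) ^+ 2 <= Q.2 <= Pc.2 + (B * ru) ^+ 2].
have qK J : K (q J).
  have dp := domP R (G_dom (sel J)); have [_ /andP[f1 f2]] := f_sec dp.
  have [] : pcube Pc (B * ru) (q J).
    have H0 : 0 <= H%:R :> R by [].
    rewrite natrM in f2.
    apply: region => [i|]; last by rewrite natrM; apply/andP; split; lra.
    by have /andP[? ?] := dp i; apply/andP; split; lra.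
  move=> h1 h2; split=> [i|].
    by have := h1 i; rewrite ltr_norml => /andP[? ?]; apply/andP; split; lra.
  by move: h2; rewrite ltr_norml => /andP[? ?]; apply/andP; split; lra.
have [P [_ hP]] := ultra_cluster UU_ultra (@compact_box R m Pc (B * ru)) qK.
have SP : S P.
  apply: contrapT => nS; have oS : open (~` S) by rewrite openC.
  have /UU_ex [J] := hP _ (open_nbhs_nbhs (conj oS nS)).
  by apply; exact: qS.
exists (base_coord P), (height_coord P); split; last by rewrite /charted ptK.
move=> r r0; have c0 : 0 < c by [].
have r'0 : 0 < ru * r / c by rewrite divr_gt0 // mulr_gt0.
apply: filterS (hP _ (nbhs_pcube P r'0)) => J /= hJ.
have cr : c * (ru * r / c) <= ru * r by rewrite mulrC divfK // gt_eqF.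
by have := pcube_chart o ot U_orth ru_gt0 hJ cr; rewrite cy_pt // cs_pt.
Qed.

Lemma UU_rho r : 0 < r -> UU [set J | rho J < r].
Proof.
move=> r0; apply: UU_infty.
have hn : r^-1 < (Num.truncn r^-1).+1%:R by exact: truncnS_gt.
exists (Num.truncn r^-1).+1 => // J /= hJ.
rewrite /rho -[ltRHS]invrK ltf_pV2 ?posrE ?invr_gt0 ?ltr0n ?expn_gt0 //.
apply: (lt_trans hn); rewrite ltr_nat; apply: leq_ltn_trans hJ _; exact: ltn_expl.
Qed.

(** Limits along [UU] are unique, so the given one is the limit in [S] found by compactness; the
    half-open ranges of the base become closed. *)
Lemma limit_set_charted y s : limit_set y s ->
  [/\ charted y s, forall i, 8 <= y i <= 9 & H%:R <= s <= (2 * H)%:R].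
Proof.
move=> [w sel lim]; have [y' [s' [lim' ch]]] := selection_limit sel.
have small (x z : R) : (forall r, 0 < r -> r <= 1 -> `|x - z| < 2 * r) -> x = z.
  move=> hr; apply/eqP; rewrite -subr_eq0 -normr_eq0; apply/eqP/le_anti; rewrite normr_ge0 andbT.
  rewrite leNgt; apply/negP => lt; pose r : R := Num.min 1 (`|x - z| / 4).
  have r0 : 0 < r by rewrite lt_min ltr01 divr_gt0.
  have r1 : r <= 1 by rewrite ge_min lexx.
  have r2 : r <= `|x - z| / 4 by rewrite ge_min lexx orbT.
  by have := hr r r0 r1; lra.
have pw (r : R) i : 0 < r -> r <= 1 -> r ^+ e i <= r.
  by move=> r0 r1; case: i => [i|] /=; rewrite ?expr1 // expr2 ler_piMl // ltW.
have ye : y' = y.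
  apply/funext => i; apply: small => r r0 r1.
  have /UU_ex [J [[h1 _] [h2 _]]] := UU_and (lim _ r0) (lim' _ r0).
  have := h1 i; have := h2 i; have := pw r i r0 r1.
  by rewrite !ltr_norml => ? /andP[? ?] /andP[? ?]; apply/andP; split; lra.
have se : s' = s.
  apply: small => r r0 r1.
  have /UU_ex [J [[_ h1] [_ h2]]] := UU_and (lim _ r0) (lim' _ r0).
  by move: h1 h2; rewrite !ltr_norml => /andP[? ?] /andP[? ?]; apply/andP; split; lra.
rewrite -ye -se; split=> //.
  move=> i; have hh (r : R) : 0 < r -> 8 - r <= y' i <= 9 + r.
    move=> r0; pose r' : R := Num.min 1 r.
    have r'0 : 0 < r' by rewrite lt_min ltr01.
    have r'1 : r' <= 1 by rewrite ge_min lexx.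
    have r'r : r' <= r by rewrite ge_min lexx orbT.
    have /UU_ex [J [h1 _]] := lim' _ r'0.
    have /andP[? ?] := domP R (G_dom (sel J)) i; have := h1 i; have := pw r' i r'0 r'1.
    by rewrite ltr_norml => ? /andP[? ?]; apply/andP; split; lra.
  by apply/andP; split; apply/ler_addgt0Pr => r r0; have /andP[? ?] := hh r r0; lra.
have hh (r : R) : 0 < r -> H%:R - r <= s' <= (2 * H)%:R + r.
  move=> r0; have /UU_ex [J [_ h1]] := lim' _ r0.
  have [_ /andP[? ?]] := f_sec (domP R (G_dom (sel J))).
  by move: h1; rewrite ltr_norml => /andP[? ?]; apply/andP; split; lra.
apply/andP; split; apply/ler_addgt0Pr => r r0; have /andP[? ?] := hh r r0; lra.
Qed.

Lemma limit_set_lip y s y' s' (delta : R) : limit_set y s -> limit_set y' s' -> 0 <= delta ->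
  (forall i, `|y' i - y i| <= delta ^+ e i) -> s' - s <= h * delta.
Proof.
move=> [w sel lim] [w' sel' lim'] d0 hd.
have h0 : 0 <= h := h_ge0.
apply/ler_addgt0Pr => eps eps0.
(* Base points move by [2 * r], the resolution adds less than [r], and the heights move by [2 * r]
   in all: the error stays below [(3 * h + 3) * r]. *)
pose r := eps / (3 * h + 3).
have hp : 0 < 3 * h + 3 by lra.
have r0 : 0 < r by rewrite divr_gt0.
have er : r * (3 * h + 3) = eps by rewrite divfK // gt_eqF.
have /UU_ex [J [[h1 h2] [[h1' h2'] hr]]] :=
  UU_and (lim _ r0) (UU_and (lim' _ r0) (UU_rho r0)).
have hd' i : `|pos (w' J) i - pos (w J) i| <= (delta + 2 * r) ^+ e i.
  have := h1 i; have := h1' i; have := hd i; rewrite !ltr_norml !ler_norml => /andP[? ?] /andP[? ?] /andP[? ?].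
  have : delta ^+ e i + 2 * r ^+ e i <= (delta + 2 * r) ^+ e i.
    by case: (e_cases (@bexp12 m) i) => ->; rewrite ?expr1 ?expr2; nra.
  by move=> ?; apply/andP; split; lra.
have dr : 0 <= delta + 2 * r by lra.
have := G_lip (sel J) (sel' J) dr hd'.
have : h * (delta + 2 * r + rho J) <= h * (delta + 3 * r).
  by apply: ler_wpM2l => //; rewrite /= in hr; lra.
move: h2 h2'; rewrite !ltr_norml => /andP[? ?] /andP[? ?]; rewrite mulrDr; lra.
Qed.

(* If no finite subfamily of the C k absorbs the approximants along UU, select at stage J
   a point avoiding as many C k as possible: the limit of the selection avoids all of them. *)
Lemma finite_absorption (C : nat -> (bidx -> R) -> Prop) :
  (forall y s, limit_set y s -> exists k r, 0 < r /\ forall z, inbox e y r z -> C k z) ->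
  exists K0 : nat, UU [set J | forall w, w \in G J -> exists2 k, (k < K0)%N & C k (pos w)].
Proof.
move=> hC; apply: contrapT => nK.
have avoid K0 : UU [set J | exists2 w, w \in G J & forall k, (k < K0)%N -> ~ C k (pos w)].
  have [h0|] := in_ultra_setVsetC [set J | forall w, w \in G J -> exists2 k, (k < K0)%N & C k (pos w)] UU_ultra.
    by case: nK; exists K0.
  apply: filterS => J /= /existsNP [w /not_implyP [wG nw]]; exists w => // k kK Ck.
  by apply: nw; exists k.
pose good J (n : nat) := `[< (n <= J)%N /\ exists2 w, w \in G J & forall k, (k < n)%N -> ~ C k (pos w) >].
have good0 J : exists n, good J n.
  exists 0%N; apply/asboolP; split=> //.
  have : (0 < #|G J|)%N.
    by rewrite lt0n; apply/negP => /eqP g0; have := G_card J; rewrite g0 muln0 leqn0 expn_eq0.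
  by move/card_gt0P => [w wG]; exists w.
have goodJ J n : good J n -> (n <= J)%N by move/asboolP => [].
have hsel J : exists w, w \in G J /\ forall n, good J n -> forall k, (k < n)%N -> ~ C k (pos w).
  have [n /asboolP [_ [w wG hw]] max] := ex_maxnP (good0 J) (@goodJ J).
  by exists w; split=> // n' /max nn' k kn'; apply: hw; exact: leq_trans nn'.
pose sel J := projT1 (cid (hsel J)).
have sel1 J : sel J \in G J by have [] := projT2 (cid (hsel J)).
have sel2 J n k : good J n -> (k < n)%N -> ~ C k (pos (sel J)).
  by have [_ hh] := projT2 (cid (hsel J)) => g kn; exact: (hh n g k kn).
have [y [s [lim _]]] := selection_limit sel1.
have [k [r [r0 hk]]] := hC y s (ex_intro2 _ _ sel sel1 lim).
have big : UU [set J | (k.+1 <= J)%N] by apply: UU_infty; exists k.+1.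
have /UU_ex [J [[b1 _] [b2 b3]]] := UU_and (lim _ r0) (UU_and (avoid k.+1) big).
apply: (sel2 J k.+1 k _ (ltnSn k) (hk _ b1)).
by apply/asboolP; split.
Qed.
End Limit.

Lemma box_count (I : finType) (N : nat) (X : {set {ffun I -> 'I_N}}) (L : I -> nat) :
  (forall w w', w \in X -> w' \in X -> forall i, (w i <= w' i + L i)%N) ->
  (#|X| <= \prod_i (2 * L i + 1))%N.
Proof.
move=> hX; have [->|[w0 w0X]] := set_0Vmem X; first by rewrite cards0.
apply: (@leq_trans (\sum_(w : {ffun I -> 'I_N})
  [forall i, [pred u : 'I_N | (w0 i - L i <= u)%N && (u < w0 i - L i + (2 * L i + 1))%N] (w i)])%N).
  rewrite -sum1_card [X in (X <= _)%N]big_mkcond; apply: leq_sum => w _; case: ifP => // wX.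
  rewrite lt0b; apply/forallP => i /=.
  have := hX _ _ w0X wX i; have := hX _ _ wX w0X i; move: (nat_of_ord _) (nat_of_ord _) (L i); lia.
rewrite (card_familyE (fun i => [pred u : 'I_N | (w0 i - L i <= u)%N && (u < w0 i - L i + (2 * L i + 1))%N])).
by apply: leq_prod => i _; rewrite /= sum_interval; lia.
Qed.

(** Two of the three [eta] serve to thicken a set of diameter [d] on both sides, the third to absorb
    rounding to the grid. *)
Lemma pow_perturb (R : realFieldType) (n : nat) (d eps : R) : 0 <= d -> 0 < eps ->
  exists2 eta, 0 < eta & (d + 3 * eta) ^+ n <= d ^+ n + eps.
Proof.
move=> d0 eps0.
have [C C0 hC] : exists2 C, 0 <= C & forall x, 0 <= x <= 1 -> (d + x) ^+ n <= d ^+ n + C * x.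
  elim: n => [|n [C C0 hC]]; first by exists 0 => // x _; rewrite !expr0 mul0r addr0.
  exists (d ^+ n + C * d + C); first by rewrite !addr_ge0 ?mulr_ge0 ?exprn_ge0.
  move=> x x01; have := hC x x01; have /andP[x0 x1] := x01.
  rewrite !exprS; have := exprn_ge0 n d0; move: (d ^+ n) ((d + x) ^+ n) => u v u0 h.
  have h1 : (d + x) * v <= (d + x) * (u + C * x) by apply: ler_wpM2l => //; lra.
  have h2 : C * x * x <= C * x by apply: ler_piMr => //; apply: mulr_ge0.
  lra.
pose eta := Num.min (1 / 3) (eps / (3 * (C + 1))).
have Cp : 0 < 3 * (C + 1) by lra.
have e0 : 0 < eta by rewrite lt_min; apply/andP; split; [lra|exact: divr_gt0].
have e1 : eta <= 1 / 3 by rewrite ge_min lexx.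
have e2 : eta * (3 * (C + 1)) <= eps by rewrite -ler_pdivlMr // ge_min lexx orbT.
exists eta => //; apply: le_trans (hC _ _) _; first by apply/andP; split; lra.
lra.
Qed.

Lemma sum_rho (R : archiRealFieldType) n : \sum_(k < n) rho R k.+1 <= 1.
Proof.
suff -> : \sum_(k < n) rho R k.+1 = 1 - rho R n by have := rho_gt0 R n; lra.
elim: n => [|n IH]; first by rewrite big_ord0 /rho expn0 invr1 subrr.
have e : rho R n = 2 * rho R n.+1 by rewrite -[n.+1]addn1 rhoD {3}/rho expn1; field.
by rewrite big_ord_recr /= IH e; ring.
Qed.

(** * Hausdorff measure of the projected limit *)

Section EDist.
Variables (R : realType) (m : nat).

Lemma edist_coord (p q : 'rV[R]_m * R) i : `|p.1 ord0 i - q.1 ord0 i| <= Defs.edist p q.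
Proof.
have -> : p.1 ord0 i - q.1 ord0 i = (p.1 - q.1) ord0 i by rewrite !mxE.
apply: (le_trans (coord_le_enorm _ _)).
by rewrite -[leLHS]ger0_norm ?enorm_ge0 // -sqrtr_sqr ler_wsqrtr // lerDl sqr_ge0.
Qed.

Lemma edist_time (p q : 'rV[R]_m * R) : `|p.2 - q.2| <= Defs.edist p q.
Proof. by rewrite -sqrtr_sqr ler_wsqrtr // lerDr sqr_ge0. Qed.
End EDist.

Section Projection.
Variables (R : realType) (m : nat) (U : 'M[R]_m.+1) (o : 'rV[R]_m.+1) (ot ru : R).
Hypothesis U_orth : orthogonal U.
Hypothesis ru_gt0 : 0 < ru.
Variables (S : set (ppoint R m)) (B : R) (Pc : ppoint R m) (H a Fr : nat) (h : R).
Local Notation bidx := (bidx m).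
Local Notation e := (@bexp m).
Local Notation chart_pt := (chart_pt U o ot ru).
Local Notation rho := (@rho R).
Local Notation charted := (charted U o ot ru S).
Local Notation Omega J := {ffun bidx -> 'I_(17 * 2 ^ (2 * (J + a)))}.
Local Notation pos := (@pos R _ e a _).
Hypothesis S_closed : closed S.
Hypothesis Fr_gt0 : (0 < Fr)%N.
Hypothesis region : forall y s, (forall i, -1 <= y i <= 18) -> -1 <= s <= (3 * H)%:R + 1 ->
  pcube Pc (B * ru) (chart_pt y s).
Variable f : (bidx -> R) -> R.
Hypothesis f_sec : forall y, (forall i, 8 <= y i < 9) -> charted y (f y) /\ H%:R <= f y <= (2 * H)%:R.
Variable G : forall J, {set Omega J}.
Hypothesis G_dom : forall J w, w \in G J -> dom e w.
Hypothesis G_card : forall J, (2 ^ ((\sum_i e i) * (J + a)) <= Fr * #|G J|)%N.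
Variable UU : set_system nat.
Hypothesis UU_ultra : UltraFilter UU.
Hypothesis UU_infty : \oo `<=` UU.

Definition base_proj (y : bidx -> R) : 'rV[R]_m * R :=
  (\row_i (o ord0 (lift ord_max i) + ru * y (Some i)), ot + ru ^+ 2 * y None).

Definition bcoord (p : 'rV[R]_m * R) (i : bidx) : R := if i is Some i then p.1 ord0 i else p.2.

Lemma pc_edist p q i : `|bcoord p i - bcoord q i| <= Defs.edist p q.
Proof. by case: i => [i|]; [exact: edist_coord|exact: edist_time]. Qed.

Lemma pc_pr y z i : bcoord (base_proj y) i - bcoord (base_proj z) i = ru ^+ e i * (y i - z i).
Proof. by case: i => [i|]; rewrite /= ?mxE ?expr1; ring. Qed.

Lemma widen_lift_max (i : 'I_m) : widen_ord (leqnSn m) i = lift ord_max i.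
Proof. by apply: val_inj; rewrite [RHS]lift_max. Qed.

Lemma proj_rot_pt y s : Defs.proj (Defs.rot U (chart_pt y s)) = base_proj y.
Proof.
rewrite /Defs.proj /Defs.rot /chart_pt /base_proj /=; congr pair; apply/rowP => i.
by rewrite [LHS]mxE [RHS]mxE widen_lift_max mulUK // mxE [X in _ + X]mxE rowof_lift.
Qed.

(** For a cover with too small a total, finitely many slightly thickened sets absorb all selected
    cells at some fine resolution. A set of diameter [d] has extent at most [d] in each of the
    [m.+1] base directions, time included, so its share of the unit box is about
    [2 ^ m.+1 * d ^ m.+1 / ru ^ m.+2]. Summing the shares contradicts [G_card]. *)
Lemma Hn_limit (X : set ('rV[R]_m * R)) :
  (forall y s, limit_set f G UU y s -> X (base_proj y)) ->
  ((ru ^+ m.+2 / (Fr%:R * 2 ^+ m.+1))%:E <= Hn X)%E.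
Proof.
(* Any mesh would do; it only ensures that the covering sets have finite diameter. *)
move=> hX; apply: le_trans (content_measure _ _ _ ltr01).
apply: content_lb => F XF dF; rewrite leNgt; apply/negP => lt.
set c0 := ru ^+ m.+2 / _ in lt.
pose d k := fine (diamd (@Defs.edist R m) (F k)).
have d0 k : 0 <= d k by rewrite fine_ge0 // diamd_ge0.
have dE k p p' : F k p -> F k p' -> Defs.edist p p' <= d k.
  move=> Fp Fp'; rewrite -lee_fin fineK.
    exact: diamd_ub Fp Fp'.
  rewrite ge0_fin_numE ?diamd_ge0 //; apply: le_lt_trans (dF k) _; exact: ltry.
set T := (\sum_(k <oo) _)%E in lt.
have T0 : (0 <= T)%E by apply: nneseries_ge0 => k _ _; exact: phi_ge0.
have Tfin : T \is a fin_num by rewrite ge0_fin_numE //; apply: lt_trans lt _; exact: ltry.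
have TE : T = (fine T)%:E by rewrite fineK.
have sum_le K : \sum_(k < K) d k ^+ m.+1 <= fine T.
  rewrite -lee_fin -TE -sumEFin -(big_mkord xpredT (fun k => (d k ^+ m.+1)%:E)).
  by apply: nneseries_lim_ge => k _ _; exact: phi_ge0.
have Tc0 : fine T < c0 by rewrite -lte_fin -TE.
pose eps := (c0 - fine T) / 2.
have eps0 : 0 < eps by rewrite divr_gt0 // subr_gt0.
have hEta k : exists eta, 0 < eta /\ (d k + 3 * eta) ^+ m.+1 <= d k ^+ m.+1 + eps * rho k.+1.
  have [|eta e0 he] := @pow_perturb R m.+1 (d k) (eps * rho k.+1) (d0 k).
    by rewrite mulr_gt0 // rho_gt0.
  by exists eta.
have [eta heta] := choice hEta.
have eta0 k : 0 < eta k by have [] := heta k.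
pose rr := ru + ru ^+ 2.
have rr0 : 0 < rr by rewrite addr_gt0 // exprn_gt0.
have rue i : ru ^+ e i <= rr.
  by case: i => [i|] /=; rewrite ?expr1 /rr ?lerDl ?lerDr ?exprn_ge0 // ltW.
pose C k (y : bidx -> R) := exists2 p, F k p & forall i, `|bcoord (base_proj y) i - bcoord p i| < eta k.
have [y s ys|K0 hK0] := @finite_absorption R m U o ot ru U_orth ru_gt0 S B Pc H a Fr S_closed region f f_sec G G_dom G_card UU UU_ultra UU_infty C.
  have [k _ Fk] := XF _ (hX y s ys).
  exists k; pose r := Num.min 1 (eta k / rr).
  have r0 : 0 < r by rewrite lt_min ltr01 divr_gt0.
  have r1 : r <= 1 by rewrite ge_min lexx.
  have r2 : rr * r <= eta k by rewrite mulrC -ler_pdivlMr // ge_min lexx orbT.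
  exists r; split=> // z hz; exists (base_proj y) => // i.
  rewrite pc_pr normrM gtr0_norm ?exprn_gt0 //; apply: lt_le_trans r2.
  apply: (@lt_le_trans _ _ (ru ^+ e i * r ^+ e i)); first by rewrite ltr_pM2l ?exprn_gt0.
  apply: ler_pM; [by rewrite exprn_ge0 // ltW|by rewrite exprn_ge0 // ltW|exact: rue|].
  by case: i {hz} => [i|] /=; rewrite ?expr1 // expr2 ler_piMl // ltW.
pose emin := \big[Num.min/1]_(k < K0) eta k.
have emin0 : 0 < emin by rewrite /emin; elim/big_rec: _ => // k x _ x0; rewrite lt_min eta0.
have emin_le k : (k < K0)%N -> emin <= eta k.
  by move=> kK; rewrite /emin (bigD1 (Ordinal kK)) //= ge_min lexx.
have [J [absJ]] := UU_ex UU_ultra (UU_and UU_ultra hK0 (UU_rho UU_infty (divr_gt0 emin0 rr0))).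
rewrite /= ltr_pdivlMr // => rJ.
pose ms i : R := mesh R e a J i.
have ms0 i : 0 < ms i by exact: mesh_gt0.
(* Half a grid step, measured in the projection, is below [eta k]: this pays for the [+ 1] in
   [box_count]. *)
have small i k : (k < K0)%N -> ru ^+ e i / (2 * ms i) <= eta k.
  move=> kK; apply: le_trans (emin_le _ kK); rewrite ler_pdivrMr ?mulr_gt0 //.
  have mJ : 1 <= rho J * ms i.
    rewrite /rho /ms /mesh mulrC ler_pdivlMr ?ltr0n ?expn_gt0 // mul1r ler_nat leq_exp2l //.
    apply: (leq_trans (leq_addr a J)); rewrite leq_pmull //; by have /andP[] := @bexp12 m i.
  apply: (le_trans (rue i)).
  have : rho J * rr * ms i <= emin * ms i by rewrite ler_pM2r // ltW.
  have : rr <= rr * (rho J * ms i) by rewrite ler_peMr // ltW.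
  have : 0 < emin * ms i by rewrite mulr_gt0.
  lra.
pose Tk (k : nat) := [set w in G J | `[< C k (pos w) >]].
have cardT k : (k < K0)%N -> #|Tk k|%:R <= 2 ^+ m.+1 * (2 ^ ((\sum_i e i) * (J + a)))%:R / ru ^+ m.+2 * (d k + 3 * eta k) ^+ m.+1.
  move=> kK; pose D := d k + 2 * eta k.
  have D0 : 0 <= D by rewrite addr_ge0 // mulr_ge0 // ltW.
  pose L i := Num.truncn (D * ms i / ru ^+ e i).
  have Lr i : 0 <= D * ms i / ru ^+ e i.
    by rewrite divr_ge0 ?mulr_ge0 ?exprn_ge0 // ltW.
  have hbox : (#|Tk k| <= \prod_i (2 * L i + 1))%N.
    apply: box_count => w w'; rewrite !inE => /andP[wG /asboolP[p Fp hp]] /andP[wG' /asboolP[p' Fp' hp']] i.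
    have hd : ru ^+ e i * (pos w i - pos w' i) <= D.
      rewrite -pc_pr; have := hp i; have := hp' i; have := le_trans (pc_edist p p' i) (dE _ _ _ Fp Fp').
      by rewrite !ltr_norml !ler_norml => /andP[? ?] /andP[? ?] /andP[? ?]; rewrite /D; lra.
    have hw : (w i)%:R - (w' i)%:R <= D * ms i / ru ^+ e i.
      rewrite ler_pdivlMr ?exprn_gt0 //; move: hd.
      rewrite -(ler_pM2r (ms0 i)) /pos mulrBr mulrBl -!mulrA ![_^-1 * _]mulVf ?gt_eqF // !mulr1.
      by rewrite -mulrBr mulrC.
    have := truncnS_gt (D * ms i / ru ^+ e i); rewrite -/(L i) => hL.
    rewrite -ltnS -(ltr_nat R) -natr1 natrD; rewrite -natr1 in hL; lra.
  rewrite -(ler_nat R) natr_prod in hbox; apply: (le_trans hbox).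
  have -> : (2 ^ ((\sum_i e i) * (J + a)))%:R = \prod_i ms i :> R.
    by rewrite /ms /mesh -natr_prod big_distrl /= expn_sum.
  have -> : ru ^+ m.+2 = \prod_i ru ^+ e i by rewrite -expr_sum sum_bexp.
  have -> : 2 ^+ m.+1 = \prod_(i : bidx) (2 : R) by rewrite prodr_const card_bidx.
  have -> : (d k + 3 * eta k) ^+ m.+1 = \prod_(i : bidx) (d k + 3 * eta k) by rewrite prodr_const card_bidx.
  rewrite -prodfV -!big_split /=; apply: ler_prod => i _; rewrite ler0n /=.
  rewrite natrD natrM.
  have hL : (L i)%:R <= D * ms i / ru ^+ e i by rewrite truncn_le.
  apply: (@le_trans _ _ (2 * (D * ms i / ru ^+ e i) + 1)); first by lra.
  have -> : 2 * (D * ms i / ru ^+ e i) + 1 = 2 * ms i / ru ^+ e i * (D + ru ^+ e i / (2 * ms i)).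
    by field; rewrite !gt_eqF ?exprn_gt0.
  rewrite ler_pM2l ?divr_gt0 ?mulr_gt0 ?exprn_gt0 //.
  have := small i k kK; rewrite /D; lra.
pose Q := (2 ^ ((\sum_i e i) * (J + a)))%:R : R.
have Q0 : 0 < Q by rewrite ltr0n expn_gt0.
have Cpos : 0 < 2 ^+ m.+1 * Q / ru ^+ m.+2.
  by apply: divr_gt0; [apply: mulr_gt0 => //; exact: exprn_gt0|exact: exprn_gt0].
have hG : #|G J|%:R <= 2 ^+ m.+1 * Q / ru ^+ m.+2 * (fine T + eps).
  apply: (@le_trans _ _ (\sum_(k < K0) #|Tk k|%:R)).
    rewrite -natr_sum ler_nat.
    have sub : (#|G J| <= \sum_w \sum_(k < K0) (w \in Tk k))%N.
      rewrite -sum1_card [X in (X <= _)%N]big_mkcond; apply: leq_sum => w _; case: ifP => // wG.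
      have [k kK Ck] := absJ w wG.
      rewrite (bigD1 (Ordinal kK)) //= inE wG /=; case: asboolP => //.
    rewrite exchange_big in sub; apply: (leq_trans sub).
    by apply: leq_sum => k _; rewrite -sum1_card [X in (_ <= X)%N]big_mkcond; apply: leq_sum => w _; case: (w \in _).
  apply: (@le_trans _ _ (\sum_(k < K0) 2 ^+ m.+1 * Q / ru ^+ m.+2 * (d k ^+ m.+1 + eps * rho k.+1))).
    apply: ler_sum => k _; apply: (le_trans (cardT k (ltn_ord k))).
    rewrite ler_pM2l //.
    by have [_] := heta k.
  rewrite -mulr_sumr ler_pM2l //.
  rewrite big_split /= -mulr_sumr; have := sum_le K0.
  have : eps * \sum_(k < K0) rho k.+1 <= eps * 1 by apply: ler_wpM2l; [exact: ltW|exact: sum_rho].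
  lra.
have := G_card J; rewrite -(ler_nat R) natrM -/Q => hQ.
have Fr0 : 0 < Fr%:R :> R by rewrite ltr0n.
have := le_trans hQ (ler_wpM2l (ltW Fr0) hG).
have -> : Fr%:R * (2 ^+ m.+1 * Q / ru ^+ m.+2 * (fine T + eps)) = Q * ((fine T + eps) / c0).
  rewrite /c0; field.
  by rewrite !gt_eqF ?exprn_gt0.
have c00 : 0 < c0 by rewrite divr_gt0 ?exprn_gt0 // mulr_gt0 ?exprn_gt0.
rewrite -[X in X <= _]mulr1 ler_pM2l // ler_pdivlMr // mul1r /eps; lra.
Qed.
End Projection.

(** * The theorem *)

Lemma different_components_sym (R : realType) (m : nat) (S A B : set (ppoint R m)) :
  different_components S A B -> different_components S B A.
Proof.
move=> [p [q [Ap Bq pA qB npq]]]; exists q, p; split=> // h; apply: npq.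
exact: connected_component_sym.
Qed.

Lemma pcube_chain (R : realType) (m : nat) (P Q Q' : ppoint R m) (r r' : R) :
  pcube P r Q -> pcube Q r' Q' -> pcube P (r + r') Q'.
Proof.
move=> [h1 h2] [h1' h2'].
have r0 : 0 < r by apply: le_lt_trans (h1 ord0).
have r'0 : 0 < r' by apply: le_lt_trans (h1' ord0).
split=> [i|].
  have := h1 i; have := h1' i; rewrite !ltr_norml => /andP[? ?] /andP[? ?]; apply/andP; split; lra.
move: h2 h2'; rewrite !ltr_norml => /andP[? ?] /andP[? ?].
have : r ^+ 2 + r' ^+ 2 <= (r + r') ^+ 2 by rewrite sqrrD; have := mulr_gt0 r0 r'0; lra.
by move=> ?; apply/andP; split; lra.
Qed.

Lemma pcube_rot (R : realType) (m : nat) (U : 'M[R]_m.+1) (P Q : ppoint R m) (r : R) :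
  orthogonal U -> pcube P (r / m.+1%:R) Q -> pcube (Defs.rot U P) r (Defs.rot U Q).
Proof.
move=> oU [h1 h2]; have c0 : 0 < m.+1%:R :> R by [].
have r0 : 0 < r / m.+1%:R by apply: le_lt_trans (h1 ord0).
split=> [i|] /=.
  have -> : (Q.1 *m U) ord0 i - (P.1 *m U) ord0 i = ((Q.1 - P.1) *m U) ord0 i.
    by rewrite mulmxBl !mxE.
  apply: le_lt_trans (coord_le_enorm _ _) _; rewrite enorm_mul //.
  have -> : r = m.+1%:R * (r / m.+1%:R) by rewrite mulrC divfK // gt_eqF.
  by apply: enorm_lt => // j; rewrite !mxE.
have rr : 0 < r by move: r0; rewrite pmulr_lgt0 ?invr_gt0.
apply: lt_le_trans h2 _; rewrite lerXn2r ?nnegrE ?(ltW r0) ?(ltW rr) //.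
by rewrite ler_pdivrMr // ler_peMr ?ler1n // ltW.
Qed.

Section Center.
Variables (R : realType) (m : nat).
Local Notation c := (m.+1%:R : R).
Local Notation e := (@bexp m).

Lemma center_chart (U : 'M[R]_m.+1) (X : 'rV[R]_m.+1) (t ru : R) (H : nat) : orthogonal U -> 0 < ru ->
  exists (o : 'rV[R]_m.+1) (ot : R), [/\ chart_pt U o ot ru (fun=> 17 / 2) H%:R = (X, t),
    forall i, base_coord U o ot ru (X, t) i = 17 / 2 & height_coord U o ru (X, t) = H%:R].
Proof.
move=> oU ru0; exists (X *m U - ru *: rowof (fun=> 17 / 2) H%:R), (t - ru ^+ 2 * (17 / 2)).
have ptA : chart_pt U (X *m U - ru *: rowof (fun=> 17 / 2) H%:R) (t - ru ^+ 2 * (17 / 2)) ru (fun=> 17 / 2) H%:R = (X, t).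
  by rewrite /chart_pt !subrK mulUTK.
by split=> // [i|]; rewrite -ptA ?cy_pt ?cs_pt.
Qed.

(** From the center [17 / 2] the ends of [[-1, 18]] are [19 / 2 < 11] away, and from height [H] the
    ends of the height window at most [2 * H + 1]. *)
Lemma chart_region (U : 'M[R]_m.+1) (o : 'rV[R]_m.+1) (ot ru : R) (H : nat) (X : 'rV[R]_m.+1) (t r1 : R) P1 y s :
  orthogonal U -> 0 < ru -> (0 < H)%N -> chart_pt U o ot ru (fun=> 17 / 2) H%:R = (X, t) ->
  pcube P1 r1 (X, t) ->
  (forall i, -1 <= y i <= 18) -> -1 <= s <= (3 * H)%:R + 1 ->
  pcube P1 (r1 + c * (ru * (3 * H + 11)%:R)) (chart_pt U o ot ru y s).
Proof.
move=> oU ru0 H0 ptA hX hy /andP[s1 s2]; apply: pcube_chain hX _; rewrite -ptA; apply: pt_pcube => //.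
have Hp : 1 <= H%:R :> R by rewrite ler1n.
rewrite natrM in s2; rewrite natrD natrM; split=> [i|]; last first.
  by rewrite ltr_norml; apply/andP; split; lra.
have /andP[? ?] := hy i.
have : 11 <= (3 * H%:R + 11) ^+ e i :> R.
  by case: (e_cases (@bexp12 m) i) => ->; rewrite ?expr1 ?expr2; nra.
by move=> ?; rewrite ltr_norml; apply/andP; split; lra.
Qed.
End Center.

Lemma gdist_coord (R : realType) (m : nat) (o : 'rV[R]_m.+1) (ot ru : R) (y z : bidx m -> R) i : 0 < ru ->
  `|z i - y i| <= (gdist (base_proj o ot ru z) (base_proj o ot ru y) / ru) ^+ bexp i.
Proof.
move=> ru0.
rewrite expr_div_n ler_pdivlMr ?exprn_gt0 // mulrC -[X in X * _](gtr0_norm (exprn_gt0 (bexp i) ru0)) -normrM.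
rewrite -(@pc_pr R m o ot); set p := base_proj _ _ _ z; set p' := base_proj _ _ _ y.
have e0 := enorm_ge0 (p.1 - p'.1); have s0 := sqrtr_ge0 `|p.2 - p'.2|.
case: i => [i|] /=.
  rewrite expr1; have -> : p.1 ord0 i - p'.1 ord0 i = (p.1 - p'.1) ord0 i by rewrite !mxE.
  apply: (le_trans (coord_le_enorm _ _)); rewrite /gdist; lra.
have -> : `|p.2 - p'.2| = Num.sqrt `|p.2 - p'.2| ^+ 2 by rewrite sqr_sqrtr.
by rewrite lerXn2r ?nnegrE // /gdist ?addr_ge0 ?lerDr.
Qed.

Lemma base_range_widen (R : realFieldType) (x : R) : 8 <= x <= 9 -> -1 <= x <= 18.
Proof. by move=> /andP[? ?]; apply/andP; split; lra. Qed.

Lemma height_range_widen (R : realFieldType) (H : nat) (x : R) :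
  H%:R <= x <= (2 * H)%:R -> -1 <= x <= (3 * H)%:R + 1.
Proof.
have H0 : 0 <= H%:R :> R by [].
by rewrite !natrM => /andP[? ?]; apply/andP; split; lra.
Qed.

(** * The piece produced at a center with good times *)

Section LocalPiece.
Variables (R : realType) (m : nat) (M g1 : R) (a H CU CL : nat).
Local Notation c := (m.+1%:R : R).
Local Notation Fr := (frac m.+1 m.+2 a CU CL H).
Local Notation h := ((slope m.+1 CU CL H)%:R : R).
Variable B : R.
(** In units of [ru]: the reach of the chart window from its center, plus the radius [r1]. *)
Hypothesis B_def : B = c * (3 * H + 11)%:R + c / g1.
Hypothesis M_gt0 : 0 < M.
Hypothesis g1_gt0 : 0 < g1.
Hypothesis a_gt0 : (0 < a)%N.
Hypothesis a_g1 : rho R a * c ^+ 2 <= g1.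
Hypothesis H_gt0 : (0 < H)%N.
Hypothesis H_big : 2 * c ^+ 2 / g1 <= H%:R.
Hypothesis CU_gt0 : (0 < CU)%N.
Hypothesis CL_gt0 : (0 < CL)%N.
Hypothesis CU_big : (4 ^ m.+2)%:R * (2 * M ^+ 2 * (2 * c * B) ^+ m.+2) <= CU%:R.
Hypothesis CL_big : M ^+ 2 * c ^+ (2 * m.+2) <= CL%:R.

Lemma local_piece (S : set (ppoint R m)) (P1 : ppoint R m) (r1 Rmax : R) :
  closed S -> parabolic_ADR S M -> weak_ts_two_cube S g1 ->
  S P1 -> (Rmax%:E < pdiam S)%E -> 0 < r1 -> r1 <= Rmax -> g1 * r1 <= Rmax -> B * (g1 * r1 / c) <= Rmax ->
  (forall t, `|t - P1.2| <= (B * (g1 * r1 / c)) ^+ 2 -> time_ok S t) ->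
  exists (U : 'M[R]_m.+1) (psi : 'rV[R]_m -> R -> R), [/\ rotation U, lip11_2 psi h &
    forall X, (forall Q, S Q -> pcube P1 (B * (g1 * r1 / c)) Q -> graph psi (Defs.rot U Q) -> X (Defs.proj (Defs.rot U Q))) ->
     (((g1 * r1 / c) ^+ m.+2 / (Fr%:R * 2 ^+ m.+1))%:E <= Hn X)%E].
Proof.
move=> Scl adr tc SP1 RS r10 r1R gR BR times.
(* With this unit [c * ru = g1 * r1] is at most the radius of the two cubes, so the vertical
   segments over the unit box begin in one cube and end in the other. *)
set ru := g1 * r1 / c in BR times *.
have c0 : 0 < c by []. have c1 : 1 <= c by rewrite ler1n.
have ru0 : 0 < ru by rewrite divr_gt0 // mulr_gt0.
have cru : c * ru = g1 * r1 by rewrite /ru mulrC divfK // gt_eqF.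
have r1E : r1 = c / g1 * ru by rewrite /ru; field; rewrite !gt_eqF.
have BE : r1 + c * (ru * (3 * H + 11)%:R) = B * ru by rewrite B_def r1E; ring.
have adm : admissible S P1 r1.
  have [t0 t1] : time_ok S P1.2 by apply: times; rewrite subrr normr0 sqr_ge0.
  by split=> //; apply: le_lt_trans RS; rewrite lee_fin.
have [rh [X1 [X2 [t [hr1 hr2 sub1 sub2 dc]]]]] := tc _ _ adm.
have [U [rotU Uax]] := rotation_to_axis (X1 - X2).
have oU : orthogonal U by case: rotU.
have rh0 : 0 < rh by apply: lt_le_trans hr1; rewrite mulr_gt0.
have self X : pcube (X, t) rh (X, t).
  by split=> [i|] /=; rewrite subrr normr0 ?exprn_gt0.
have [XA [XB [subA subB dcAB [axAB AB]]]] : exists XA XB, [/\ pcube P1 r1 (XA, t), pcube P1 r1 (XB, t),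
    different_components S (pcube (XA, t) rh `&` slab S) (pcube (XB, t) rh `&` slab S) &
    (forall i, i != ord_max -> (XA *m U) ord0 i = (XB *m U) ord0 i) /\
    (XA *m U) ord0 ord_max <= (XB *m U) ord0 ord_max].
  have ax i : i != ord_max -> (X1 *m U) ord0 i = (X2 *m U) ord0 i.
    by move=> /Uax; rewrite mulmxBl !mxE => /eqP; rewrite subr_eq0 => /eqP.
  case: (leP ((X1 *m U) ord0 ord_max) ((X2 *m U) ord0 ord_max)) => le12.
    by exists X1, X2; split=> //; [exact: sub1|exact: sub2].
  exists X2, X1; split; [exact: sub2|exact: sub1|exact: different_components_sym|split=> [i /ax ->//|]].
  exact: ltW.
have [ov [ot [ptA cyA csA]]] := center_chart XA t H oU ru0.
have region0 y s : (forall i, -1 <= y i <= 18) -> -1 <= s <= (3 * H)%:R + 1 -> pcube P1 (B * ru) (chart_pt U ov ot ru y s).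
  by move=> hy hs; rewrite -BE; exact: chart_region ptA subA hy hs.
have region y s : (forall i, -1 <= y i <= 18) -> -1 <= s <= (3 * H)%:R + 1 ->
    time_ok S (chart_pt U ov ot ru y s).2 /\ pcube P1 (B * ru) (chart_pt U ov ot ru y s).
  move=> hy hs; have h1 := region0 _ _ hy hs; split=> //; apply: times.
  by case: h1 => _ /ltW.
have tP1 : time_ok S P1.2 by case: adm.
have cruR : c * ru <= Rmax by rewrite cru.
have cyB i : base_coord U ov ot ru (XB, t) i = 17 / 2.
  rewrite -(cyA i); case: i => [i|] //.
  have := axAB (lift ord_max i); rewrite eq_sym neq_lift => /(_ isT) ax.
  by rewrite /base_coord mxE [X in _ = X / _]mxE ax.
pose ht := height_coord U ov ru (XB, t).
have csAB : ht - H%:R = ((XB *m U) ord0 ord_max - (XA *m U) ord0 ord_max) / ru.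
  by rewrite -csA /ht /height_coord -mulrBl; congr (_ / _); rewrite !mxE; ring.
(* Both centers are within [r1] of [P1] in each coordinate, so their distance is at most
   [2 * c * r1], that is [2 * c ^ 2 / g1] units; [H_big] bounds this by [H]. *)
have htH : H%:R <= ht <= (2 * H)%:R.
  have : 0 <= ht - H%:R by rewrite csAB divr_ge0 ?subr_ge0 // ltW.
  have : ht - H%:R <= H%:R.
    apply: le_trans H_big; rewrite csAB ler_pdivrMr //.
    have -> : 2 * c ^+ 2 / g1 * ru = c * (2 * r1) by rewrite r1E; field; rewrite gt_eqF.
    have -> : (XB *m U) ord0 ord_max - (XA *m U) ord0 ord_max = ((XB - XA) *m U) ord0 ord_max.
      by rewrite mulmxBl !mxE.
    apply: (le_trans (ler_norm _)); apply: (le_trans (coord_le_enorm _ _)); rewrite enorm_mul //.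
    apply: enorm_le => i; have [/(_ i) hA _] := subA; have [/(_ i) hB _] := subB; rewrite /= in hA hB.
    rewrite !mxE; move: hA hB; rewrite !ltr_norml ler_norml => /andP[? ?] /andP[? ?].
    by apply/andP; split; lra.
  by rewrite natrM => ? ?; apply/andP; split; lra.
have cru_rh : c * ru <= rh by rewrite cru.
have [f hf] := chart_section oU ru0 region cru_rh htH H_gt0 cyA cyB csA erefl dcAB.
pose E := charted U ov ot ru S.
have pieces J := discrete_pieces (@bexp12 m) H_gt0 a_gt0 CU_gt0 CL_gt0
  (chart_hits_upper oU ru0 M_gt0 adr RS cruR BR SP1 tP1 region a J CU_big)
  (fun j y s => @chart_hits_lower _ _ _ _ _ _ oU ru0 _ _ _ _ _ _ M_gt0 adr RS cruR region a J CL j y s CL_big)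
  (@cconn_sym _ _ _ _ _ _ _) (@cconn_trans _ _ _ _ _ _ _) (@chart_conn_seg _ _ _ _ _ _ _)
  (fun j y s => @chart_conn_box _ _ _ _ _ _ oU ru0 _ _ _ _ _ RS cruR region g1 a j y s tc a_g1 H_gt0) hf.
pose G J := projT1 (cid (pieces J)).
have G_dom J w : w \in G J -> dom (@bexp m) w by have [hh _ _] := projT2 (cid (pieces J)); exact: hh.
have G_card J : (2 ^ ((\sum_i @bexp m i) * (J + a)) <= Fr * #|G J|)%N.
  have [_ hh _] := projT2 (cid (pieces J)); apply: (leq_trans hh).
  by rewrite leq_mul2r; apply/orP; right; rewrite card_bidx sum_bexp.
have G_lip J (w w' : {ffun bidx m -> 'I_(17 * 2 ^ (2 * (J + a)))}) (delta : R) : w \in G J -> w' \in G J -> 0 <= delta ->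
  (forall i, `|pos R (@bexp m) w' i - pos R (@bexp m) w i| <= delta ^+ bexp i) ->
  f (pos R (@bexp m) w') - f (pos R (@bexp m) w) <= h * (delta + rho R J).
  move=> wG w'G d0 hd; have [_ _ ns] := projT2 (cid (pieces J)).
  have := @no_steep_lip R _ (@bexp m) (@bexp12 m) a H J CU CL f H_gt0 (fun y hy => (hf y hy).2) w w' delta
    (G_dom _ _ wG) (G_dom _ _ w'G) d0 (fun j hj => ns j w w' hj wG w'G) hd.
  by rewrite card_bidx.
have [UU [UU_ultra UU_infty]] := ultraFilterLemma (_ : ProperFilter \oo).
have Fr0 : (0 < Fr)%N by rewrite /frac muln_gt0 expn_gt0.
have h0 : 0 <= h by [].
pose L := limit_set f G UU.
have Lprop y s (l : L y s) := limit_set_charted oU ru0 Scl region0 hf G_dom UU_ultra l.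
pose A := [set u : ('rV[R]_m * R) * R | exists y s, L y s /\ u = (base_proj ov ot ru y, ov ord0 ord_max + ru * s)].
have A_lip u v : A u -> A v -> `|u.2 - v.2| <= h * gdist u.1 v.1.
  have one y s y' s' : L y s -> L y' s' -> ru * s' - ru * s <= h * gdist (base_proj ov ot ru y') (base_proj ov ot ru y).
    move=> l l'; rewrite -mulrBr mulrC -ler_pdivlMr // -mulrA.
    apply: (limit_set_lip h0 G_lip UU_ultra UU_infty l l').
      by rewrite divr_ge0 ?gdist_ge0 // ltW.
    by move=> i; exact: gdist_coord.
  move=> [y [s [l ->]]] [y' [s' [l' ->]]] /=; have := one _ _ _ _ l l'; have := one _ _ _ _ l' l.
  rewrite (gdist_sym (base_proj ov ot ru y')) => h1 h2.
  by rewrite opprD addrACA subrr add0r ler_norml lerNl opprB h1 h2.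
have [psi [psi_lip psiA]] := mcshane h0 A_lip.
exists U, psi; split=> // X hX.
apply: (Hn_limit oU ru0 Scl Fr0 region0 hf G_dom G_card UU_ultra UU_infty) => y s l.
have [ch hy hs] := Lprop _ _ l.
rewrite -(proj_rot_pt ov ot ru oU y s); apply: hX => //.
  by apply: region0 => [i|]; [exact: base_range_widen|exact: height_range_widen].
have := psiA (base_proj ov ot ru y, ov ord0 ord_max + ru * s) (ex_intro _ y (ex_intro _ s (conj l erefl))).
rewrite -(proj_rot_pt ov ot ru oU y s) /graph /= => ->.
by rewrite mulUK // mxE [X in _ + X]mxE rowof_max.
Qed.
End LocalPiece.

Lemma pcube_le (R : realType) (m : nat) (P : ppoint R m) (r r' : R) : r <= r' -> pcube P r `<=` pcube P r'.
Proof.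
move=> rr Q [h1 h2]; have r0 : 0 < r by apply: le_lt_trans (h1 ord0).
split=> [i|]; first exact: lt_le_trans (h1 i) rr.
by apply: lt_le_trans h2 _; rewrite lerXn2r ?nnegrE ?(ltW r0) // (le_trans (ltW r0)).
Qed.

Lemma exists_nat_ge (R : realType) (x : R) : exists n : nat, (0 < n)%N /\ x <= n%:R.
Proof. by exists (Num.truncn x).+1; split=> //; apply/ltW/truncnS_gt. Qed.

Theorem theorem3p4 (R : realType) (m : nat) (M g1 : R) :
  0 < M -> 0 < g1 < 1 ->
  exists eps b : R, 0 < eps /\ 0 < b /\
    forall S : set (ppoint R m),
      closed S -> parabolic_ADR S M -> weak_ts_two_cube S g1 ->
      UBP_lip_graphs S eps b.
Proof.
move=> M0 /andP[g0 g1lt].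
have [cT cT0 hT] := time_good m M0.
pose c : R := m.+1%:R; have c0 : 0 < c by rewrite ltr0n.
have c1 : 1 <= c by rewrite ler1n.
have [a [a0 ha]] := exists_nat_ge (c ^+ 2 / g1).
have ag : rho R a * c ^+ 2 <= g1.
  rewrite /rho mulrC ler_pdivrMr ?ltr0n ?expn_gt0 // mulrC -ler_pdivrMr //.
  by apply: (le_trans ha); rewrite ler_nat ltnW // ltn_expl.
have [H [H0 hH]] := exists_nat_ge (2 * c ^+ 2 / g1).
pose B := c * (3 * H + 11)%:R + c / g1.
have [CU [CU0 hCU]] := exists_nat_ge ((4 ^ m.+2)%:R * (2 * M ^+ 2 * (2 * c * B) ^+ m.+2)).
have [CL [CL0 hCL]] := exists_nat_ge (M ^+ 2 * c ^+ (2 * m.+2)).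
pose B' := B * g1 / c.
have B'E : B' = (3 * H + 11)%:R * g1 + 1 by rewrite /B' /B; field; rewrite !gt_eqF.
have B'1 : 1 <= B' by rewrite B'E lerDr mulr_ge0 // ltW.
have B'0 : 0 < B' by apply: lt_le_trans B'1.
(* The piece will lie within [mu * r0] of [P1]. Together with the displacement [r0 / (2 * c)] of
   [P1] this is at most [r0 / c], as rotating the cube requires; [mu <= 1] and [mu <= cT] give
   [(mu * r0) ^ 2 <= cT * r0 ^ 2], the range of good times. *)
pose mu := Num.min (1 / (2 * c)) (Num.min 1 cT).
have mu0 : 0 < mu by rewrite !lt_min ltr01 cT0 divr_gt0 ?mulr_gt0.
have mu1 : mu <= 1 / (2 * c) by rewrite ge_min lexx.
have mu2 : mu <= 1 by rewrite !ge_min lexx !orbT.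
have mu3 : mu <= cT by rewrite !ge_min lexx !orbT.
pose kap := mu / B'.
have kap0 : 0 < kap by rewrite divr_gt0.
have kap1 : kap <= 1 by rewrite ler_pdivrMr // mul1r (le_trans mu2).
pose Fr := frac m.+1 m.+2 a CU CL H.
have Fr0 : 0 < Fr%:R :> R by rewrite ltr0n /Fr /frac muln_gt0 expn_gt0.
exists ((g1 * kap / c) ^+ m.+2 / (Fr%:R * 2 ^+ m.+1)), (slope m.+1 CU CL H)%:R.
split.
  apply: divr_gt0; last by rewrite mulr_gt0 // exprn_gt0.
  by apply: exprn_gt0; rewrite divr_gt0 // mulr_gt0.
split; first by rewrite ltr0n /slope /hgt addn3.
move=> S Scl adr tc P0 r0 adm0; have [SP0 _ _ r00 r0d] := adm0.
have [P1 [SP1 cP1 hP1]] := hT S adr P0 r0 adm0.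
have Br : B * (g1 * (kap * r0) / c) = mu * r0.
  have -> : B * (g1 * (kap * r0) / c) = B' * kap * r0 by rewrite /B'; field; rewrite gt_eqF.
  by rewrite /kap mulrC [B' * _]mulrC divfK ?gt_eqF // mulrC.
have krr : kap * r0 <= r0 by rewrite ler_piMl // ltW.
have kr0 : 0 < kap * r0 by rewrite mulr_gt0.
have [||t ht|U [psi [rotU lipU hU]]] := @local_piece R m M g1 a H CU CL B erefl M0 g0 a0 ag H0 hH CU0 CL0 hCU hCL
  S P1 (kap * r0) r0 Scl adr tc SP1 r0d kr0 krr.
- by apply: le_trans krr; rewrite ler_piMl ?ltW.
- by rewrite Br ler_piMl // ltW.
- apply: hP1; apply: (le_trans ht); rewrite Br exprMn ler_wpM2r ?sqr_ge0 //.
  by apply: le_trans mu3; rewrite expr2 ler_piMl // ltW.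
exists U, psi; split=> //.
have -> : (g1 * kap / c) ^+ m.+2 / (Fr%:R * 2 ^+ m.+1) * r0 ^+ m.+2 =
    (g1 * (kap * r0) / c) ^+ m.+2 / (Fr%:R * 2 ^+ m.+1).
  by rewrite mulrAC -exprMn; congr (_ ^+ _ / _); ring.
apply: hU => Q SQ cQ gQ; exists (Defs.rot U Q) => //; split=> //; split; first by exists Q.
apply: pcube_rot; first by case: rotU.
rewrite Br in cQ; apply: pcube_le (pcube_chain cP1 cQ).
have -> : r0 / m.+1%:R = r0 / (2 * c) + 1 / (2 * c) * r0 by rewrite -/c; field; rewrite gt_eqF.
by rewrite lerD2l ler_pM2r.
Qed.
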